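(* Let $\Gamma,p\colon\mathbb{R}\to\mathbb{R}$ be BPUC functions such that the limits $\gamma_\pm:=\lim_{t\to\pm\infty}\Gamma(t)$ exist and are finite, and consider $$y'=-\big(y-\Gamma(t)\big)^2+p(t),\qquad(\ast)$$ whose solution with value $y_0$ at $t=s$ is denoted by $y(t,s,y_0)$. Assume that $x'=-x^2+p(t)$ has an attractor-repeller pair $(\tilde a,\tilde r)$, and let $(\tilde{\mathfrak a}_\pm,\tilde{\mathfrak r}_\pm):=(\tilde a+\gamma_\pm,\tilde r+\gamma_\pm)$, which are the attractor-repeller pairs of $y'=-(y-\gamma_\pm)^2+p(t)$. Then: (i) there exist the functions $\mathfrak a$ and $\mathfrak r$ associated to $(\ast)$ (see context). (ii) $\lim_{t\to-\infty}|\mathfrak a(t)-\tilde{\mathfrak a}_-(t)|=0$; $\lim_{t\to-\infty}|y(t,s,y_0)-\tilde{\mathfrak r}_-(t)|=0$ whenever $\mathfrak a(s)$ exists and $y_0<\mathfrak a(s)$; $\lim_{t\to+\infty}|\mathfrak r(t)-\tilde{\mathfrak r}_+(t)|=0$; and $\lim_{t\to+\infty}|y(t,s,y_0)-\tilde{\mathfrak a}_+(t)|=0$ whenever $\mathfrak r(s)$ exists and $y_0>\mathfrak r(s)$. (iii) The solutions $\mathfrak a$ and $\mathfrak r$ are respectively locally pullback attractive and locally pullback repulsive. (iv) If $\mathfrak a$ and $\mathfrak r$ are globally defined and different, then they are uniformly separated, and hence $(\mathfrak a,\mathfrak r)$ is an attractor-repeller pair for $(\ast)$. (v) If the equation $(\ast)$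 does not have hyperbolic solutions, then it has at most one bounded solution $\mathfrak a=\mathfrak r$.
   Context: BPUC functions: a set $\Delta=\{a_j\mid j\in\mathbb{Z}\}\subset\mathbb{R}$ is disperse if $\inf_{j\in\mathbb{Z}}(a_{j+1}-a_j)>0$. $BPUC_\Delta(\mathbb{R},\mathbb{R})$ is the set of bounded right-continuous functions $q\colon\mathbb{R}\to\mathbb{R}$ such that for all $\varepsilon>0$ there is $\delta>0$ such that, if $t_1,t_2\in(a_j,a_{j+1})$ for some $j\in\mathbb{Z}$ and $|t_2-t_1|<\delta$, then $|q(t_2)-q(t_1)|<\varepsilon$. A function $q$ is BPUC if $q=q_1+\cdots+q_n$ with $q_i\in BPUC_{\Delta_i}(\mathbb{R},\mathbb{R})$ for finitely many disperse sets $\Delta_1,\dots,\Delta_n$. Solutions are in the Carathéodory sense (absolutely continuous on compact intervals, satisfying the equation a.e.), maximally extended. ''Bounded solution'' means globally defined and bounded on $\mathbb{R}$. All equations here have the form $x'=-x^2+Q(t)x+P(t)$ with $Q,P$ BPUC (for $(\ast)$, $Q=2\Gamma$ and $P=p-\Gamma^2$). Functions $\mathfrak a,\mathfrak r$: if some solution is bounded as $t\to-\infty$, then there is a maximal solution $\mathfrak a\colon(-\infty,\beta)\to\mathbb{R}$, $\beta\le\infty$, such that for $s<\beta$ the solution $y(t,s,y_0)$ remains bounded as $t\to-\infty$ iff $y_0\le\mathfrak a(s)$, and $\lim_{t\to\beta^-}\mathfrak a(t)=-\infty$ if $\beta<\infty$. If some solution is bounded as $t\to+\infty$, then there is a maximal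 solution $\mathfrak r\colon(\alpha,\infty)\to\mathbb{R}$, $\alpha\ge-\infty$, such that for $s>\alpha$ the solution $y(t,s,y_0)$ remains bounded as $t\to+\infty$ iff $y_0\ge\mathfrak r(s)$, and $\lim_{t\to\alpha^+}\mathfrak r(t)=\infty$ if $\alpha>-\infty$. Assertion (i) means that both kinds of half-bounded solutions exist, so that $\mathfrak a$ and $\mathfrak r$ are defined. A bounded solution $\tilde b$ is hyperbolic if there exist $k\ge1$, $\beta>0$ with either $\exp\int_s^t(-2\tilde b(l)+Q(l))\,dl\le k e^{-\beta(t-s)}$ whenever $t\ge s$ (attractive), or $\exp\int_s^t(-2\tilde b(l)+Q(l))\,dl\le k e^{\beta(t-s)}$ whenever $t\le s$ (repulsive). Globally defined solutions $x_1\le x_2$ are uniformly separated if $\inf_{t\in\mathbb{R}}(x_2(t)-x_1(t))>0$. An attractor-repeller pair $(a,r)$ consists of the maximal bounded solution $a$ and the minimal bounded solution $r$ when they are hyperbolic, with $a$ attractive and $r$ repulsive (equivalently, when they are uniformly separated). A solution $\bar a\colon(-\infty,\beta)\to\mathbb{R}$ is locally pullback attractive if there exist $s_0<\beta$ and $\delta>0$ such that, if $s\le s_0$ and $|y_0-\bar a(s)|<\delta$, then $y(t,s,y_0)$ is defined on $[s,s_0]$ and, in addition, $\lim_{s\to-\infty}\max_{y_0\in[\bar a(s)-\delta,\bar a(s)+\delta]}|\bar a(t)-y(t,s,y_0)|=0$ for all $t\le s_0$. (In this scalar case this is equivalent to: for $s\le s_0$ the solutions $y(t,s,\bar a(s)\pm\delta)$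 are defined on $[s,s_0]$ and $\lim_{s\to-\infty}|\bar a(t)-y(t,s,\bar a(s)\pm\delta)|=0$ for all $t\le s_0$.) A solution $\bar r\colon(\alpha,\infty)\to\mathbb{R}$ is locally pullback repulsive if there exist $s_0>\alpha$ and $\delta>0$ such that, if $s\ge s_0$, the solutions $y(t,s,\bar r(s)\pm\delta)$ are defined on $[s_0,s]$ and $\lim_{s\to\infty}|\bar r(t)-y(t,s,\bar r(s)\pm\delta)|=0$ for all $t\ge s_0$. *)

(* Defs.v *)
From HB Require Import structures.
From mathcomp Require Export all_boot all_order all_algebra.
From mathcomp Require Export all_classical all_reals all_analysis.
From mathcomp Require Import ring.

Set Implicit Arguments.
Unset Strict Implicit.
Unset Printing Implicit Defensive.

Export Order.TTheory GRing.Theory Num.Theory.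
Export numFieldNormedType.Exports.

Local Open Scope classical_set_scope.
Local Open Scope ring_scope.

Section BPUC.
Variable R : realType.

(* [inf] is 0 on sets that are not bounded below, so [0 < inf _] is never
   true by default. *)
Definition disperse (d : int -> R) : Prop :=
  0 < inf (range (fun j : int => d (j + 1) - d j)).

Definition BPUC_on (d : int -> R) (q : R -> R) : Prop :=
  [/\ exists M, forall t, `|q t| <= M,
      forall t, q x @[x --> t^'+] --> q t &
      forall e, 0 < e -> exists2 delta, 0 < delta &
        forall (j : int) t1 t2,
          d j < t1 < d (j + 1) -> d j < t2 < d (j + 1) ->
          `|t2 - t1| < delta -> `|q t2 - q t1| < e].

Definition BPUC (q : R -> R) : Prop :=
  exists (n : nat) (d : 'I_n.+1 -> int -> R) (qs : 'I_n.+1 -> R -> R),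
    (forall i, disperse (d i) /\ BPUC_on (d i) (qs i)) /\
    forall t, q t = \sum_i qs i t.

End BPUC.

Section Caratheodory.
Variable R : realType.

Definition abs_continuous (c d : R) (f : R -> R) : Prop :=
  forall e, 0 < e -> exists2 delta, 0 < delta &
    forall (n : nat) (u v : 'I_n -> R),
      (forall i, c <= u i /\ u i < v i /\ v i <= d) ->
      trivIset setT (fun i => `]u i, v i[%classic) ->
      \sum_i (v i - u i) < delta ->
      \sum_i `|f (v i) - f (u i)| < e.

Definition riccati (Q P : R -> R) (t x : R) : R :=
  - x ^+ 2 + Q t * x + P t.

(* The equation y' = -(y - G t)^2 + p t is the one with coefficients
   [shiftQ G] and [shiftP G p]; see [riccati_shift]. *)
Definition shiftQ (G : R -> R) : R -> R := fun t => 2 * G t.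
Definition shiftP (G p : R -> R) : R -> R := fun t => p t - G t ^+ 2.

Lemma riccati_shift (G p : R -> R) (t y : R) :
  riccati (shiftQ G) (shiftP G p) t y = - (y - G t) ^+ 2 + p t.
Proof. rewrite /riccati /shiftQ /shiftP; ring. Qed.

(* The values of [x] outside the interval [D] are irrelevant. *)
Definition solution (Q P : R -> R) (D : set R) (x : R -> R) : Prop :=
  [/\ is_interval D,
      forall c d, c <= d -> `[c, d]%classic `<=` D -> abs_continuous c d x &
      {ae (@lebesgue_measure R), forall t, D t ->
         is_derive t (1 : R) x (riccati Q P t (x t))}].

Definition maximal_solution (Q P : R -> R) (D : set R) (x : R -> R) : Prop :=
  solution Q P D x /\
  forall D' x', solution Q P D' x' -> D `<=` D' ->
    (forall t, D t -> x' t = x t) -> D' `<=` D.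

(* The maximally extended solution with value y0 at time s, given as its
   interval of definition and a function, and selected by classical choice. *)
Definition maximal_through (Q P : R -> R) (s y0 : R) : set R * (R -> R) :=
  get [set Dx : set R * (R -> R) |
        [/\ maximal_solution Q P Dx.1 Dx.2, Dx.1 s & Dx.2 s = y0]].

Definition ydom (Q P : R -> R) (s y0 : R) : set R :=
  (maximal_through Q P s y0).1.

Definition y (Q P : R -> R) (t s y0 : R) : R :=
  (maximal_through Q P s y0).2 t.

Definition bounded_at_ninfty (D : set R) (x : R -> R) : Prop :=
  exists t0 M, forall t, t <= t0 -> D t /\ `|x t| <= M.

Definition bounded_at_pinfty (D : set R) (x : R -> R) : Prop :=
  exists t0 M, forall t, t0 <= t -> D t /\ `|x t| <= M.

Definition bounded_solution (Q P : R -> R) (b : R -> R) : Prop :=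
  solution Q P setT b /\ exists M, forall t, `|b t| <= M.

(* [a], defined on (-oo, beta), is the function frak-a of the equation. *)
Definition is_frak_a (Q P : R -> R) (beta : \bar R) (a : R -> R) : Prop :=
  [/\ (-oo < beta)%E,
      maximal_solution Q P [set t | (t%:E < beta)%E] a,
      forall s y0, (s%:E < beta)%E ->
        bounded_at_ninfty (ydom Q P s y0) (fun t => y Q P t s y0) <->
        y0 <= a s &
      forall b : R, beta = b%:E -> a t @[t --> b^'-] --> -oo].

(* [r], defined on (alpha, +oo), is the function frak-r of the equation. *)
Definition is_frak_r (Q P : R -> R) (alpha : \bar R) (r : R -> R) : Prop :=
  [/\ (alpha < +oo)%E,
      maximal_solution Q P [set t | (alpha < t%:E)%E] r,
      forall s y0, (alpha < s%:E)%E ->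
        bounded_at_pinfty (ydom Q P s y0) (fun t => y Q P t s y0) <->
        r s <= y0 &
      forall b : R, alpha = b%:E -> r t @[t --> b^'+] --> +oo].

Definition oriented_integral (f : R -> R) (s t : R) : R :=
  if s <= t then \int[@lebesgue_measure R]_(l in `[s, t]) f l
  else - \int[@lebesgue_measure R]_(l in `[t, s]) f l.

Definition attractive_bound (Q b : R -> R) : Prop :=
  exists k beta : R, [/\ 1 <= k, 0 < beta & forall s t, s <= t ->
    expR (oriented_integral (fun l => - 2 * b l + Q l) s t)
      <= k * expR (- beta * (t - s))].

Definition repulsive_bound (Q b : R -> R) : Prop :=
  exists k beta : R, [/\ 1 <= k, 0 < beta & forall s t, t <= s ->
    expR (oriented_integral (fun l => - 2 * b l + Q l) s t)
      <= k * expR (beta * (t - s))].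

Definition hyperbolic_attractive (Q P b : R -> R) : Prop :=
  bounded_solution Q P b /\ attractive_bound Q b.

Definition hyperbolic_repulsive (Q P b : R -> R) : Prop :=
  bounded_solution Q P b /\ repulsive_bound Q b.

Definition hyperbolic (Q P b : R -> R) : Prop :=
  hyperbolic_attractive Q P b \/ hyperbolic_repulsive Q P b.

Definition uniformly_separated (x1 x2 : R -> R) : Prop :=
  (forall t, x1 t <= x2 t) /\ 0 < inf (range (fun t => x2 t - x1 t)).

Definition attractor_repeller (Q P a r : R -> R) : Prop :=
  [/\ hyperbolic_attractive Q P a, hyperbolic_repulsive Q P r &
      forall b, bounded_solution Q P b -> forall t, r t <= b t <= a t].

(* The maximum over [a s - delta, a s + delta] is written as a supremum in the
   extended reals, which has no default value; it requires the solutions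
   starting at the end points to be defined as well. *)
Definition locally_pullback_attractive
    (Q P : R -> R) (beta : \bar R) (a : R -> R) : Prop :=
  exists s0 delta : R, [/\ (s0%:E < beta)%E, 0 < delta,
    forall s y0, s <= s0 -> `|y0 - a s| <= delta ->
      `[s, s0]%classic `<=` ydom Q P s y0 &
    forall t, t <= s0 ->
      ereal_sup [set `|a t - y Q P t s y0|%:E
                | y0 in `[a s - delta, a s + delta]%classic]
        @[s --> -oo] --> 0%E].

Definition locally_pullback_repulsive
    (Q P : R -> R) (alpha : \bar R) (r : R -> R) : Prop :=
  exists s0 delta : R, [/\ (alpha < s0%:E)%E, 0 < delta,
    forall s, s0 <= s ->
      `[s0, s]%classic `<=` ydom Q P s (r s + delta) /\
      `[s0, s]%classic `<=` ydom Q P s (r s - delta) &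
    forall t, s0 <= t ->
      `|r t - y Q P t s (r s + delta)| @[s --> +oo] --> 0 /\
      `|r t - y Q P t s (r s - delta)| @[s --> +oo] --> 0].

End Caratheodory.

(* Main.v *)
Require Import Defs.
From mathcomp Require Import measurable_realfun.
From mathcomp Require Import ring lra.

(** BPUC functions are bounded and measurable ([BPUC_bounded_measurable]), and the
    equation [y' = - (y - G t) ^+ 2 + p t] is studied for such [G] and [p].

    The unperturbed equation [x' = - x ^+ 2 + p] has the attractor [ta] and the
    repeller [tr].  The hyperbolic bounds force [w = ta - tr] to be bounded below by
    some [delta > 0] ([hyperbolic_pair_separated]).  For [t] near [-oo], where [G] is
    close to its limit [gam], the coordinate [theta = (y - gam - tr) / w] satisfies
    [theta' = w * theta * (1 - theta)] up to an error that is small compared with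
    [1 + `|theta|], so that everything can be read off the logistic equation.  Above
    [1 + eps] solutions blow up backwards in bounded time, below [1 - eps] they exist
    for all past times and tend to [0] backwards, and near [1] they attract each
    other.

    Hence a solution is bounded in the past if and only if it exists for all past
    times, the set of initial values of such solutions has a largest element
    ([largest_past_solution]), and the solution [a] through it stays near
    [theta = 1]: otherwise it could be increased.  This gives the existence of [a]
    ([frak_a_exists]), its convergence to [ta + gam] ([frak_a_cvg]) and its pullback
    attractivity ([frak_a_pullback_attractive]).  A solution below [a] cannot stay
    near [1], since differences there would grow backwards beyond any bound, so it
    tends to [tr + gam] ([below_frak_a]).  The change of variables [t -> - t],
    [y -> - y] yields the corresponding statements for [r] near [+oo].

    If [a] and [r] are global and different, then [r < a], and each of them is close
    to a translate of [ta] or [tr] near both ends, so that [a - r] is bounded below;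
    uniform separation of two solutions implies the hyperbolic bounds, by
    [weighted_attractor] and [weighted_repeller].  Without hyperbolic solutions
    [a = r], and every bounded solution lies between [r] and [a].

    Existence, uniqueness and maximality of solutions come from linearization: the
    Riccati solutions are the quotients [v / u] of the solutions of the linear system
    [u' = v], [v' = Q v + P u], which exist globally ([linear_solution_exists],
    [maximal_throughP]).  Differential inequalities for absolutely continuous
    functions rest on the mean value inequality [ac_mean_value]. *)

Set Implicit Arguments.
Unset Strict Implicit.
Unset Printing Implicit Defensive.

Local Open Scope classical_set_scope.
Local Open Scope ring_scope.

(** * A mean value inequality for absolutely continuous functions *)

Section ACMeanValue.
Variable R : realType.
Notation mu := (@lebesgue_measure R).
Implicit Types (f g x : R -> R) (c d s t u v : R).

Lemma derive_slope f t l : is_derive t (1 : R) f l ->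
  forall e, 0 < e -> exists2 eta, 0 < eta &
    forall v, `|v - t| < eta -> `|f v - f t - l * (v - t)| <= e * `|v - t|.
Proof.
move=> [df <-] e e0.
have /cvgrPdist_le /(_ e e0) := df.
rewrite nearE /= => /nbhs_ballP [eta /= eta0 H].
exists eta => // v vt.
have [->|vNt] := eqVneq v t; first by rewrite !subrr mulr0 subrr normr0 mulr0.
have vt0 : v - t != 0 by rewrite subr_eq0.
have /= := H (v - t).
rewrite /ball /= sub0r normrN vt => /(_ isT vt0).
rewrite scaler1 (_ : v - t + t = v); last by ring.
rewrite /GRing.scale /= => {}H.
rewrite -/('D_1 f t) in H.
have -> : f v - f t - 'D_1 f t * (v - t) =
   - (('D_1 f t - (v - t)^-1 * (f v - f t)) * (v - t)).
  rewrite mulrBl mulrAC mulVf // mul1r; ring.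
by rewrite normrN normrM ler_wpM2r.
Qed.

(** A sequence of intervals can be lengthened by one interval at a time, which
    suits an argument that moves from left to right; the most recent interval is
    the rightmost one and stands at the head. *)
Lemma abs_continuous_seq c d f : abs_continuous c d f ->
  forall e, 0 < e -> exists2 delta, 0 < delta & forall s : seq (R * R),
    {in s, forall p, c <= p.1 /\ p.1 < p.2 /\ p.2 <= d} ->
    pairwise (fun p q => q.2 <= p.1) s ->
    \sum_(p <- s) (p.2 - p.1) < delta ->
    \sum_(p <- s) `|f p.2 - f p.1| < e.
Proof.
move=> acf e e0; have [del del0 H] := acf e e0.
exists del => // s sin spair ssum.
pose n := size s.
pose U (i : 'I_n) := (nth (0, 0) s i).1.
pose V (i : 'I_n) := (nth (0, 0) s i).2.
have sE F : \sum_(p <- s) F p = \sum_(i < n) F (nth (0, 0) s i) :> R.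
  by rewrite (big_nth (0, 0)) big_mkord.
have lt_disj (i j : 'I_n) : (i < j)%N -> V j <= U i.
  move=> ij; have /(pairwiseP (0, 0)) := spair; apply => //; rewrite inE //.
rewrite sE; apply: (H n U V).
- by move=> i; apply: sin; apply: mem_nth.
- move=> i j _ _ [z [/=]]; rewrite !in_itv /= => /andP[h1 h2] /andP[h3 h4].
  apply/val_inj/eqP; rewrite eqn_leq.
  apply/andP; split; rewrite leqNgt; apply/negP => /lt_disj; lra.
- by rewrite /U /V -(sE (fun p => p.2 - p.1)).
Qed.

(** The exceptional null set is put into an open set [W] of small measure and the
    inequality is propagated from [c] to [d] by a supremum argument.  Outside [W]
    a short step is controlled by the derivative; the steps inside [W] form a
    family of small total length, so that absolute continuity makes their total
    contribution negligible.  The sign condition on [m] makes the term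
    [m * (t - t')] harmless on those steps; [primitive_mean_ge] removes it. *)
Lemma ac_mean_value c d m f : c <= d -> m <= 0 -> abs_continuous c d f ->
  {ae mu, forall t, c < t < d -> exists2 l, m <= l & is_derive t (1 : R) f l} ->
  m * (d - c) <= f d - f c.
Proof.
move=> cd m0 acf hN.
apply/ler_addgt0Pl => e e0.
pose e1 := e / 2 / (d - c + 1).
have dc1 : 0 < d - c + 1 by lra.
have e10 : 0 < e1 by rewrite !divr_gt0.
have e1dc : e1 * (d - c) <= e / 2.
  by rewrite /e1 mulrAC ler_pdivrMr // ler_pM2l ?divr_gt0 //; lra.
have e20 : 0 < e / 2 by lra.
have [del del0 Hac] := abs_continuous_seq acf e20.
(* the end points are added to the exceptional set, no derivative being given there *)
have set1_negl a : mu.-negligible [set a].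
  by exists [set a]; split => //; exact: lebesgue_measure_set1.
have [N [mN N0 hN']] :=
  negligibleU (negligibleU hN (set1_negl c)) (set1_negl d).
have [|W [oW NW muW]] := lebesgue_regularity_outer mN _ del0.
  by rewrite N0.
have mW : measurable (W : set (measurableTypeR R)) by exact: measurable_realfun.open_measurable.
have {}muW : (mu W < del%:E)%E.
  have e3 : (mu W <= mu (W `\` N) + mu N)%E.
    have mD : measurable (W `\` N : set (measurableTypeR R)) by exact: measurableD.
    apply: (le_trans _ (measureU2 _ mD mN)).
    apply: le_measure; rewrite ?inE //; first exact: measurableU.
    by move=> z Wz; have [?|?] := pselect (N z); [right|left].
  by move: e3; rewrite N0 adde0 => /le_lt_trans; apply.
(* [V t] is the room available in [W] up to time [t] for the selected intervals *)
pose V t := fine (mu (W `&` `[c, t])).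
have Vfin (A : set R) : measurable (A : set (measurableTypeR R)) ->
    (mu (W `&` A) < del%:E)%E.
  move=> mA; apply: le_lt_trans muW; apply: le_measure; rewrite ?inE //.
  exact: measurableI.
have VfinE (A : set R) : measurable (A : set (measurableTypeR R)) ->
    mu (W `&` A) \is a fin_num.
  move=> mA; rewrite ge0_fin_numE //; apply: lt_trans (Vfin _ mA) _.
  exact: ltry.
have Vlt t : V t < del by rewrite -lte_fin fineK ?VfinE ?Vfin.
have Vle t t' : t' <= t -> V t' <= V t.
  move=> tt; rewrite -lee_fin !fineK ?VfinE //.
  apply: le_measure; rewrite ?inE //; try exact: measurableI.
  by apply: setIS => z /=; rewrite !in_itv /= => /andP[-> /le_trans]; apply.
have Vadd t' t : c <= t' -> t' <= t -> (forall z, t' <= z <= t -> W z) ->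
    V t' + (t - t') <= V t.
  move=> ct tt inW; rewrite -lee_fin EFinD !fineK ?VfinE //.
  have -> : ((t - t')%:E = mu (`]t', t]%classic))%E.
    rewrite lebesgue_measure_itv /= lte_fin; case: ltP => // h.
    by congr (_%:E); lra.
  rewrite -measureU //; last 2 first.
  - exact: measurableI.
  - apply/seteqP; split => // z [] /= [_]; rewrite !in_itv /=.
    by move=> /andP[_ h1] /andP[h2 _]; lra.
  apply: le_measure; rewrite ?inE //.
  - by apply: measurableU => //; exact: measurableI.
  - exact: measurableI.
  - move=> z [[Wz]|] /=; rewrite !in_itv /= => /andP[h1 h2].
      by split => //; apply/andP; split; lra.
    by split; [apply: inW; lra|lra].
(* [t] is good if the inequality holds on [c, t] up to a selected family in [W] *)
pose good t := exists s : seq (R * R),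
  [/\ {in s, forall p, c <= p.1 /\ p.1 < p.2 /\ p.2 <= t},
      pairwise (fun p q => q.2 <= p.1) s,
      \sum_(p <- s) (p.2 - p.1) <= V t &
      m * (t - c) <= f t - f c + e1 * (t - c) + \sum_(p <- s) `|f p.2 - f p.1|].
have good_c : good c.
  exists [::]; split => //; rewrite ?big_nil ?subrr ?mulr0 ?addr0 //.
  by rewrite /V fine_ge0.
(* a good point propagates through a step that is either short or inside W *)
have step s : c <= s <= d -> exists2 eta, 0 < eta &
    forall t' t, s - eta < t' -> t' <= s -> s <= t -> t < s + eta ->
    c <= t' -> t <= d -> good t' -> good t.
  move=> csd.
  have [Ws|nWs] := pselect (W s).
    have /nbhs_ballP[eta /= eta0 H] := oW _ Ws.
    exists eta => // t' t h1 h2 h3 h4 h5 h6 [l [l1 l2 l3 l4]].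
    have [tt|tt] := eqVneq t' t; first by rewrite -tt; exists l; split.
    have {}tt : t' < t by rewrite lt_neqAle tt; lra.
    exists ((t', t) :: l); split.
    - move=> p; rewrite inE => /orP[/eqP -> //|/l1 [? [? ?]]]; split; [|split] => //; lra.
    - rewrite /= l2 andbT; apply/allP => p /l1 [_ []] //.
    - rewrite big_cons /=; apply: le_trans (Vadd t' t h5 _ _); [lra|lra|].
      move=> z zz; apply: H; rewrite /ball /= ltr_distlC; lra.
    - rewrite big_cons /=.
      have := ler_norm (- (f t - f t')); rewrite normrN.
      set S := \sum_(_ <- _) _ in l4 *; set A := `|_| => hA.
      have : 0 <= e1 * (t - t') by rewrite mulr_ge0 //; lra.
      have : m * (t - t') <= 0 by rewrite mulr_le0_ge0 //; lra.
      lra.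
  have : ~ N s by move=> /NW.
  move/(contra_not (hN' s)) => /not_orP[/not_orP[sbad sc] sd].
  have cs : c < s < d.
    move/eqP : sc; move/eqP: sd; lra.
  have {sbad} [l ml fl] : exists2 l, m <= l & is_derive s (1 : R) f l.
    by apply: contrapT => h; apply: sbad => /(_ cs).
  have [eta eta0 H] := derive_slope fl e10.
  exists eta => // t' t h1 h2 h3 h4 h5 h6 [l0 [l1 l2 l3 l4]].
  exists l0; split => //.
  - by move=> p /l1 [? [? ?]]; split => //; split => //; lra.
  - by apply: le_trans l3 _; apply: Vle; lra.
  - set S := \sum_(_ <- _) _ in l4 *.
    have := H t; have := H t'.
    rewrite distrC ger0_norm ?subr_ge0 // => /(_ _) Ht'.
    rewrite ger0_norm ?subr_ge0 // => /(_ _) Ht.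
    have {}Ht' := Ht' ltac:(lra); have {}Ht := Ht ltac:(lra).
    move: Ht' Ht; rewrite !ler_norml => /andP[a1 a2] /andP[a3 a4].
    have : m * (t - t') <= l * (t - t') by rewrite ler_wpM2r //; lra.
    lra.
pose A := [set t | c <= t <= d /\ good t].
have Ac : A c by split => //; lra.
have supA : has_sup A.
  by split; [exists c|exists d => t [/andP[]]].
have c_sup : c <= sup A by apply: ub_le_sup => //; case: supA.
have sup_d : sup A <= d by apply: ge_sup => [|t [/andP[]]]; [exists c|].
have [eta eta0 H] := step (sup A) (introT andP (conj c_sup sup_d)).
have [t' [/andP[ct' td'] gt'] ht'] := sup_adherent eta0 supA.
have t'sup : t' <= sup A by apply: ub_le_sup; [case: supA|split => //; lra].
have [lt_sup|] := ltP (sup A) d.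
  pose t := Num.min d (sup A + eta / 2).
  have [td tsup] : t <= d /\ t <= sup A + eta / 2.
    by rewrite /t !ge_min !lexx orbT.
  have suplt : sup A < t by rewrite /t lt_min lt_sup /=; lra.
  have gt : good t by apply: (H t' t); try lra.
  have : t <= sup A by apply: ub_le_sup; [case: supA|split => //; lra].
  lra.
move=> d_sup; have {d_sup} supE : sup A = d by lra.
rewrite supE in H ht' t'sup.
have [s [s1 s2 s3 s4]] : good d by apply: (H t' d); try lra.
have := Hac s s1 s2 (le_lt_trans s3 (Vlt d)).
lra.
Qed.
End ACMeanValue.

(** * Lipschitz primitives *)

Section Primitive.
Variable R : realType.
Notation mu := (@lebesgue_measure R).
Implicit Types (f g x z : R -> R) (c d s t u v : R).

Lemma aeS (P Q : set R) : P `<=` Q ->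
  {ae mu, forall t, P t} -> {ae mu, forall t, Q t}.
Proof. by apply: filterS; exact: (ae_filter_ringOfSetsType mu). Qed.

Lemma aeS2 (P Q T : set R) : (forall t, P t -> Q t -> T t) ->
  {ae mu, forall t, P t} -> {ae mu, forall t, Q t} -> {ae mu, forall t, T t}.
Proof. by apply: filterS2; exact: (ae_filter_ringOfSetsType mu). Qed.

Definition lipschitz_itv c d x := exists2 L : R, 0 <= L &
  forall s t, c <= s <= d -> c <= t <= d -> `|x t - x s| <= L * `|t - s|.

(** The solutions met below have bounded derivatives, hence are Lipschitz.  Asking
    for this rather than for absolute continuity makes the notion stable under
    products, inverses and exponentials, and the almost everywhere derivative
    obeys the usual rules. *)
Definition primitive c d g x := lipschitz_itv c d x /\
  {ae mu, forall t, c < t < d -> is_derive t (1 : R) x (g t)}.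

Lemma lipschitz_abs_continuous c d x :
  lipschitz_itv c d x -> abs_continuous c d x.
Proof.
move=> [L L0 H] e e0; exists (e / (L + 1)); first by rewrite divr_gt0 //; lra.
move=> n u v huv _; rewrite ltr_pdivlMr; last lra.
apply: le_lt_trans; apply: (@le_trans _ _ (\sum_i (v i - u i) * L)).
  apply: ler_sum => i _; have [h1 [h2 h3]] := huv i.
  rewrite mulrC; have := H (u i) (v i).
  rewrite (ger0_norm (x := v i - u i)); last lra.
  by apply; lra.
rewrite -mulr_suml ler_wpM2l ?sumr_ge0 // => [i _|]; last lra.
by have := huv i; lra.
Qed.

Lemma primitive_sub c d c' d' g x : c <= c' -> d' <= d ->
  primitive c d g x -> primitive c' d' g x.
Proof.
move=> cc dd [[L L0 H] ae]; split.
  by exists L => // s t h1 h2; apply: H; lra.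
by apply: aeS ae => t h h1; apply: h; lra.
Qed.

Lemma eq_primitive c d g g' x x' :
  (forall t, c < t < d -> g t = g' t) -> (forall t, c <= t <= d -> x t = x' t) ->
  primitive c d g x -> primitive c d g' x'.
Proof.
move=> gg xx [[L L0 H] ae]; split.
  by exists L => // s t h1 h2; rewrite -!xx // H.
apply: aeS ae => t h h1; rewrite -gg //.
apply: near_eq_is_derive (h h1).
near=> v; apply: xx; apply/andP; split; apply: ltW; near: v.
  by apply: lt_nbhsr; case/andP: h1.
by apply: lt_nbhsl; case/andP: h1.
Unshelve. all: by end_near. Qed.

Lemma primitiveD c d f g x z : primitive c d f x -> primitive c d g z ->
  primitive c d (fun t => f t + g t) (fun t => x t + z t).
Proof.
move=> [[L L0 H] ae] [[L' L0' H'] ae']; split.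
  exists (L + L'); first lra.
  move=> s t hs ht; have := H s t hs ht; have := H' s t hs ht.
  rewrite (_ : _ + _ - _ = (x t - x s) + (z t - z s)); last ring.
  have := ler_normD (x t - x s) (z t - z s); lra.
by apply: aeS2 ae ae' => t h h' ct; apply: is_deriveD; auto.
Qed.

Lemma primitive_cst c d k : primitive c d (fun=> 0) (fun=> k).
Proof.
split; first by exists 0 => // s t _ _; rewrite subrr normr0 mul0r.
by apply: aeW => t _; exact: is_derive_cst.
Qed.

Lemma primitive_id c d : primitive c d (fun=> 1) id.
Proof.
split; first by exists 1 => // s t _ _; rewrite mul1r.
by apply: aeW => t _; exact: is_derive_id.
Qed.

Lemma lipschitz_bounded c d x : lipschitz_itv c d x ->
  exists2 M : R, 0 < M & forall t, c <= t <= d -> `|x t| <= M.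
Proof.
move=> [L L0 H]; have [cd|dc] := leP c d; last by exists 1 => // t; lra.
exists (`|x c| + L * (d - c) + 1).
  have : 0 <= L * (d - c) by rewrite mulr_ge0 //; lra.
  by have := normr_ge0 (x c); lra.
move=> t ct; have := H c t; rewrite lexx cd => /(_ isT ct).
rewrite (ger0_norm (x := t - c)); last lra.
have : L * (t - c) <= L * (d - c) by rewrite ler_wpM2l //; lra.
have := ler_normD (x t - x c) (x c); rewrite subrK; lra.
Qed.

Lemma primitiveM c d f g x z : primitive c d f x -> primitive c d g z ->
  primitive c d (fun t => f t * z t + x t * g t) (fun t => x t * z t).
Proof.
move=> [lx ae] [lz ae']; split.
  have [M M0 xM] := lipschitz_bounded lx.
  have [M' M0' zM] := lipschitz_bounded lz.
  move: lx lz => [L L0 H] [L' L0' H'].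
  exists (L * M' + M * L'); first by rewrite addr_ge0 // mulr_ge0 // ltW.
  move=> s t hs ht.
  rewrite (_ : _ - _ = (x t - x s) * z t + x s * (z t - z s)); last ring.
  apply: le_trans (ler_normD _ _) _; rewrite !normrM mulrDl.
  apply: lerD.
    by rewrite mulrAC ler_pM //; auto.
  by rewrite -mulrA ler_pM //; auto.
apply: aeS2 ae ae' => t h h' ct.
apply: is_derive_eq (is_deriveM (h ct) (h' ct)) _.
by rewrite /GRing.scale /=; ring.
Qed.


Lemma primitiveZ c d k g x : primitive c d g x ->
  primitive c d (fun t => k * g t) (fun t => k * x t).
Proof.
move=> gx; apply: eq_primitive (primitiveM (primitive_cst c d k) gx) => t _ //.
by rewrite mul0r add0r.
Qed.

Lemma primitiveB c d f g x z : primitive c d f x -> primitive c d g z ->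
  primitive c d (fun t => f t - g t) (fun t => x t - z t).
Proof.
move=> fx gz; apply: eq_primitive (primitiveD fx (primitiveZ (-1) gz)) => t _;
by rewrite mulN1r.
Qed.

(** Subtracting [m * t] reduces to the case [m = 0] of [ac_mean_value]. *)
Lemma primitive_mean_ge c d m g x : c <= d -> primitive c d g x ->
  (forall t, c < t < d -> m <= g t) -> m * (d - c) <= x d - x c.
Proof.
move=> cd gx mg.
have [lz ae] := primitiveB gx (primitiveZ m (primitive_id c d)).
have := ac_mean_value cd (lexx 0) (lipschitz_abs_continuous lz).
suff H : {ae mu, forall t, c < t < d -> exists2 l, 0 <= l &
    is_derive t (1 : R) (fun t => x t - m * id t) l}.
  by move=> /(_ H); rewrite /=; lra.
apply: aeS ae => t h ct; exists (g t - m * 1); last exact: h.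
by rewrite mulr1 subr_ge0; exact: mg.
Qed.

Lemma primitive_mean_le c d m g x : c <= d -> primitive c d g x ->
  (forall t, c < t < d -> g t <= m) -> x d - x c <= m * (d - c).
Proof.
move=> cd gx mg; have := @primitive_mean_ge c d (- m) _ _ cd (primitiveZ (-1) gx).
have H : forall t, c < t < d -> - m <= -1 * g t by move=> t /mg; lra.
move=> /(_ H); lra.
Qed.

Lemma lipschitz_continuous c d x t : lipschitz_itv c d x -> c < t < d ->
  {for t, continuous x}.
Proof.
move=> [L L0 H] ct; apply/cvgrPdist_lt => e e0.
have L1 : 0 < L + 1 by lra.
near=> v.
have cv : c <= v <= d.
  apply/andP; split; apply: ltW; near: v.
    by apply: lt_nbhsr; case/andP: ct.
  by apply: lt_nbhsl; case/andP: ct.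
have ct' : c <= t <= d by lra.
apply: le_lt_trans (H v t cv ct') _.
apply: (@le_lt_trans _ _ ((L + 1) * `|t - v|)); first by rewrite ler_wpM2r //; lra.
rewrite -ltr_pdivlMl // mulrC; near: v.
by apply: cvgr_dist_lt; rewrite ?divr_gt0 //; exact: cvg_id.
Unshelve. all: by end_near. Qed.

Lemma primitiveV c d g x m : 0 < m -> (forall t, c <= t <= d -> m <= x t) ->
  primitive c d g x ->
  primitive c d (fun t => - g t / x t ^+ 2) (fun t => (x t)^-1).
Proof.
move=> m0 mx [[L L0 H] ae]; split.
  exists (L / m ^+ 2); first by rewrite divr_ge0 // exprn_ge0 // ltW.
  move=> s t hs ht; have xs := mx s hs; have xt := mx t ht.
  have xs0 : 0 < x s by exact: lt_le_trans xs.
  have xt0 : 0 < x t by exact: lt_le_trans xt.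
  have -> : (x t)^-1 - (x s)^-1 = (x s - x t) / (x s * x t).
    by field; rewrite !gt_eqF.
  rewrite normrM normfV (ger0_norm (x := x s * x t)); last by rewrite mulr_ge0 // ltW.
  rewrite mulrAC; apply: ler_pM; rewrite ?invr_ge0 ?mulr_ge0 // ?(ltW xs0) ?(ltW xt0) //.
    by rewrite distrC H.
  by rewrite lef_pV2 ?posrE ?mulr_gt0 ?exprn_gt0 // expr2 ler_pM // ltW.
apply: aeS ae => t h ct.
have xt0 : x t != 0 by rewrite gt_eqF // (lt_le_trans m0) // mx; lra.
apply: is_derive_eq (is_deriveV xt0 (h ct)) _.
by rewrite /GRing.scale /= mulNr mulrC -mulNr.
Qed.

Lemma lipschitz_comp_expR c d x : lipschitz_itv c d x ->
  lipschitz_itv c d (fun t => expR (x t)).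
Proof.
move=> lx; have [M M0 xM] := lipschitz_bounded lx; case: lx => L L0 H.
exists (expR M * L); first by rewrite mulr_ge0 // expR_ge0.
have aux (a b : R) : a <= M -> a <= b -> b <= M -> `|expR b - expR a| <= expR M * `|b - a|.
  move=> aM ab bM; rewrite !ger0_norm ?subr_ge0 ?ler_expR //.
  have -> : expR b - expR a = expR b * (1 - expR (a - b)).
    by rewrite mulrBr mulr1 -expRD; congr (_ - expR _); ring.
  apply: ler_pM; rewrite ?expR_ge0 ?ler_expR //.
    by rewrite subr_ge0 -expR0 ler_expR; lra.
  by have := expR_ge1Dx (a - b); lra.
move=> s t hs ht; rewrite -mulrA /=.
apply: (@le_trans _ _ (expR M * `|x t - x s|)); last first.
  by rewrite ler_wpM2l ?expR_ge0 // H.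
have h1 := le_trans (ler_norm _) (xM t ht).
have h2 := le_trans (ler_norm _) (xM s hs).
have [h|h] := leP (x s) (x t); first exact: aux.
by have := aux (x t) (x s) h1 (ltW h) h2; rewrite distrC (distrC (x s)).
Qed.

Lemma primitive_expR c d g x : primitive c d g x ->
  primitive c d (fun t => g t * expR (x t)) (fun t => expR (x t)).
Proof.
move=> [lx ae]; split; first exact: lipschitz_comp_expR.
apply: aeS ae => t h ct.
apply: is_derive_eq (is_derive1_comp (is_derive_expR (x t)) (h ct)) _.
by rewrite mulrC.
Qed.

(** Only the values of [x] just above [K] matter: after the last passage through
    [K] the function stays below [K'] for a short while, and there it decreases. *)
Lemma primitive_barrier c d K K' g x : c <= d -> primitive c d g x -> K < K' ->
  (forall t, c < t < d -> K < x t < K' -> g t <= 0) -> x c <= K -> x d <= K.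
Proof.
move=> cd gx KK gK xcK; rewrite leNgt; apply/negP => Kxd.
pose A := [set t | c <= t <= d /\ x t <= K].
have Ac : A c by split; rewrite ?lexx.
have supA : has_sup A by split; [exists c|exists d => t [/andP[]]].
have ubA t : A t -> t <= sup A by apply: ub_le_sup; case: supA.
have c_sup := ubA c Ac.
have sup_d : sup A <= d by apply: ge_sup => [|t [/andP[]]]; [exists c|].
set s := sup A in ubA c_sup sup_d *.
have [[L L0 H] _] := gx.
have xsK : x s <= K.
  apply/ler_addgt0Pl => e e0; rewrite leNgt; apply/negP => h.
  have e1 : 0 < e / (L + 1) by rewrite divr_gt0 //; lra.
  have [t [ctd xt] ts] := sup_adherent e1 supA.
  have ts' := ubA t (conj ctd xt).
  have := H t s ctd (introT andP (conj c_sup sup_d)).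
  rewrite (ger0_norm (x := s - t)); last by rewrite subr_ge0.
  have : L * (s - t) <= e.
    have : (L + 1) * (s - t) <= e.
      rewrite mulrC -ler_pdivlMr; last by clear -L0; lra.
      by clear -ts; rewrite -/s in ts; lra.
    by clear -ts'; lra.
  move=> h1 /(le_trans (ler_norm _)).
  by clear -h1 h xt; lra.
have sd : s < d.
  by rewrite lt_neqAle sup_d andbT; apply: contraTneq Kxd => <-; rewrite -leNgt.
have xgt t : s < t <= d -> K < x t.
  move=> /andP[st td]; rewrite ltNge; apply/negP => xt.
  have : A t by split => //; rewrite td (le_trans c_sup) // ltW.
  by move=> /ubA; rewrite leNgt st.
(* shortly after the last passage through K the value is still below K' *)
have eta0 : 0 < (K' - K) / (L + 1) by rewrite divr_gt0 ?subr_gt0 //; clear -L0; lra.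
pose t1 := Num.min d (s + (K' - K) / (L + 1)).
have st1 : s < t1 by rewrite /t1 lt_min sd /= ltrDl.
have t1d : t1 <= d by rewrite /t1 ge_min lexx.
have t1e : t1 - s <= (K' - K) / (L + 1).
  by rewrite lerBlDl /t1 ge_min lexx orbT.
have := @primitive_mean_le s t1 0 g x (ltW st1) (primitive_sub c_sup t1d gx).
have HH t : s < t < t1 -> g t <= 0.
  move=> ht; apply: gK; first by clear -ht c_sup t1d; lra.
  apply/andP; split; first by apply: xgt; clear -ht t1d; lra.
  have hs : c <= s <= d by rewrite c_sup sup_d.
  have ht' : c <= t <= d by clear -ht c_sup t1d; lra.
  have := H s t hs ht'; rewrite (ger0_norm (x := t - s)); last by clear -ht; lra.
  have : (L + 1) * (t - s) < K' - K.
    rewrite mulrC -ltr_pdivlMr; last by clear -L0; lra.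
    by clear -ht t1e; lra.
  have : 0 <= t - s by clear -ht; lra.
  move=> h0 h1 /(le_trans (ler_norm _)).
  by clear -h0 h1 xsK; lra.
move=> /(_ HH); rewrite mul0r; have := xgt t1 (introT andP (conj st1 t1d)).
by clear -xsK; lra.
Qed.

Lemma primitive_scaled_expR c d k s g x : primitive c d g x ->
  primitive c d (fun t => (g t - k * x t) * expR (- k * (t - s)))
    (fun t => x t * expR (- k * (t - s))).
Proof.
move=> gx; have h := primitive_expR (primitiveZ (- k)
   (primitiveB (primitive_id c d) (primitive_cst c d s))).
apply: eq_primitive (primitiveM gx h) => t _ //=; ring.
Qed.

(** The product of [x] with [expR (- k * t)] is monotone. *)
Lemma primitive_expR_le c d k g x : c <= d -> primitive c d g x ->
  (forall t, c < t < d -> g t <= k * x t) -> x d <= x c * expR (k * (d - c)).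
Proof.
move=> cd gx gk.
have := primitive_mean_le (m := 0) cd (primitive_scaled_expR k c gx).
have H t : c < t < d -> (g t - k * x t) * expR (- k * (t - c)) <= 0.
  by move=> /gk h; rewrite mulr_le0_ge0 ?expR_ge0 // subr_le0.
move=> /(_ H); rewrite subrr mulr0 expR0 mulr1 mul0r subr_le0 mulNr expRN.
by rewrite ler_pdivrMr ?expR_gt0.
Qed.

Lemma primitive_expR_ge c d k g x : c <= d -> primitive c d g x ->
  (forall t, c < t < d -> k * x t <= g t) -> x c * expR (k * (d - c)) <= x d.
Proof.
move=> cd gx gk.
have := primitive_expR_le (k := k) cd (primitiveZ (-1) gx).
have H t : c < t < d -> -1 * g t <= k * (-1 * x t) by move=> /gk; clear; lra.
move=> /(_ H); clear; lra.
Qed.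

(** Apply the two exponential comparisons to the square of [x]. *)
Lemma primitive_zero c d K g x s : primitive c d g x ->
  (forall t, c < t < d -> `|g t| <= K * `|x t|) -> c <= s <= d -> x s = 0 ->
  forall t, c <= t <= d -> x t = 0.
Proof.
move=> gx gK /andP[cs sd] xs0 t /andP[ct td].
have xx := primitiveM gx gx.
have bnd l : c < l < d -> `|g l * x l + x l * g l| <= 2 * K * (x l * x l).
  move=> /gK h.
  have -> : g l * x l + x l * g l = 2 * (g l * x l) by ring.
  have -> : x l * x l = `|x l| * `|x l| by rewrite -!expr2 real_normK ?num_real.
  rewrite !normrM ger0_norm // -mulrA ler_pM2l // mulrA ler_wpM2r //.
apply/eqP; rewrite -sqrf_eq0 expr2 eq_le -{2}expr2 sqr_ge0 andbT.
have [ts|st] := leP t s.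
  have := primitive_expR_ge (k := - (2 * K)) ts (primitive_sub ct sd xx).
  have H l : t < l < s -> - (2 * K) * (x l * x l) <= g l * x l + x l * g l.
    move=> tls; have : c < l < d by clear -tls ct sd; lra.
    by move=> /bnd; rewrite ler_norml mulNr => /andP[].
  move=> /(_ H); rewrite xs0 mulr0 => h.
  by rewrite -(pmulr_lle0 _ (expR_gt0 (- (2 * K) * (s - t)))) mulrC mulrC.
have := primitive_expR_le (k := 2 * K) (ltW st) (primitive_sub cs td xx).
have H l : s < l < t -> g l * x l + x l * g l <= (2 * K) * (x l * x l).
  move=> tls; have : c < l < d by clear -tls cs td; lra.
  by move=> /bnd; rewrite ler_norml => /andP[].
by move=> /(_ H); rewrite xs0 mulr0 mul0r.
Qed.

End Primitive.

(** * Integrals as primitives *)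

Section OrientedIntegral.
Variable R : realType.
Notation mu := (@lebesgue_measure R).
Implicit Types (f g x z : R -> R) (c d s t u v : R).

(** Cutting [f] off outside [c, d] makes it integrable on the whole line, and the
    Lebesgue differentiation theorem applies to the cut-off function. *)
Lemma primitive_oriented_integral c d (M : R) f s : measurable_fun setT f ->
  (forall t, c <= t <= d -> `|f t| <= M) -> c <= s <= d ->
  primitive c d f (oriented_integral f s).
Proof.
move=> mf fM csd.
have M0 : 0 <= M by apply: le_trans (fM s csd).
pose h := f \_ `[c, d].
have hM t : `|h t| <= M.
  by rewrite /h patchE; case: ifPn => [|_]; rewrite ?normr0 // inE /= in_itv => /fM.
have hE t : c <= t <= d -> h t = f t.
  by move=> ct; rewrite /h patchE mem_set //= in_itv.
have ih : mu.-integrable setT (EFin \o h).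
  have -> : EFin \o h = (EFin \o f) \_ `[c, d].
    by apply/funext => t /=; rewrite /h !patchE; case: ifP.
  apply/(integrable_mkcond _ _).1 => //.
  apply: measurable_bounded_integrable => //.
  - by rewrite /= lebesgue_measure_itv /=; case: ifP => _; rewrite -?EFinB ltry.
  - exact: measurable_funTS.
  - exists M; split; first exact: num_real.
    by move=> y My t /=; rewrite in_itv /= => /fM h'; exact: le_trans h' (ltW My).
have ihS (S : set R) : measurable (S : set (measurableTypeR R)) ->
    mu.-integrable S (EFin \o h).
  by move=> mS; apply: integrableS ih.
pose F t := \int[mu]_(l in `]-oo, t]) h l.
have FB u t : u <= t -> F t - F u = \int[mu]_(l in `]u, t]) h l.
  move=> ut; rewrite /F Rintegral_itvB //; exact: ihS.
have FL u t : u <= t -> `|F t - F u| <= M * `|t - u|.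
  move=> ut; rewrite FB // (ger0_norm (x := t - u)) ?subr_ge0 //.
  apply: (le_trans (le_normr_Rintegral _ _)) => //; first exact: ihS.
  have -> : M * (t - u) = \int[mu]_(l in `]u, t]) M.
    rewrite Rintegral_cst //= lebesgue_measure_itv /= lte_fin.
    by case: ltP => // tu; rewrite /= (_ : t = u) ?subrr //; lra.
  apply: le_Rintegral => //.
  - by move: (ihS `]u, t]%classic (measurable_itv _)) => /integrable_abse; exact.
  - apply: measurable_bounded_integrable => //; last first.
      exists M; split; first exact: num_real.
      by move=> y My l /= _; rewrite ger0_norm // ltW.
    by rewrite /= lebesgue_measure_itv /=; case: ifP => _; rewrite -?EFinB ltry.
have Fae : {ae mu, forall t, derivable F t 1 /\ derive1 F t = h t}.
  apply: FTC1Ny; first by move=> y; exact: ihS.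
  by apply: open_integrable_locally; [exact: openT|exact: ih].
have {Fae} pF : primitive c d f F.
  split.
    exists M => // u t _ _; have [ut|tu] := leP u t; first exact: FL.
    by rewrite distrC (distrC t); apply: FL; exact: ltW.
  apply: aeS Fae => t [dF FE] ct; rewrite -hE; last by clear -ct; lra.
  by rewrite -FE derive1E; exact: DeriveDef.
have IE u t : c <= u -> u <= t -> t <= d ->
    \int[mu]_(l in `[u, t]) f l = F t - F u.
  move=> cu ut td; rewrite FB // Rintegral_itv_obnd_cbnd; last exact: ihS.
  apply: eq_Rintegral => l; rewrite inE /= in_itv /= => ul; rewrite hE //.
  by clear -ul cu td; lra.
apply: eq_primitive (primitiveB pF (primitive_cst c d (F s))) => t ct.
  by rewrite subr0.
rewrite /oriented_integral; case: leP => st; rewrite IE //; try by clear -st ct csd; lra.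
Qed.
End OrientedIntegral.

(** * Existence for linear systems *)

Section LocallyBounded.
Variable R : realType.
Notation mu := (@lebesgue_measure R).
Implicit Types (f g x z : R -> R) (c d s t u v : R).

Definition locally_bounded_measurable f := measurable_fun setT f /\
  forall c d, exists M : R, forall t, c <= t <= d -> `|f t| <= M.

Definition bounded_measurable f := measurable_fun setT f /\
  exists M : R, forall t, `|f t| <= M.

Notation lbm := locally_bounded_measurable.

Lemma lbmD f g : lbm f -> lbm g -> lbm (fun t => f t + g t).
Proof.
move=> [mf bf] [mg bg]; split; first exact: measurable_funD.
move=> c d; have [M fM] := bf c d; have [M' gM] := bg c d.
exists (M + M') => t ct; apply: le_trans (ler_normD _ _) _.
by apply: lerD; auto.
Qed.

Lemma lbmM f g : lbm f -> lbm g -> lbm (fun t => f t * g t).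
Proof.
move=> [mf bf] [mg bg]; split; first exact: measurable_funM.
move=> c d; have [M fM] := bf c d; have [M' gM] := bg c d.
by exists (M * M') => t ct; rewrite normrM; apply: ler_pM; auto.
Qed.

Lemma lbm_cst (k : R) : lbm (fun=> k).
Proof. by split; [exact: measurable_cst|move=> *; exists `|k|]. Qed.

Lemma bm_lbm f : bounded_measurable f -> lbm f.
Proof. by move=> [mf [M fM]]; split => // c d; exists M. Qed.

Lemma lbm_primitive g x : (forall c d, primitive c d g x) -> lbm x.
Proof.
move=> gx; split.
  apply: continuous_measurable_fun => t.
  have [lx _] := gx (t - 1) (t + 1).
  by apply: (lipschitz_continuous lx); clear; lra.
move=> c d; have [lx _] := gx c d.
by have [M _ xM] := lipschitz_bounded lx; exists M.
Qed.

Lemma oriented_integral_id f s : oriented_integral f s s = 0.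
Proof. by rewrite /oriented_integral lexx set_itv1 Rintegral_set1. Qed.

Lemma lbm_oriented_integral f s c d : lbm f ->
  primitive c d f (oriented_integral f s).
Proof.
move=> [mf bf]; have [M fM] := bf (Num.min c s) (Num.max d s).
have h1 : Num.min c s <= s by rewrite ge_min lexx orbT.
have h2 : s <= Num.max d s by rewrite le_max lexx orbT.
apply: primitive_sub (primitive_oriented_integral mf fM (introT andP (conj h1 h2))).
  by rewrite ge_min lexx.
by rewrite le_max lexx.
Qed.

(** Integration gains a factor [1 / lam] in the norm weighted by
    [expR (lam * `|t - s|)]; for large [lam] the Picard operator is thus a
    contraction on the whole line at once. *)
Lemma primitive_expR_weight_le (lam B : R) g x s t : 0 < lam -> 0 <= B ->
  (forall c d, primitive c d g x) -> x s = 0 ->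
  (forall l, `|g l| <= B * expR (lam * `|l - s|)) ->
  x t <= B / lam * expR (lam * `|t - s|).
Proof.
move=> lam0 B0 gx xs0 gB.
have Bl : 0 <= B / lam by rewrite divr_ge0 // ltW.
have [st|ts] := leP s t.
  rewrite (ger0_norm (x := t - s)) ?subr_ge0 //.
  have h := primitiveB (gx s t) (primitiveZ (B / lam) (primitive_expR
     (primitiveZ lam (primitiveB (primitive_id s t) (primitive_cst s t s))))).
  have := primitive_mean_le (m := 0) st h.
  have H l : s < l < t ->
     g l - B / lam * (lam * (1 - 0) * expR (lam * (id l - s))) <= 0.
    move=> /andP[sl _]; rewrite subr0 mulr1 mulrA divfK ?gt_eqF // subr_le0.
    have := gB l; rewrite (ger0_norm (x := l - s)) ?subr_ge0 ?(ltW sl) //.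
    by move=> h'; apply: le_trans (ler_norm _) h'.
  move=> /(_ H); rewrite xs0 subrr mulr0 expR0 mul0r.
  by clear -Bl; lra.
rewrite (ltr0_norm (x := t - s)) ?subr_lt0 // opprB.
have h := primitiveD (gx t s) (primitiveZ (- (B / lam)) (primitive_expR
   (primitiveZ (- lam) (primitiveB (primitive_id t s) (primitive_cst t s s))))).
have := primitive_mean_ge (m := 0) (ltW ts) h.
have H l : t < l < s ->
   0 <= g l + - (B / lam) * (- lam * (1 - 0) * expR (- lam * (id l - s))).
  move=> /andP[_ ls].
  have -> : - lam * (id l - s) = lam * (s - l) by rewrite /=; ring.
  rewrite subr0 mulr1 mulrA mulrNN divfK ?gt_eqF //.
  have := gB l; rewrite (ltr0_norm (x := l - s)) ?subr_lt0 // opprB.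
  by rewrite ler_norml => /andP[h' _]; clear -h'; lra.
move=> /(_ H); rewrite xs0 subrr mulr0 expR0 mul0r.
have -> : - lam * (id t - s) = lam * (s - t) by rewrite /=; ring.
by clear -Bl; lra.
Qed.

Lemma primitive_expR_weight (lam B : R) g x s t : 0 < lam -> 0 <= B ->
  (forall c d, primitive c d g x) -> x s = 0 ->
  (forall l, `|g l| <= B * expR (lam * `|l - s|)) ->
  `|x t| <= B / lam * expR (lam * `|t - s|).
Proof.
move=> lam0 B0 gx xs0 gB; rewrite ler_norml.
have h1 := primitive_expR_weight_le t lam0 B0 gx xs0 gB.
have h2 := @primitive_expR_weight_le lam B _ _ s t lam0 B0
  (fun c d => primitiveZ (-1) (gx c d)).
have {}h2 := h2 ltac:(by rewrite xs0 mulr0).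
have H l : `|-1 * g l| <= B * expR (lam * `|l - s|) by rewrite mulN1r normrN.
by move: (h2 H) h1; clear; lra.
Qed.

Lemma dyadic_small (K e : R) : 0 < e ->
  exists N, forall n, (N <= n)%N -> K / 2 ^+ n <= e.
Proof.
move=> e0.
have /cvgrPdist_le /(_ e e0) [N _ HN] : geometric K 2^-1 @ \oo --> (0 : R).
  by apply: cvg_geometric; rewrite ger0_norm ?invr_ge0 // invf_lt1 // ltr1n.
exists N => n Nn; have := HN n Nn; rewrite /geometric /= sub0r normrN exprVn.
exact: le_trans (ler_norm _).
Qed.

(** The limit is the supremum of the lower bounds [a n - 2 * K / 2 ^+ n]. *)
Lemma geometric_limit (a : nat -> R) (K : R) : 0 <= K ->
  (forall n, `|a n.+1 - a n| <= K / 2 ^+ n) ->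
  exists l, forall n, `|l - a n| <= 2 * K / 2 ^+ n.
Proof.
move=> K0 aK; pose b n := 2 * K / 2 ^+ n.
have bS n : b n = b n.+1 + K / 2 ^+ n.
  rewrite /b exprS; have : (2 : R) ^+ n != 0 by rewrite expf_neq0.
  by move=> h; field.
have b0 n : 0 <= b n by rewrite /b divr_ge0 ?exprn_ge0 // mulr_ge0.
have ndl n : a n - b n <= a n.+1 - b n.+1.
  by have := aK n; rewrite ler_norml (bS n) => /andP[]; clear; lra.
have niu n : a n.+1 + b n.+1 <= a n + b n.
  by have := aK n; rewrite ler_norml (bS n) => /andP[]; clear; lra.
have mono_l n k : a n - b n <= a (n + k)%N - b (n + k)%N.
  by elim: k => [|k IH]; rewrite ?addn0 // addnS (le_trans IH).
have mono_u n k : a (n + k)%N + b (n + k)%N <= a n + b n.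
  by elim: k => [|k IH]; rewrite ?addn0 // addnS (le_trans _ IH).
have lu n m : a n - b n <= a m + b m.
  apply: le_trans (mono_l n m) _; rewrite addnC; apply: le_trans (mono_u m n).
  by rewrite addnC; have := b0 (n + m)%N; rewrite addnC; clear; lra.
exists (sup (range (fun n => a n - b n))) => n.
rewrite ler_norml -/(b n).
have h1 : a n - b n <= sup (range (fun n => a n - b n)).
  apply: ub_le_sup; last by exists n.
  by exists (a 0%N + b 0%N) => _ [m _ <-].
have h2 : sup (range (fun n => a n - b n)) <= a n + b n.
  by apply: ge_sup; [exists (a 0%N - b 0%N); exists 0%N|move=> _ [m _ <-]].
by clear -h1 h2; lra.
Qed.

End LocallyBounded.

Section LinearSystem.
Variable R : realType.
Notation mu := (@lebesgue_measure R).
Implicit Types (Q P f g x z u v : R -> R) (c d s t : R).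
Notation lbm := locally_bounded_measurable.

(** The system [u' = v], [v' = Q v + P u], whose quotients [v / u] solve the
    Riccati equation. *)
Definition linear_solution Q P u v :=
  (forall c d, primitive c d v u) /\
  (forall c d, primitive c d (fun t => Q t * v t + P t * u t) v).

(** Picard iteration for [v], the function [u] being recovered from [v] by
    integration, in the weighted norm of [primitive_expR_weight]. *)
Lemma linear_solution_exists Q P s (u0 v0 : R) :
  bounded_measurable Q -> bounded_measurable P ->
  exists u v, [/\ linear_solution Q P u v, u s = u0 & v s = v0].
Proof.
move=> bQ bP; have [mQ [CQ QC]] := bQ; have [mP [CP PC]] := bP.
have [lQ lP] := (bm_lbm bQ, bm_lbm bP).
pose C := `|CQ| + `|CP|.
have C0 : 0 <= C by rewrite addr_ge0.
have {}QC t : `|Q t| <= C.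
  by apply: le_trans (QC t) _; apply: le_trans (ler_norm _) _; rewrite lerDl.
have {}PC t : `|P t| <= C.
  by apply: le_trans (PC t) _; apply: le_trans (ler_norm _) _; rewrite lerDr.
pose lam := 4 * C + 4.
have lam0 : 0 < lam by rewrite /lam; clear -C0; lra.
pose E t := expR (lam * `|t - s|).
have E0 t : 0 < E t by exact: expR_gt0.
have E1 t : 1 <= E t by rewrite -expR0 ler_expR mulr_ge0 // ltW.
pose J f := oriented_integral f s.
have J0 f : J f s = 0 by exact: oriented_integral_id.
pose U v t := u0 + J v t.
pose F v t := Q t * v t + P t * U v t.
pose T v t := v0 + J (F v) t.
have JP f c d : lbm f -> primitive c d f (J f) by exact: lbm_oriented_integral.
have UP v : lbm v -> forall c d, primitive c d v (U v).
  move=> lv c d; apply: eq_primitive (primitiveD (primitive_cst c d u0) (JP v c d lv)).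
    by move=> t _; rewrite add0r.
  by [].
have lbmF v : lbm v -> lbm (F v).
  by move=> lv; apply: lbmD; apply: lbmM => //; exact: lbm_primitive (UP v lv).
have TP v : lbm v -> forall c d, primitive c d (F v) (T v).
  move=> lv c d; apply: eq_primitive (primitiveD (primitive_cst c d v0) (JP _ c d (lbmF v lv))).
    by move=> t _; rewrite add0r.
  by [].
have lbmT v : lbm v -> lbm (T v) by move=> lv; exact: lbm_primitive (TP v lv).
(* the choice of lam makes T a contraction of ratio 1/2 for the weighted distance *)
have contr v w A : lbm v -> lbm w -> 0 <= A -> (forall t, `|v t - w t| <= A * E t) ->
    forall t, `|T v t - T w t| <= A / 2 * E t.
  move=> lv lw A0 vw.
  have UU t : `|U v t - U w t| <= A / lam * E t.
    apply: (primitive_expR_weight t lam0 A0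
      (fun c d => primitiveB (UP v lv c d) (UP w lw c d))) => //.
    by rewrite /U !J0 subrr.
  have FF t : `|F v t - F w t| <= (2 * C * A) * E t.
    have -> : F v t - F w t = Q t * (v t - w t) + P t * (U v t - U w t).
      by rewrite /F; ring.
    apply: le_trans (ler_normD _ _) _; rewrite !normrM.
    have h1 : `|Q t| * `|v t - w t| <= C * (A * E t) by rewrite ler_pM.
    have h2 : `|P t| * `|U v t - U w t| <= C * (A / lam * E t) by rewrite ler_pM.
    have h3 : C * (A / lam * E t) <= C * (A * E t).
      rewrite ler_wpM2l // ler_wpM2r ?(ltW (E0 t)) //.
      rewrite ler_pdivrMr // ler_peMr //.
      by rewrite /lam; clear -C0; lra.
    by clear -h1 h2 h3; lra.
  move=> t; have CA : 0 <= 2 * C * A by rewrite !mulr_ge0.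
  have h := primitive_expR_weight t lam0 CA
      (fun c d => primitiveB (TP v lv c d) (TP w lw c d)) _ FF.
  apply: le_trans (h _) _; first by rewrite /T !J0 subrr.
  rewrite -/(E t) ler_wpM2r ?(ltW (E0 t)) // ler_pdivrMr // /lam.
  have : 0 <= C * A by rewrite mulr_ge0.
  by clear -A0; lra.
pose vn n := iter n T (fun=> 0).
have lvn n : lbm (vn n) by elim: n => [|n IH]; [exact: lbm_cst|exact: lbmT].
pose A := `|v0| + C * `|u0|.
have A0 : 0 <= A by rewrite addr_ge0 // mulr_ge0.
have step0 t : `|T (fun=> 0) t - 0| <= A * E t.
  have l0 := lbm_cst (0 : R).
  have UE l : `|U (fun=> 0) l| <= `|u0|.
    rewrite /U.
    suff -> : J (fun=> 0) l = 0 by rewrite addr0.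
    have H l' : `|(fun=> 0 : R) l'| <= 0 * E l' by rewrite normr0 mul0r.
    have := primitive_expR_weight l lam0 (lexx 0) (fun c d => JP _ c d l0) (J0 _) H.
    by rewrite !mul0r normr_le0 => /eqP.
  have FE l : `|F (fun=> 0) l| <= C * `|u0| * E l.
    rewrite /F mulr0 add0r normrM.
    apply: (@le_trans _ _ (C * `|u0|)); first by rewrite ler_pM.
    by rewrite ler_peMr // mulr_ge0.
  have Cu : 0 <= C * `|u0| by rewrite mulr_ge0.
  have h := primitive_expR_weight t lam0 Cu
     (fun c d => JP _ c d (lbmF _ l0)) (J0 _) FE.
  rewrite subr0 /T; apply: le_trans (ler_normD _ _) _.
  rewrite /A mulrDl; apply: lerD; first by rewrite ler_peMr.
  apply: le_trans h _; rewrite -/(E t) ler_wpM2r ?(ltW (E0 t)) //.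
  rewrite ler_pdivrMr // ler_peMr // /lam.
  by clear -C0; lra.
have stepn n t : `|vn n.+1 t - vn n t| <= A / 2 ^+ n * E t.
  elim: n t => [|n IH] t; first by rewrite expr0 divr1 step0.
  have An : 0 <= A / 2 ^+ n by rewrite divr_ge0 // exprn_ge0.
  have := contr _ _ _ (lvn n.+1) (lvn n) An IH t.
  by rewrite exprSr invfM mulrA.
have lim_v t : exists l, forall n, `|l - vn n t| <= 2 * (A * E t) / 2 ^+ n.
  apply: geometric_limit; first by rewrite mulr_ge0 // ltW.
  by move=> n; rewrite mulrAC; exact: stepn.
have [v vP] := choice lim_v.
have lbmv : lbm v.
  split.
    apply: (measurable_fun_cvg (fun n => (lvn n).1)) => t _.
    apply/cvgrPdist_le => e e0.
    have [N HN] := dyadic_small (2 * (A * E t)) e0.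
    by exists N => // n /= Nn; apply: le_trans (vP t n) (HN n Nn).
  move=> c d; exists (2 * A * expR (lam * (`|c - s| + `|d - s|))) => t ct.
  have := vP t 0%N; rewrite subr0 expr0 divr1 => /le_trans; apply.
  rewrite mulrA ler_wpM2l ?mulr_ge0 // ler_expR ler_pM2l //.
  have h1 : s - c <= `|c - s| by rewrite distrC ler_norm.
  have h2 := ler_norm (d - s); have h3 := normr_ge0 (c - s).
  by rewrite ler_norml; have := normr_ge0 (d - s); clear -ct h1 h2 h3; lra.
have Tv t : T v t = v t.
  apply/eqP; rewrite -subr_eq0 -normr_le0; apply/ler_addgt0Pl => e e0.
  have [N HN] := dyadic_small (2 * A * E t) e0; have {}HN := HN N (leqnn N).
  have AN : 0 <= 2 * A / 2 ^+ N by rewrite divr_ge0 ?exprn_ge0 // mulr_ge0.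
  have h1 l : `|v l - vn N l| <= 2 * A / 2 ^+ N * E l.
    by apply: le_trans (vP l N) _; rewrite mulrA mulrAC.
  have {h1} h1 := contr _ _ _ lbmv (lvn N) AN h1 t.
  have h2 := vP t N.+1.
  have -> : T v t - v t = (T v t - vn N.+1 t) - (v t - vn N.+1 t) by ring.
  apply: le_trans (ler_normB _ _) _; rewrite addr0.
  have -> : e = e / 2 + e / 2 by field.
  apply: lerD.
    apply: le_trans h1 _.
    have -> : 2 * A / 2 ^+ N / 2 * E t = 2 * A * E t / 2 ^+ N / 2.
      by rewrite mulrAC (mulrAC _ _ (E t)).
    by rewrite ler_pM2r.
  apply: le_trans h2 _.
  have -> : 2 * (A * E t) / 2 ^+ N.+1 = 2 * A * E t / 2 ^+ N / 2.
    by rewrite exprSr invfM !mulrA.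
  by rewrite ler_pM2r.
exists (U v), v; split.
- split => c d; first exact: UP.
  by apply: eq_primitive (TP v lbmv c d) => // t _; rewrite Tv.
- by rewrite /U J0 addr0.
- by rewrite -Tv /T J0 addr0.
Qed.
End LinearSystem.

(** * Solutions as primitives, uniqueness and order *)

Section Positivity.
Variable R : realType.
Implicit Types (f g x z : R -> R) (c d s t u v : R).

Lemma abs_continuousN c d f :
  abs_continuous c d f -> abs_continuous c d (fun t => - f t).
Proof.
move=> acf e e0; have [del del0 H] := acf e e0; exists del => // n u v h1 h2 h3.
under eq_bigr do rewrite -opprD normrN.
exact: H.
Qed.

Lemma abs_continuous_sub c d c' d' f : c <= c' -> d' <= d ->
  abs_continuous c d f -> abs_continuous c' d' f.
Proof.
move=> cc dd acf e e0; have [del del0 H] := acf e e0; exists del => // n u v h1.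
by apply: H => i; have := h1 i; move: cc dd; clear; lra.
Qed.

Lemma abs_continuous_bounded c d f : abs_continuous c d f ->
  exists2 M : R, 0 <= M & forall t, c <= t <= d -> `|f t| <= M.
Proof.
move=> acf; have [cd|dc] := leP c d; last by exists 0 => // t; lra.
have [del del0 H] := abs_continuous_seq acf ltr01.
have short u v : c <= u -> u <= v -> v <= d -> v - u < del -> `|f v - f u| <= 1.
  move=> cu uv vd uvd; have [->|nuv] := eqVneq u v; first by rewrite subrr normr0.
  have {}uv : u < v by rewrite lt_neqAle nuv.
  apply: ltW; have := H [:: (u, v)]; rewrite !big_seq1 /=; apply => //.
  by move=> p; rewrite inE => /eqP ->.
have del20 : 0 < del / 2 by rewrite divr_gt0.
(* t is reached from c in k steps, along each of which f varies by at most 1 *)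
have cover k t : c <= t <= d -> t - c <= k%:R * (del / 2) -> `|f t - f c| <= k%:R.
  elim: k t => [|k IH] t ct tk.
    rewrite (_ : t = c) ?subrr ?normr0 //.
    by move: tk; rewrite mul0r; move: ct; clear; lra.
  rewrite -natr1 in tk *; rewrite mulrDl mul1r in tk.
  pose u := Num.max c (t - del / 2).
  have hu : [/\ c <= u, u <= t & t - u <= del / 2].
    by rewrite /u; case: (leP c (t - del / 2)) => h; split=> //; move: h ct del20; clear; lra.
  have [h1 h2 h3] := hu.
  have hu' : u - c <= k%:R * (del / 2).
    have : 0 <= k%:R * (del / 2) by rewrite mulr_ge0 // ltW.
    by rewrite /u; case: (leP c (t - del / 2)) => h; move: tk; clear; lra.
  have := IH u ltac:(move: ct h1 h2; clear; lra) hu'.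
  have := short u t h1 h2 ltac:(move: ct; clear; lra) ltac:(move: h3 del0; clear; lra).
  have := ler_normD (f t - f u) (f u - f c).
  by rewrite (_ : f t - f u + (f u - f c) = f t - f c); [lra|ring].
have [k hk] : exists k : nat, (d - c) / (del / 2) <= k%:R.
  exists (Num.truncn ((d - c) / (del / 2))).+1.
  by apply: ltW; apply: truncnS_gt.
exists (k%:R + `|f c|) => [|t ct]; first by rewrite addr_ge0.
have := cover k t ct; rewrite ler_pdivrMr // in hk.
move=> /(_ ltac:(move: ct hk; clear; lra)).
by have := ler_normD (f t - f c) (f c); rewrite subrK; lra.
Qed.

(** A mean value inequality in both directions makes the function Lipschitz. *)
Lemma ac_primitive c d K f g : abs_continuous c d f ->
  {ae (@lebesgue_measure R), forall t, c < t < d -> is_derive t (1 : R) f (g t)} ->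
  (forall t, c < t < d -> `|g t| <= K) -> primitive c d g f.
Proof.
move=> acf ae gK; split=> //.
have up u v : c <= u -> u <= v -> v <= d -> `|f v - f u| <= `|K| * `|v - u|.
  move=> cu uv vd; rewrite (ger0_norm (x := v - u)) ?subr_ge0 // ler_norml.
  have sub t : u < t < v -> c < t < d by move: cu vd; clear; lra.
  have gK' t : u < t < v -> - `|K| <= g t <= `|K|.
    move=> /sub /gK; rewrite -ler_norml => /le_trans; apply; exact: ler_norm.
  have K0 : - `|K| <= 0 by rewrite oppr_le0.
  have h1 := ac_mean_value uv K0 (abs_continuous_sub cu vd acf).
  have h2 := ac_mean_value uv K0 (abs_continuousN (abs_continuous_sub cu vd acf)).
  have {}h1 := h1 ltac:(apply: aeS ae => t h ut; exists (g t);
    [by have /andP[] := gK' t ut|exact: h (sub t ut)]).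
  have {}h2 := h2 ltac:(apply: aeS ae => t h ut; exists (- g t);
    [by have /andP[] := gK' t ut; rewrite lerN2
    |by apply: is_deriveN; exact: h (sub t ut)]).
  by move: h1 h2; clear; lra.
exists `|K| => // s t hs ht; have [st|ts] := leP s t.
  by apply: up => //; move: hs ht; clear; lra.
by rewrite distrC (distrC t); apply: up; move: ts hs ht; clear; lra.
Qed.

Lemma lipschitz_IVT c d x s t : lipschitz_itv c d x ->
  c <= s <= d -> c <= t <= d -> 0 < x s -> x t <= 0 ->
  exists2 l, c <= l <= d & x l = 0.
Proof.
move=> [L L0 H] hs ht xs xt.
(* extending x by constants outside [c, d] makes it continuous on the line *)
pose k (l : R) := Num.min (Num.max l c) d.
have cd : c <= d by move: hs; clear; lra.
have kP l : [\/ l <= c /\ k l = c, c < l <= d /\ k l = l | d < l /\ k l = d].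
  rewrite /k; have [lc|cl] := leP l c; first by apply: Or31; rewrite min_l.
  by have [ld|dl] := leP l d; [apply: Or32|apply: Or33].
have kin l : c <= k l <= d.
  by case: (kP l) => -[h ->]; move: h cd; clear; lra.
have kE l : c <= l <= d -> k l = l.
  by case: (kP l) => -[h ->]; move: h cd; clear; lra.
have kl a b : `|k a - k b| <= `|a - b|.
  have h1 := ler_norm (a - b); have := ler_norm (b - a).
  rewrite (distrC b) ler_norml => h2.
  by case: (kP a) => -[h ->]; case: (kP b) => -[h' ->]; move: h h' h1 h2 cd; clear; lra.
have ck : continuous (x \o k).
  move=> l; have lx : lipschitz_itv (l - 1) (l + 1) (x \o k).
    exists L => // a b _ _ /=; apply: le_trans (H _ _ (kin a) (kin b)) _.
    by rewrite ler_wpM2l.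
  by apply: (lipschitz_continuous lx); clear; lra.
have IV a b : a <= b -> (x (k a) <= 0 /\ 0 <= x (k b)) \/ (0 <= x (k a) /\ x (k b) <= 0) ->
    exists2 l, c <= l <= d & x l = 0.
  move=> ab hab; have [||l _ xl] := @IVT _ (x \o k) a b 0 ab.
  - exact: continuous_subspaceT.
  - by rewrite ge_min le_max /=; case: hab => [[-> ->]|[-> ->]]; rewrite ?orbT.
  - by exists (k l).
have [st|ts] := leP s t.
  by apply: (IV s t st); right; rewrite !kE //; split => //; exact: ltW.
by apply: (IV t s (ltW ts)); left; rewrite !kE //; split => //; exact: ltW.
Qed.

(** A zero of [x] would force [x] to vanish identically. *)
Lemma primitive_positive c d K g x s : primitive c d g x ->
  (forall t, c < t < d -> `|g t| <= K * `|x t|) -> c <= s <= d -> 0 < x s ->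
  forall t, c <= t <= d -> 0 < x t.
Proof.
move=> gx gK hs xs t ht; rewrite ltNge; apply/negP => xt.
have [lx _] := gx.
have [l hl xl] := lipschitz_IVT lx hs ht xs xt.
by have := primitive_zero gx gK hl xl hs => x0; rewrite x0 ltxx in xs.
Qed.

End Positivity.

Section Riccati.
Variable R : realType.
Notation mu := (@lebesgue_measure R).
Variables (Q P : R -> R).
Hypothesis (bQ : bounded_measurable Q) (bP : bounded_measurable P).
Implicit Types (D : set R) (f g x z u v : R -> R) (c d s t : R).

Local Notation ric x := (fun t => riccati Q P t (x t)).

Lemma solution_sub D D' x : solution Q P D x -> is_interval D' -> D' `<=` D ->
  solution Q P D' x.
Proof.
move=> [_ acD ae] iD' DD; split => //.
  by move=> c d cd cdD; apply: acD => // t /cdD; exact: DD.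
by apply: aeS ae => t h D't; apply: h; exact: DD.
Qed.

Lemma solution_primitive D x c d : solution Q P D x ->
  `[c, d]%classic `<=` D -> primitive c d (ric x) x.
Proof.
move=> [_ acD ae] cdD; have [cd|dc] := leP c d; last first.
  split; first by exists 0 => // s t; move: dc; clear -bQ bP; lra.
  by apply: aeW => t; move: dc; clear -bQ bP; lra.
have acx := acD c d cd cdD.
have [M M0 xM] := abs_continuous_bounded acx.
have [_ [CQ QC]] := bQ; have [_ [CP PC]] := bP.
apply: (@ac_primitive R c d (M ^+ 2 + CQ * M + CP) x) => //.
  apply: aeS ae => t h ct; apply: h; apply: cdD.
  by rewrite /= in_itv /=; move: ct; clear -bQ bP; lra.
move=> t ct; have {ct} xt : `|x t| <= M by apply: xM; move: ct; clear -bQ bP; lra.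
rewrite /riccati; apply: le_trans (ler_normD _ _) _; apply: lerD => //.
apply: le_trans (ler_normD _ _) _; apply: lerD.
  by rewrite normrN normrX lerXn2r ?nnegrE.
by rewrite normrM ler_pM.
Qed.

Lemma riccati_diff_bound c d x1 x2 : lipschitz_itv c d x1 -> lipschitz_itv c d x2 ->
  exists K : R, forall t, c < t < d ->
  `|riccati Q P t (x2 t) - riccati Q P t (x1 t)| <= K * `|x2 t - x1 t|.
Proof.
move=> /lipschitz_bounded [M1 M10 h1] /lipschitz_bounded [M2 M20 h2].
have [_ [CQ QC]] := bQ.
exists (CQ + M1 + M2) => t ct.
have -> : riccati Q P t (x2 t) - riccati Q P t (x1 t)
     = (Q t - x1 t - x2 t) * (x2 t - x1 t) by rewrite /riccati; ring.
rewrite normrM ler_wpM2r //.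
have {}h1 := h1 t ltac:(move: ct; clear -bQ bP; lra).
have {}h2 := h2 t ltac:(move: ct; clear -bQ bP; lra).
apply: le_trans (ler_normB _ _) _; apply: lerD => //.
by apply: le_trans (ler_normB _ _) _; apply: lerD.
Qed.

(** The difference [z] of two solutions satisfies
    [z' = (Q - x1 - x2) * z], so that it cannot change sign. *)
Lemma solution_lt D x1 x2 s t : solution Q P D x1 -> solution Q P D x2 ->
  D s -> D t -> x1 s < x2 s -> x1 t < x2 t.
Proof.
move=> s1 s2 Ds Dt lt_s.
pose c := Num.min s t; pose d := Num.max s t.
have cdD : `[c, d]%classic `<=` D.
  have [iD _ _] := s1.
  rewrite /c /d; move=> l /=; rewrite in_itv /=; case: (leP s t) => st.
    exact: iD Ds Dt l.
  exact: iD Dt Ds l.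
have p1 := solution_primitive s1 cdD; have p2 := solution_primitive s2 cdD.
have [K HK] := riccati_diff_bound p1.1 p2.1.
have := primitive_positive (primitiveB p2 p1) HK (s := s).
rewrite !subr_gt0 => /(_ _ lt_s t); rewrite subr_gt0; apply;
by rewrite /c /d; case: (leP s t) => h; move: h; clear -bQ bP; lra.
Qed.

Lemma solution_unique D x1 x2 s t : solution Q P D x1 -> solution Q P D x2 ->
  D s -> D t -> x1 s = x2 s -> x1 t = x2 t.
Proof.
move=> s1 s2 Ds Dt eq_s; have [h|h|//] := ltgtP (x1 t) (x2 t).
  by have := solution_lt s1 s2 Dt Ds h; rewrite eq_s ltxx.
by have := solution_lt s2 s1 Dt Ds h; rewrite eq_s ltxx.
Qed.

Lemma solution_le D x1 x2 s t : solution Q P D x1 -> solution Q P D x2 ->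
  D s -> D t -> x1 s <= x2 s -> x1 t <= x2 t.
Proof.
move=> s1 s2 Ds Dt; rewrite le_eqVlt => /orP[/eqP/(solution_unique s1 s2 Ds Dt) -> //|].
by move=> /(solution_lt s1 s2 Ds Dt) /ltW.
Qed.

End Riccati.

(** * The maximally extended solutions *)

Section MaximalSolution.
Variable R : realType.
Notation mu := (@lebesgue_measure R).
Variables (Q P : R -> R).
Hypothesis (bQ : bounded_measurable Q) (bP : bounded_measurable P).
Implicit Types (D : set R) (f g x z u v : R -> R) (c d s t : R).

Local Notation ric x := (fun t => riccati Q P t (x t)).

Definition positive_component u s : set R :=
  [set t | forall l, Num.min s t <= l <= Num.max s t -> 0 < u l].

Lemma positive_componentP u s t : positive_component u s t <->
  (forall l, s <= l <= t \/ t <= l <= s -> 0 < u l).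
Proof.
split=> [H l hl|H l].
  apply: H; case: (leP s t) => st; move: hl st; clear -bQ bP; lra.
by move=> hl; apply: H; move: hl; case: (leP s t) => st; move: st; clear -bQ bP; lra.
Qed.

(** The difference [e = v - x * u] satisfies [e' = (Q - x) * e] and vanishes at [s],
    hence everywhere; then [u' = x * u] keeps [u] positive. *)
Lemma solution_linear D x u v s t : solution Q P D x -> linear_solution Q P u v ->
  D s -> u s = 1 -> v s = x s -> D t -> 0 < u t /\ v t = x t * u t.
Proof.
move=> sx [uP vP] Ds us vs Dt.
pose c := Num.min s t; pose d := Num.max s t.
have cdD : `[c, d]%classic `<=` D.
  have [iD _ _] := sx.
  rewrite /c /d; move=> l /=; rewrite in_itv /=; case: (leP s t) => st.
    exact: iD Ds Dt l.
  exact: iD Dt Ds l.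
have hs : c <= s <= d by rewrite /c /d; case: (leP s t) => h; move: h; clear -bQ bP; lra.
have ht : c <= t <= d by rewrite /c /d; case: (leP s t) => h; move: h; clear -bQ bP; lra.
have px := solution_primitive bQ bP sx cdD.
have [M M0 xM] := lipschitz_bounded px.1.
have [_ [CQ QC]] := bQ.
pose e l := v l - x l * u l.
have pe : primitive c d (fun l => (Q l - x l) * e l) e.
  apply: eq_primitive (primitiveB (vP c d) (primitiveM px (uP c d))) => // l _.
  by rewrite /riccati /e; ring.
have eK l : c < l < d -> `|(Q l - x l) * e l| <= (CQ + M) * `|e l|.
  move=> hl; rewrite normrM ler_wpM2r //; apply: le_trans (ler_normB _ _) _.
  by apply: lerD => //; apply: xM; move: hl; clear -bQ bP; lra.
have e0 := primitive_zero pe eK hs ltac:(by rewrite /e us vs mulr1 subrr).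
have vE l : c <= l <= d -> v l = x l * u l.
  by move=> /e0 /eqP; rewrite subr_eq0 => /eqP.
split; last exact: vE.
apply: (primitive_positive (K := M) (uP c d) _ hs) => //; last by rewrite us.
move=> l hl; rewrite vE; last by move: hl; clear -bQ bP; lra.
by rewrite normrM ler_wpM2r //; apply: xM; move: hl; clear -bQ bP; lra.
Qed.

(** The exceptional null sets of countably many compact intervals are collected. *)
Lemma linear_solution_ae u v : linear_solution Q P u v ->
  {ae mu, forall t, is_derive t (1 : R) u (v t) /\
                    is_derive t (1 : R) v (Q t * v t + P t * u t)}.
Proof.
move=> [uP vP].
pose T n := [set t : R | - n%:R < t < n%:R -> is_derive t (1 : R) u (v t) /\
                    is_derive t (1 : R) v (Q t * v t + P t * u t)].
have : {ae mu, forall t, forall n, T n t}.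
  apply: ae_foralln => n.
  have [_ h1] := uP (- n%:R) n%:R; have [_ h2] := vP (- n%:R) n%:R.
  by apply: aeS2 h1 h2 => t h h' ht; split; auto.
apply: aeS => t H; apply: (H (Num.truncn `|t|).+1).
by rewrite -ltr_norml truncnS_gt.
Qed.

Lemma linear_continuous g u : (forall c d, primitive c d g u) -> continuous u.
Proof.
move=> gu t; have [lx _] := gu (t - 1) (t + 1).
by apply: (lipschitz_continuous lx); clear -bQ bP; lra.
Qed.

Lemma positive_lower_bound u c d : c <= d -> continuous u ->
  (forall t, c <= t <= d -> 0 < u t) ->
  exists2 m, 0 < m & forall t, c <= t <= d -> m <= u t.
Proof.
move=> cd cu u0.
have [t0 ht0 H] := EVT_min cd (continuous_subspaceT cu).
exists (u t0); first by apply: u0; move: ht0; rewrite in_itv.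
by move=> t ht; apply: H; rewrite in_itv.
Qed.

Lemma solution_quotient u v s : linear_solution Q P u v -> u s = 1 ->
  solution Q P (positive_component u s) (fun t => v t / u t).
Proof.
move=> luv us; have [uP vP] := luv.
have posD t : positive_component u s t -> 0 < u t.
  by move=> /positive_componentP; apply; case: (leP s t) => st; [left|right]; move: st; clear -bQ bP; lra.
split.
- move=> a b /positive_componentP ha /positive_componentP hb l hl.
  apply/positive_componentP => k hk.
  have [[h|h]|[h|h]] : (s <= k <= a \/ a <= k <= s) \/ (s <= k <= b \/ b <= k <= s).
  + by case: (leP s k) => sk; move: hl hk sk; clear -bQ bP; lra.
  + by apply: ha; left.
  + by apply: ha; right.
  + by apply: hb; left.
  + by apply: hb; right.
- move=> c d cd cdD.
  have u0 t : c <= t <= d -> 0 < u t by move=> ht; apply: posD; apply: cdD; rewrite /= in_itv.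
  have [m m0 um] := positive_lower_bound cd (linear_continuous uP) u0.
  apply: lipschitz_abs_continuous.
  by have [] := primitiveM (vP c d) (primitiveV m0 um (uP c d)).
apply: aeS (linear_solution_ae luv) => t [du dv] Dt.
have ut0 : u t != 0 by rewrite gt_eqF // posD.
apply: is_derive_eq (is_deriveM dv (is_deriveV ut0 du)) _.
by rewrite /GRing.scale /= /riccati; field.
Qed.

(** By [solution_linear] every solution through [(s, y0)] is a restriction of the
    quotient [v / u] on the component of [s] in the set where [u] is positive, so
    that this quotient is the maximal solution, whichever one choice selects. *)
Lemma maximal_throughP s (y0 : R) : exists u v,
  [/\ linear_solution Q P u v /\ (u s = 1 /\ v s = y0),
      [/\ maximal_solution Q P (ydom Q P s y0) (fun t => y Q P t s y0),
         ydom Q P s y0 s & y Q P s s y0 = y0],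
      ydom Q P s y0 = positive_component u s &
      forall t, ydom Q P s y0 t -> 0 < u t /\ v t = y Q P t s y0 * u t].
Proof.
have [u [v [luv us vs]]] := linear_solution_exists s 1 y0 bQ bP.
exists u, v.
pose D := positive_component u s; pose x t := v t / u t.
have Ds : D s.
  by apply/positive_componentP => l hl; rewrite (_ : l = s) ?us //; move: hl; clear -bQ bP; lra.
have sx := solution_quotient luv us.
have xs : x s = y0 by rewrite /x us vs divr1.
have great D' x' : solution Q P D' x' -> D' s -> x' s = y0 -> D' `<=` D.
  move=> sx' D's x's t D't; apply/positive_componentP => l hl.
  have [iD' _ _] := sx'.
  have D'l : D' l by case: hl; [exact: iD'|exact: iD'].
  by have [] := solution_linear sx' luv D's us (etrans vs (esym x's)) D'l.
have mDx : [/\ maximal_solution Q P D x, D s & x s = y0].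
  split => //; split => // D' x' sx' DD' xx'.
  by apply: great sx' (DD' _ Ds) _; rewrite xx'.
have : [set Dx : set R * (R -> R) |
        [/\ maximal_solution Q P Dx.1 Dx.2, Dx.1 s & Dx.2 s = y0]] (D, x) by [].
move=> /getI; rewrite -/(maximal_through Q P s y0) => -[[s1 max1] D1s y1s].
have D1D := great _ _ s1 D1s y1s.
have ux1 t : (maximal_through Q P s y0).1 t -> 0 < u t /\
    v t = (maximal_through Q P s y0).2 t * u t.
  by move=> D1t; apply: (solution_linear s1 luv D1s us) => //; rewrite vs y1s.
split => //; apply/seteqP; split => //.
apply: (max1 D x) => // t D1t; rewrite /x; have [h ->] := ux1 t D1t.
by rewrite mulfK // gt_eqF.
Qed.

Lemma y_maximal s (y0 : R) :
  maximal_solution Q P (ydom Q P s y0) (fun t => y Q P t s y0).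
Proof. by have [u [v [_ [h _ _] _ _]]] := maximal_throughP s y0. Qed.

Lemma y_solution s (y0 : R) : solution Q P (ydom Q P s y0) (fun t => y Q P t s y0).
Proof. by case: (y_maximal s y0). Qed.

Lemma ydom_id s (y0 : R) : ydom Q P s y0 s.
Proof. by have [u [v [_ [_ h _] _ _]]] := maximal_throughP s y0. Qed.

Lemma y_id s (y0 : R) : y Q P s s y0 = y0.
Proof. by have [u [v [_ [_ _ h] _ _]]] := maximal_throughP s y0. Qed.

Lemma y_greatest D x s : solution Q P D x -> D s ->
  D `<=` ydom Q P s (x s) /\ forall t, D t -> x t = y Q P t s (x s).
Proof.
move=> sx Ds; have [u [v [[luv [us vs]] _ dE yE]]] := maximal_throughP s (x s).
have DD t : D t -> ydom Q P s (x s) t.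
  move=> Dt; rewrite dE; apply/positive_componentP => l hl.
  have [iD _ _] := sx.
  have Dl : D l by case: hl; exact: iD.
  by have [] := solution_linear sx luv Ds us vs Dl.
split => // t Dt.
have [ut vt] := solution_linear sx luv Ds us vs Dt.
have [_ vt'] := yE t (DD t Dt).
by apply: (mulIf (lt0r_neq0 ut)); rewrite -vt -vt'.
Qed.

Lemma maximal_solutionE D x s : maximal_solution Q P D x -> D s ->
  ydom Q P s (x s) = D /\ forall t, D t -> y Q P t s (x s) = x t.
Proof.
move=> [sx mx] Ds; have [DD xE] := y_greatest sx Ds.
split=> [|t Dt]; last exact/esym/xE.
apply/seteqP; split => //; apply: mx (y_solution _ _) DD _ => t Dt.
exact/esym/xE.
Qed.

Lemma ydom_interval s (y0 : R) a b t : ydom Q P s y0 a -> ydom Q P s y0 b ->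
  a <= t <= b -> ydom Q P s y0 t.
Proof. by move=> ha hb; have [iD _ _] := y_solution s y0; exact: iD. Qed.

(** Since [u' = y * u <= M * u], going backwards from [u s = 1] the function [u]
    decays at most exponentially and cannot reach the value [0]. *)
Lemma ydom_backward s (y0 M : R) t0 : t0 <= s ->
  (forall t, t0 <= t <= s -> ydom Q P s y0 t -> y Q P t s y0 <= M) ->
  forall t, t0 <= t <= s -> ydom Q P s y0 t.
Proof.
move=> t0s yM t ht.
have [u [v [[[uP vP] [us vs]] _ dE yE]]] := maximal_throughP s y0.
rewrite dE; apply/positive_componentP => l hl; rewrite ltNge; apply/negP => ul.
pose A := [set k | t0 <= k <= s /\ u k <= 0].
have Al : A l by split => //; move: hl ht; clear -bQ bP; lra.
have supA : has_sup A by split; [exists l|exists s => k [/andP[]]].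
have ubA k : A k -> k <= sup A by apply: ub_le_sup; case: supA.
have supl := ubA l Al.
have sups : sup A <= s by apply: ge_sup => [|k [/andP[]]]; [exists l|].
(* [sup A] is the last zero of [u] before [s] *)
have usup : u (sup A) <= 0.
  rewrite leNgt; apply/negP => u0.
  have cu : continuous u by apply: linear_continuous uP.
  have /cvgrPdist_lt /(_ _ u0) := cu (sup A).
  rewrite nearE => /nbhs_ballP[eta /= eta0 H].
  have [k Ak hk] := sup_adherent eta0 supA.
  have := H k; rewrite /ball /= ger0_norm ?subr_ge0 ?ubA // => /(_ ltac:(move: hk; clear -bQ bP; lra)).
  move=> /(le_lt_trans (ler_norm _)); case: Ak => _; clear -bQ bP; lra.
have t0sup : t0 <= sup A by move: supl hl ht; clear -bQ bP; lra.
have D k : sup A < k <= s -> positive_component u s k.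
  move=> hk; apply/positive_componentP => m hm; rewrite ltNge; apply/negP => um.
  have : m <= sup A by apply: ubA; split => //; move: hm hk t0sup; clear -bQ bP; lra.
  by move: hm hk; clear -bQ bP; lra.
have := primitive_expR_le (k := M) sups (uP (sup A) s).
have H k : sup A < k < s -> v k <= M * u k.
  move=> hk; have Dk : ydom Q P s y0 k by rewrite dE; apply: D; move: hk; clear -bQ bP; lra.
  have [uk ->] := yE k Dk.
  by rewrite ler_wpM2r ?(ltW uk) // yM //; move: hk t0sup; clear -bQ bP; lra.
move=> /(_ H); rewrite us => /(lt_le_trans ltr01); rewrite pmulr_lgt0 ?expR_gt0 //.
by rewrite ltNge usup.
Qed.

(** Symmetric to [ydom_backward], for solutions bounded below. *)
Lemma ydom_forward s (y0 M : R) t1 : s <= t1 ->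
  (forall t, s <= t <= t1 -> ydom Q P s y0 t -> M <= y Q P t s y0) ->
  forall t, s <= t <= t1 -> ydom Q P s y0 t.
Proof.
move=> st1 yM t ht.
have [u [v [[[uP vP] [us vs]] _ dE yE]]] := maximal_throughP s y0.
rewrite dE; apply/positive_componentP => l hl; rewrite ltNge; apply/negP => ul.
pose A := [set k | s <= k <= t1 /\ u k <= 0].
have Al : A l by split => //; move: hl ht; clear -bQ bP; lra.
have infA : has_inf A by split; [exists l|exists s => k [/andP[]]].
have lbA k : A k -> inf A <= k by apply: ge_inf; case: infA.
have infl := lbA l Al.
have infs : s <= inf A by apply: lb_le_inf => [|k [/andP[]]]; [exists l|].
(* [inf A] is the first zero of [u] after [s] *)
have uinf : u (inf A) <= 0.
  rewrite leNgt; apply/negP => u0.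
  have cu : continuous u by apply: linear_continuous uP.
  have /cvgrPdist_lt /(_ _ u0) := cu (inf A).
  rewrite nearE => /nbhs_ballP[eta /= eta0 H].
  have [k Ak hk] := inf_adherent eta0 infA.
  have := H k; rewrite /ball /= distrC ger0_norm ?subr_ge0 ?lbA // => /(_ ltac:(move: hk; clear -bQ bP; lra)).
  by move=> /(le_lt_trans (ler_norm _)); case: Ak => _; clear -bQ bP; lra.
have inft1 : inf A <= t1 by move: infl hl ht; clear -bQ bP; lra.
have D k : s <= k < inf A -> positive_component u s k.
  move=> hk; apply/positive_componentP => m hm; rewrite ltNge; apply/negP => um.
  have : inf A <= m by apply: lbA; split => //; move: hm hk inft1; clear -bQ bP; lra.
  by move: hm hk; clear -bQ bP; lra.
have := primitive_expR_ge (k := M) infs (uP s (inf A)).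
have H k : s < k < inf A -> M * u k <= v k.
  move=> hk; have Dk : ydom Q P s y0 k by rewrite dE; apply: D; move: hk; clear -bQ bP; lra.
  have [uk ->] := yE k Dk.
  by rewrite ler_wpM2r ?(ltW uk) // yM //; move: hk inft1; clear -bQ bP; lra.
move=> /(_ H); rewrite us mul1r => /(lt_le_trans (expR_gt0 _)).
by rewrite ltNge uinf.
Qed.

Lemma ydom_open_right s (y0 : R) t : ydom Q P s y0 t -> exists2 t', t < t' & ydom Q P s y0 t'.
Proof.
have [u [v [[[uP vP] [us vs]] _ dE yE]]] := maximal_throughP s y0.
rewrite dE => /positive_componentP Dt.
have ut : 0 < u t by apply: Dt; case: (leP s t) => h; move: h; clear -bQ bP; lra.
have cu : continuous u by apply: linear_continuous uP.
have /cvgrPdist_lt /(_ _ ut) := cu t.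
rewrite nearE => /nbhs_ballP[eta /= eta0 H].
exists (t + eta / 2); first by move: eta0; clear -bQ bP; lra.
apply/positive_componentP => l hl.
have [h|h] : (s <= l <= t \/ t <= l <= s) \/ t <= l <= t + eta / 2.
- by case: (leP l t) => lt; move: hl eta0 lt; clear -bQ bP; lra.
- exact: Dt.
have := H l; rewrite /ball /= ltr_distlC.
move=> /(_ ltac:(move: h eta0; clear -bQ bP; lra)) /(le_lt_trans (ler_norm _)).
by clear -bQ bP; lra.
Qed.

End MaximalSolution.

(** * Perturbed logistic equations *)

Section Logistic.
Variable R : realType.
Implicit Types (delta eps T c d k : R) (F : R -> R -> R) (phi : R -> R).

(** At time [t] the field [F t] is [w * th * (1 - th)], with [w] bounded below, up
    to an error that grows at most linearly in [th].  Its zeros near [0] and [1]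
    play the roles of the repeller and of the attractor. *)
Definition nearly_logistic delta eps F t :=
  exists2 w : R, delta <= w & forall th : R,
    `|F t th - w * th * (1 - th)| <= delta * eps / 4 * (1 + `|th|).

Definition logistic_before delta F eps T := 0 < eps /\ eps <= 1 / 4 /\
  forall t, t <= T -> nearly_logistic delta eps F t.

Definition trajectory F c d phi := primitive c d (fun t => F t (phi t)) phi.

Variables (delta : R) (F : R -> R -> R).
Hypothesis (delta0 : 0 < delta).
Local Notation calm := (logistic_before delta F).

(** The next three lemmas give the sign of the field away from [0] and [1]; the
    error is absorbed because [eps] is at most [1 / 4]. *)
Lemma logistic_field_above eps T t (th : R) : calm eps T -> t <= T ->
  1 + eps <= th -> F t th <= - (delta / 2) * (th - 1) ^+ 2.
Proof.
move=> [e0 [e4 H]] /H [w dw /(_ th) + th1]; move: (F t th) => Ft.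
rewrite (ger0_norm (x := th)); last lra.
rewrite ler_norml => /andP[_ h].
have h1 : 0 <= (w - delta) * (th * (th - 1)) by rewrite mulr_ge0 ?mulr_ge0 ?subr_ge0 //; lra.
have h2 : 0 <= delta * (th * (th - 1 - eps)).
  by rewrite mulr_ge0 ?mulr_ge0 ?subr_ge0 // ?(ltW delta0); lra.
have h3 : 0 <= delta * (eps * (th - 1)) by rewrite !mulr_ge0 ?(ltW delta0) ?(ltW e0) //; lra.
have h4 : 0 <= delta * (th - 1) by rewrite !mulr_ge0 ?(ltW delta0) //; lra.
have -> : (th - 1) ^+ 2 = th * (th - 1) - (th - 1) by ring.
lra.
Qed.

Lemma logistic_field_between eps T t (th : R) : calm eps T -> t <= T ->
  eps <= th -> th <= 1 - eps -> delta * eps / 4 <= F t th.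
Proof.
move=> [e0 [e4 H]] /H [w dw /(_ th) + th0 th1]; move: (F t th) => Ft.
rewrite (ger0_norm (x := th)); last lra.
rewrite ler_norml => /andP[h _].
have h1 : 0 <= (w - delta) * (th * (1 - th)) by rewrite mulr_ge0 ?mulr_ge0 ?subr_ge0 //; lra.
have h2 : 0 <= delta * ((th - eps) * (1 - eps - th)).
  by rewrite !mulr_ge0 ?subr_ge0 // ?(ltW delta0).
have h3 : 0 <= delta * eps * (1 - th) by rewrite !mulr_ge0 ?(ltW delta0) ?(ltW e0) //; lra.
have h4 : 0 <= delta * eps * (1 / 4 - eps).
  by rewrite !mulr_ge0 ?(ltW delta0) ?(ltW e0) //; lra.
lra.
Qed.

Lemma logistic_field_below eps T t (th : R) : calm eps T -> t <= T ->
  th <= - eps -> F t th <= - (delta / 2) * th ^+ 2.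
Proof.
move=> [e0 [e4 H]] /H [w dw /(_ th) + th1]; move: (F t th) => Ft.
rewrite (ler0_norm (x := th)); last lra.
rewrite ler_norml => /andP[_ h].
have h1 : 0 <= (w - delta) * (- th * (1 - th)) by rewrite mulr_ge0 ?mulr_ge0 ?subr_ge0 //; lra.
have h2 : 0 <= delta * ((- th - eps) * (1 - th)).
  by rewrite !mulr_ge0 ?subr_ge0 // ?(ltW delta0) //; lra.
have h3 : 0 <= delta * (th * th) by rewrite mulr_ge0 ?(ltW delta0) // -expr2 sqr_ge0.
have h4 : 0 <= delta * (- th) by rewrite !mulr_ge0 ?(ltW delta0) //; lra.
rewrite expr2; lra.
Qed.

Lemma trajectory_sub c d c' d' phi : c <= c' -> d' <= d ->
  trajectory F c d phi -> trajectory F c' d' phi.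
Proof. exact: primitive_sub. Qed.

Lemma trajectory_stays_below eps T c d phi k : calm eps T -> c <= d -> d <= T ->
  trajectory F c d phi -> 1 + eps <= k -> phi c <= k -> phi d <= k.
Proof.
move=> cT cd dT pF ek; apply: (primitive_barrier (K' := k + 1) cd pF).
  by rewrite ltrDl.
move=> t ht hk; have tT : t <= T by lra.
have := logistic_field_above (th := phi t) cT tT ltac:(lra).
have : 0 <= delta / 2 * (phi t - 1) ^+ 2 by rewrite mulr_ge0 ?sqr_ge0 // divr_ge0 // ltW.
lra.
Qed.

Lemma trajectory_stays_above eps T c d phi k : calm eps T -> c <= d -> d <= T ->
  trajectory F c d phi -> eps < k -> k <= 1 - eps -> k <= phi c -> k <= phi d.
Proof.
move=> cT cd dT pF ek k1 kc.
have := primitive_barrier (K := - k) (K' := - eps) cd (primitiveZ (-1) pF).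
rewrite !mulN1r !lerN2 ltrN2; apply => //.
move=> t ht hk; have tT : t <= T by lra.
rewrite mulN1r oppr_le0.
have := logistic_field_between (th := phi t) cT tT ltac:(lra) ltac:(lra).
have : 0 <= delta * eps / 4.
  by case: cT => e0 _; rewrite !mulr_ge0 // ltW.
lra.
Qed.

Lemma trajectory_stays_negative eps T c d phi k : calm eps T -> c <= d -> d <= T ->
  trajectory F c d phi -> k < - eps -> phi c <= k -> phi d <= k.
Proof.
move=> cT cd dT pF ek; apply: (primitive_barrier (K' := - eps) cd pF) => //.
move=> t ht hk; have tT : t <= T by lra.
have := logistic_field_below (th := phi t) cT tT ltac:(lra).
have : 0 <= delta / 2 * phi t ^+ 2 by rewrite mulr_ge0 ?sqr_ge0 // divr_ge0 // ltW.
lra.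
Qed.

(** Above [1 + eps] the reciprocal of [phi - 1] grows at rate [delta / 2], so that
    [phi] blows up backwards after a time of at most [2 / (delta * eps)]. *)
Lemma trajectory_upper eps T c d phi : calm eps T -> c <= d -> d <= T ->
  trajectory F c d phi -> 2 / (delta * eps) < d - c -> phi d <= 1 + eps.
Proof.
move=> cT cd dT pF long; rewrite leNgt; apply/negP => hd.
have e0 : 0 < eps by case: cT.
have up t : c <= t <= d -> 1 + eps < phi t.
  move=> /andP[ct td]; rewrite ltNge; apply/negP => h.
  have := trajectory_stays_below cT td dT (trajectory_sub ct (lexx d) pF) (lexx _) h.
  by rewrite leNgt hd.
have pz := primitiveB pF (primitive_cst c d 1).
have low t : c <= t <= d -> eps <= phi t - 1 by move=> /up; lra.
have := primitive_mean_ge (m := delta / 2) cd (primitiveV e0 low pz).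
have H t : c < t < d -> delta / 2 <= - (F t (phi t) - 0) / (phi t - 1) ^+ 2.
  move=> ht; have tT : t <= T by lra.
  have ut := up t ltac:(lra).
  have sq0 : 0 < (phi t - 1) ^+ 2 by rewrite exprn_gt0 //; lra.
  rewrite ler_pdivlMr // subr0.
  by have := logistic_field_above cT tT (ltW ut); lra.
move=> /(_ H) h1.
have c1 : 0 <= (phi c - 1)^-1.
  by rewrite invr_ge0; have := up c ltac:(lra); lra.
have d1 : (phi d - 1)^-1 <= eps^-1 by rewrite lef_pV2 ?posrE //; lra.
have : 2 / (delta * eps) * (delta / 2) < (d - c) * (delta / 2).
  by rewrite ltr_pM2r // divr_gt0.
have -> : 2 / (delta * eps) * (delta / 2) = eps^-1.
  by field; rewrite !gt_eqF.
lra.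
Qed.

(** A trajectory below [- 2 * eps] can only decrease, so in the past it was
    higher. *)
Lemma trajectory_lower eps T c d phi : calm eps T -> c <= d -> d <= T ->
  trajectory F c d phi -> Num.min (- (2 * eps)) (phi d) <= phi c.
Proof.
move=> cT cd dT pF; rewrite leNgt lt_min; apply/negP => /andP[h1 h2].
have e0 : 0 < eps by case: cT.
have := trajectory_stays_negative cT cd dT pF (k := phi c) ltac:(lra) (lexx _).
by rewrite leNgt h2.
Qed.

Lemma trajectory_below_attractor eps T c d phi : calm eps T -> c <= d -> d <= T ->
  trajectory F c d phi -> phi d < 1 - eps -> phi c < 1 - eps.
Proof.
move=> cT cd dT pF h; rewrite ltNge; apply/negP => h1.
have [e0 [e4 _]] := cT.
have := trajectory_stays_above cT cd dT pF (k := 1 - eps) ltac:(lra) (lexx _) h1.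
by rewrite leNgt h.
Qed.

(** Backwards in time a trajectory that is below the attractor approaches [0]:
    outside the strip of half width [2 * eps] the field has size at least a
    constant, which leaves room for a time of bounded length only. *)
Lemma trajectory_to_repeller eps T c d phi : calm eps T -> c <= d -> d <= T ->
  trajectory F c d phi -> phi d < 1 - eps ->
  4 / (delta * eps) <= d - c -> (1 + `|phi d|) / (delta * eps ^+ 2) <= d - c ->
  `|phi c| <= 2 * eps.
Proof.
move=> cT cd dT pF hd long1 long2.
have [e0 [e4 _]] := cT.
have de : 0 < delta * eps by rewrite mulr_gt0.
have de2 : 0 < delta * eps ^+ 2 by rewrite mulr_gt0 ?exprn_gt0.
have sub t : c <= t <= d -> phi t < 1 - eps.
  by move=> /andP[ct td]; apply: (trajectory_below_attractor cT td dT (trajectory_sub ct (lexx d) pF) hd).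
rewrite ler_norml; apply/andP; split; rewrite leNgt; apply/negP => h.
  (* below - 2 eps the field is at most - (delta / 2) (2 eps)^2 *)
  have low t : c < t < d -> phi t <= - (2 * eps).
    move=> ht; apply: (le_trans _ (ltW h)).
    by apply: (trajectory_stays_negative cT _ _ (trajectory_sub (lexx c) _ pF)); lra.
  have := primitive_mean_le (m := - (delta * eps ^+ 2)) cd pF.
  have H t : c < t < d -> F t (phi t) <= - (delta * eps ^+ 2).
    move=> ht; have tT : t <= T by lra.
    have lt := low t ht.
    have := logistic_field_below (th := phi t) cT tT ltac:(lra).
    have : 4 * eps ^+ 2 <= phi t ^+ 2.
      have : 0 <= (- phi t - 2 * eps) * (- phi t + 2 * eps) by rewrite mulr_ge0 //; lra.
      by rewrite !expr2; lra.
    move=> h1; have : 0 <= delta * (phi t ^+ 2 - 4 * eps ^+ 2).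
      by rewrite mulr_ge0 ?subr_ge0 // ltW.
    lra.
  move=> /(_ H) h1; rewrite ler_pdivrMr // in long2.
  by have := ler_norm (- phi d); rewrite normrN; lra.
have up t : c < t < d -> eps <= phi t.
  move=> ht; apply: (@le_trans _ _ (2 * eps)); first lra.
  by apply: (trajectory_stays_above cT _ _ (trajectory_sub (lexx c) _ pF)); lra.
have := primitive_mean_ge (m := delta * eps / 4) cd pF.
have H t : c < t < d -> delta * eps / 4 <= F t (phi t).
  move=> ht; apply: (logistic_field_between cT); [lra|exact: up|].
  by apply/ltW/sub; lra.
move=> /(_ H) h1; rewrite ler_pdivrMr // in long1.
lra.
Qed.

End Logistic.

(** * Dynamics near minus infinity *)

Section NearInfinity.
Variable R : realType.

Lemma near_ninftyP (A : set R) : (\forall t \near -oo, A t) <->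
  exists T, forall t, t <= T -> A t.
Proof.
split=> [[T [_ H]]|[T H]].
  by exists (T - 1) => t tT; apply: H; lra.
by exists T; split; [exact: num_real|move=> t tT; apply: H; exact: ltW].
Qed.

Lemma cvg0_ninftyP (f : R -> R) : f t @[t --> -oo] --> 0 <->
  forall e, 0 < e -> exists T, forall t, t <= T -> `|f t| <= e.
Proof.
split=> [/cvgrPdist_le H e e0|H].
  by have /near_ninftyP[T HT] := H e e0; exists T => t /HT; rewrite sub0r normrN.
apply/cvgrPdist_le => e e0; apply/near_ninftyP.
by have [T HT] := H e e0; exists T => t /HT; rewrite sub0r normrN.
Qed.

End NearInfinity.

Section ShiftBounded.
Variable R : realType.
Lemma shiftQ_bounded (G : R -> R) : bounded_measurable G -> bounded_measurable (shiftQ G).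
Proof.
move=> [mG [M GM]]; split.
  by apply: measurable_funM => //; exact: measurable_cst.
by exists (2 * M) => t; rewrite /shiftQ normrM ger0_norm // ler_pM2l.
Qed.

Lemma shiftP_bounded (G p : R -> R) : bounded_measurable G -> bounded_measurable p ->
  bounded_measurable (shiftP G p).
Proof.
move=> [mG [M GM]] [mp [N pN]]; split.
  by apply: measurable_funB => //; exact: measurable_funX.
exists (N + M ^+ 2) => t; rewrite /shiftP.
apply: le_trans (ler_normB _ _) _; apply: lerD => //.
rewrite normrX lerXn2r ?nnegrE //; exact: le_trans (GM t).
Qed.
End ShiftBounded.

Section PastHalf.
Variable R : realType.
Variables (G p ta tr : R -> R) (gam delta B : R).
Hypothesis (bG : bounded_measurable G) (bp : bounded_measurable p).
Hypothesis (hG : G t @[t --> -oo] --> gam).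
Hypothesis (sta : solution (fun=> 0) p setT ta) (str : solution (fun=> 0) p setT tr).
Hypothesis (delta0 : 0 < delta) (sep : forall t, delta <= ta t - tr t).
Hypothesis (taB : forall t, `|ta t| <= B) (trB : forall t, `|tr t| <= B).

Local Notation Q := (shiftQ G).
Local Notation P := (shiftP G p).
Local Notation ric x := (fun t => riccati Q P t (x t)).

Let bQ : bounded_measurable Q := shiftQ_bounded bG.
Let bP : bounded_measurable P := shiftP_bounded bG bp.

Local Notation w t := (ta t - tr t).

(** The coordinate in which the translated repeller is [0] and the attractor [1]. *)
Definition theta t x := (x - gam - tr t) / w t.

(** The field of the equation in the coordinate [theta]; with [G] equal to [gam] it
    is exactly logistic, because the attractor and the repeller of
    [x' = - x ^+ 2 + p] are both known. *)
Definition theta_field t th := w t * th * (1 - th) +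
  (2 * (G t - gam) * (tr t + th * w t) - (G t - gam) ^+ 2) / w t.

Local Notation F := theta_field.

Let w0 t : 0 < w t. Proof. exact: lt_le_trans (sep t). Qed.

Let wB t : w t <= 2 * B.
Proof.
have := taB t; have := trB t; rewrite !ler_norml; lra.
Qed.

Let B0 : 0 <= B. Proof. exact: le_trans (taB 0). Qed.

(* a small context keeps lra fast; the section hypotheses have to stay *)
Local Ltac arith := clear -bG bp hG sta str delta0 sep taB trB bQ bP w0 wB B0; have := delta0; lra.

Lemma thetaK t x : x = gam + tr t + theta t x * w t.
Proof. by rewrite /theta divfK ?gt_eqF //; ring. Qed.

Lemma theta_lt t x x' : (theta t x < theta t x') = (x < x').
Proof. by rewrite /theta ltr_pM2r ?invr_gt0 // !ltrD2r. Qed.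

Lemma theta_le t x x' : (theta t x <= theta t x') = (x <= x').
Proof. by rewrite /theta ler_pM2r ?invr_gt0 // !lerD2r. Qed.

Lemma theta_un t th : theta t (gam + tr t + th * w t) = th.
Proof.
by rewrite /theta (_ : _ - _ - _ = th * w t) ?mulfK ?gt_eqF //; ring.
Qed.

Lemma theta_norm_le t x k : `|theta t x| <= k -> `|x| <= `|gam| + B + k * (2 * B).
Proof.
move=> hk; rewrite {1}(thetaK t x).
apply: le_trans (ler_normD _ _) _; apply: lerD.
  by apply: le_trans (ler_normD _ _) _; apply: lerD.
rewrite normrM (gtr0_norm (w0 t)); apply: ler_pM => //; exact: ltW.
Qed.

Lemma theta_trajectory c d x : primitive c d (ric x) x ->
  trajectory F c d (fun t => theta t (x t)).
Proof.
move=> px.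
have b0 : bounded_measurable (fun=> 0 : R).
  by split; [exact: measurable_cst|exists 0 => t; rewrite normr0].
have pa := solution_primitive b0 bp sta (subsetT `[c, d]).
have pr := solution_primitive b0 bp str (subsetT `[c, d]).
have pw := primitiveB pa pr.
have pV := primitiveV delta0 (fun t _ => sep t) pw.
have pn := primitiveB (primitiveB px (primitive_cst c d gam)) pr.
apply: eq_primitive (primitiveM pn pV) => // t _.
have wt0 : w t != 0 by rewrite gt_eqF.
rewrite /F {1 2}(thetaK t (x t)); set th := theta t (x t).
rewrite /riccati /shiftQ /shiftP; field.
exact: wt0.
Qed.

Definition calm eps T := logistic_before delta F eps T /\
  forall t, t <= T -> 2 * `|G t - gam| <= delta * eps / 4.

(** The perturbation is [G - gam] times a function of linear growth in [theta]. *)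
Lemma calm_exists (eps : R) : 0 < eps -> eps <= 1 / 4 -> exists T, calm eps T.
Proof.
move=> e0 e4.
pose K := (2 * B + 2 * (2 * B) + 1) / delta.
have K0 : 0 < K by rewrite divr_gt0 //; move: B0; arith.
pose e := Num.min 1 (Num.min (delta * eps / 4 / K) (delta * eps / 8)).
have de0 : 0 < delta * eps by rewrite mulr_gt0.
have e_gt0 : 0 < e.
  rewrite /e !lt_min ltr01 /=; apply/andP; split; last by rewrite divr_gt0.
  by apply: divr_gt0 => //; rewrite divr_gt0.
have /cvgrPdist_le /(_ e e_gt0) /near_ninftyP [T HT] := hG.
exists T; split.
  split => //; split => // t /HT; rewrite distrC /e.
  rewrite !le_min => /andP[g1 /andP[g2 _]].
  exists (w t); first exact: sep.
  move=> th; rewrite /F addrC addKr normrM normfV (gtr0_norm (w0 t)).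
  set g := G t - gam in g1 g2 *.
  have num : `|2 * g * (tr t + th * w t) - g ^+ 2| <= `|g| * (K * delta) * (1 + `|th|).
    rewrite /K divfK ?gt_eqF //.
    have -> : 2 * g * (tr t + th * w t) - g ^+ 2 = g * (2 * (tr t + th * w t) - g) by ring.
    rewrite normrM -mulrA ler_wpM2l //.
    apply: le_trans (ler_normB _ _) _; rewrite normrM (ger0_norm (x := 2)) //.
    have h1 : `|tr t + th * w t| <= B + `|th| * (2 * B).
      apply: le_trans (ler_normD _ _) _; apply: lerD => //.
      by rewrite normrM (gtr0_norm (w0 t)) ler_wpM2l.
    have h2 : 0 <= B * `|th| by rewrite mulr_ge0.
    have h3 := normr_ge0 th; have h4 := B0.
    by move: h1 h2 h3 h4 g1; arith.
  rewrite ler_pdivrMr //; apply: le_trans num _.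
  have h1 : `|g| * K <= delta * eps / 4 by rewrite -ler_pdivlMr.
  have -> : `|g| * (K * delta) * (1 + `|th|) = `|g| * K * (1 + `|th|) * delta by ring.
  apply: ler_pM => //.
  - by rewrite mulr_ge0 ?addr_ge0 // mulr_ge0 // ltW.
  - exact: ltW.
  - by rewrite ler_wpM2r // addr_ge0.
move=> t /HT; rewrite distrC /e !le_min => /andP[_ /andP[_ g3]].
by move: g3; arith.
Qed.

(** The difference [D] in the coordinate [theta] satisfies
    [D' = (w * (1 - theta1 - theta2) + 2 * (G - gam)) * D], and above [1 - eps] the
    factor is at most [- delta / 4].  Integrating [D' <= - (delta / 4) * D d] gives a
    linear estimate that replaces the exponential one. *)
Lemma theta_contraction eps T c d x1 x2 : calm eps T -> c <= d -> d <= T ->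
  primitive c d (ric x1) x1 -> primitive c d (ric x2) x2 ->
  (forall t, c <= t <= d -> x1 t <= x2 t /\ 1 - eps <= theta t (x1 t)) ->
  (theta d (x2 d) - theta d (x1 d)) * (delta / 4 * (d - c))
    <= theta c (x2 c) - theta c (x1 c).
Proof.
move=> [[e0 [e4 _]] smallg] cd dT p1 p2 H.
pose D t := theta t (x2 t) - theta t (x1 t).
have D0 t : c <= t <= d -> 0 <= D t by move=> /H[h _]; rewrite subr_ge0 theta_le.
have pD := primitiveB (theta_trajectory p2) (theta_trajectory p1).
have rate t : c < t < d -> F t (theta t (x2 t)) - F t (theta t (x1 t)) <= - (delta / 4) * D t.
  move=> ht; have ht' : c <= t <= d by move: ht; arith.
  have [h12 h1] := H t ht'; have Dt := D0 t ht'.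
  have tT : t <= T by move: ht dT; arith.
  have hg := smallg t tT.
  have -> : F t (theta t (x2 t)) - F t (theta t (x1 t)) =
     (w t * (1 - theta t (x1 t) - theta t (x2 t)) + 2 * (G t - gam)) * D t.
    have wt0 : w t != 0 by rewrite gt_eqF.
    by rewrite /F /D; field; exact: wt0.
  rewrite ler_wpM2r //.
  have h2 : theta t (x1 t) <= theta t (x2 t) by rewrite theta_le.
  have h3 : 0 <= (w t - delta) * (theta t (x1 t) + theta t (x2 t) - 1).
    by rewrite mulr_ge0 ?subr_ge0 //; move: h1 h2 e4; arith.
  have h4 : 0 <= delta * (theta t (x1 t) + theta t (x2 t) - 1 - 1 / 2).
    by rewrite mulr_ge0 ?(ltW delta0) //; move: h1 h2 e4; arith.
  have h5 := ler_norm (G t - gam).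
  have h6 : 0 <= delta * (1 / 4 - eps) by rewrite mulr_ge0 ?(ltW delta0) //; move: e4; arith.
  move: (theta t (x1 t)) (theta t (x2 t)) h1 h2 h3 h4 => a b h1 h2 h3 h4.
  by move: h3 h4 h5 h6 hg; arith.
have anti t : c <= t <= d -> D d <= D t.
  move=> /andP[ct td]; have := primitive_mean_le (m := 0) td (primitive_sub ct (lexx d) pD).
  have H' l : t < l < d -> F l (theta l (x2 l)) - F l (theta l (x1 l)) <= 0.
    move=> hl; apply: (le_trans (rate l _)); first by move: hl ct; arith.
    rewrite mulNr oppr_le0 mulr_ge0 ?D0 //; first by rewrite divr_ge0 // ltW.
    by move: hl ct; arith.
  by move=> /(_ H'); rewrite mul0r subr_le0.
have := primitive_mean_le (m := - (delta / 4) * D d) cd pD.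
have H' l : c < l < d -> F l (theta l (x2 l)) - F l (theta l (x1 l)) <= - (delta / 4) * D d.
  move=> hl; apply: (le_trans (rate l hl)); rewrite !mulNr lerN2 ler_pM2l ?divr_gt0 //.
  by apply: anti; move: hl; arith.
move=> /(_ H'); rewrite -/(D d) -/(D c).
have := D0 d ltac:(move: cd; arith).
by arith.
Qed.


Lemma y_trajectory s (x0 : R) c d : `[c, d]%classic `<=` ydom Q P s x0 ->
  primitive c d (ric (fun t => y Q P t s x0)) (fun t => y Q P t s x0).
Proof. exact: (solution_primitive bQ bP (y_solution bQ bP s x0)). Qed.

Local Notation ytheta s x0 t := (theta t (y Q P t s x0)).

Lemma ydom_segment s (x0 : R) c d : ydom Q P s x0 c -> ydom Q P s x0 d ->
  `[c, d]%classic `<=` ydom Q P s x0.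
Proof.
by move=> hc hd t; rewrite /= in_itv /=; exact: (ydom_interval bQ bP hc hd).
Qed.

Lemma past_solution_upper eps T s (x0 : R) d : calm eps T -> d <= T ->
  (forall t, t <= d -> ydom Q P s x0 t) -> ytheta s x0 d <= 1 + eps.
Proof.
move=> [cT _] dT H; pose c := d - (2 / (delta * eps) + 1).
have e0 : 0 < eps by case: cT.
have : 0 < 2 / (delta * eps) by rewrite divr_gt0 // mulr_gt0.
move=> h; have cd : c <= d by rewrite /c; move: h; arith.
have cdD : `[c, d]%classic `<=` ydom Q P s x0.
  by apply: ydom_segment; apply: H.
apply: (trajectory_upper delta0 cT cd dT (theta_trajectory (y_trajectory cdD))).
by rewrite /c; move: h; arith.
Qed.

Lemma past_solution_lower eps T s (x0 : R) c d : calm eps T -> d <= T -> c <= d ->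
  ydom Q P s x0 c -> ydom Q P s x0 d ->
  Num.min (- (2 * eps)) (ytheta s x0 d) <= ytheta s x0 c.
Proof.
move=> [cT _] dT cd hc hd.
exact: (trajectory_lower delta0 cT cd dT (theta_trajectory (y_trajectory (ydom_segment hc hd)))).
Qed.

(** A solution that exists for all past times is at most [1 + eps] in the coordinate
    [theta], since it would otherwise blow up backwards, and it is bounded below by
    [trajectory_lower]. *)
Lemma past_solution_bounded s (x0 : R) d :
  (forall t, t <= d -> ydom Q P s x0 t) ->
  bounded_at_ninfty (ydom Q P s x0) (fun t => y Q P t s x0).
Proof.
move=> H; have [||T cT] := @calm_exists (1 / 4); [lra|by []|].
pose t0 := Num.min d T.
have [t0d t0T] : t0 <= d /\ t0 <= T by rewrite /t0 !ge_min !lexx orbT.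
have Ht t : t <= t0 -> ydom Q P s x0 t by move=> h; apply: H; exact: le_trans t0d.
pose k := 2 + `|ytheta s x0 t0|.
exists t0, (`|gam| + B + k * (2 * B)) => t tt0; split; first exact: Ht.
apply: theta_norm_le; rewrite ler_norml; apply/andP; split.
  apply: le_trans (past_solution_lower cT t0T tt0 (Ht _ tt0) (Ht _ (lexx _))).
  rewrite le_min /k; have := ler_norm (- ytheta s x0 t0).
  by rewrite normrN; have := normr_ge0 (ytheta s x0 t0); arith.
have := @past_solution_upper _ _ s x0 t cT (le_trans tt0 t0T).
have Ht' l : l <= t -> ydom Q P s x0 l by move=> h; apply: Ht; exact: le_trans tt0.
by move=> /(_ Ht'); rewrite /k; have := normr_ge0 (ytheta s x0 t0); lra.
Qed.

Lemma bounded_past_solution s (x0 : R) :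
  bounded_at_ninfty (ydom Q P s x0) (fun t => y Q P t s x0) ->
  forall t, t <= s -> ydom Q P s x0 t.
Proof.
move=> [t0 [M H]] t ts; have [h|h] := leP t t0; first by case: (H t h).
apply: (ydom_interval bQ bP (H t0 (lexx _)).1 (ydom_id bQ bP s x0)).
by rewrite ts ltW.
Qed.

Lemma past_solution_exists s (x0 : R) k : (forall t, t <= s -> ydom Q P s x0 t ->
  ytheta s x0 t <= k) -> forall t, t <= s -> ydom Q P s x0 t.
Proof.
move=> H t ts.
apply: (ydom_backward bQ bP (M := `|gam| + B + `|k| * (2 * B)) ts) => [l hl Dl|]; last first.
  by rewrite lexx ts.
rewrite (thetaK l (y Q P l s x0)); apply: lerD.
  by apply: lerD; apply: le_trans (ler_norm _) _.
have h1 : ytheta s x0 l <= `|k|.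
  by apply: le_trans (ler_norm _); apply: H => //; case/andP: hl.
apply: (@le_trans _ _ (`|k| * w l)); first by rewrite ler_wpM2r // ltW.
by rewrite ler_wpM2l.
Qed.

(** Below the attractor [theta] stays below [1 - eps] backwards, and an upper bound
    is all that existence for past times requires. *)
Lemma past_solution_below eps T s (x0 : R) : calm eps T -> s <= T ->
  theta s x0 < 1 - eps -> forall t, t <= s -> ydom Q P s x0 t.
Proof.
move=> [cT _] sT xs; apply: (@past_solution_exists s x0 1) => t ts Dt.
have Ds := ydom_id bQ bP s x0.
have := trajectory_below_attractor delta0 cT ts sT
  (theta_trajectory (y_trajectory (ydom_segment Dt Ds))).
rewrite y_id // => /(_ xs).
by case: cT => e0 _; lra.
Qed.

Lemma past_solution_repeller eps T s (x0 : R) t1 : calm eps T -> t1 <= T ->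
  (forall t, t <= t1 -> ydom Q P s x0 t) -> ytheta s x0 t1 < 1 - eps ->
  `|y Q P t s x0 - (tr t + gam)| @[t --> -oo] --> 0.
Proof.
move=> cT t1T H ht1; have [[e0 [e4 _]] _] := cT.
apply/cvg0_ninftyP => e egt0.
pose e1 := Num.min eps (e / (4 * B + 1)).
have B1 : 0 < 4 * B + 1 by have := B0; arith.
have e1_gt0 : 0 < e1 by rewrite /e1 lt_min e0 /=; apply: divr_gt0.
have e1eps : e1 <= eps by rewrite /e1 ge_min lexx.
have e1e : e1 * (4 * B + 1) <= e by rewrite -ler_pdivlMr // /e1 ge_min lexx orbT.
have [T1 [cT1 _]] := calm_exists e1_gt0 (le_trans e1eps e4).
pose d := Num.min t1 T1.
have [dt1 dT1] : d <= t1 /\ d <= T1 by rewrite /d !ge_min !lexx orbT.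
have Hd t : t <= d -> ydom Q P s x0 t by move=> h; apply: H; exact: le_trans dt1.
have hd : ytheta s x0 d < 1 - e1.
  suff h' : ytheta s x0 d < 1 - eps by move: h' e1eps; arith.
  case: cT => cT _.
  have tj := theta_trajectory (y_trajectory (ydom_segment (Hd d (lexx _)) (H t1 (lexx _)))).
  exact: (trajectory_below_attractor delta0 cT dt1 t1T tj ht1).
have de1 : 0 < delta * e1 by apply: mulr_gt0.
have de2 : 0 < delta * e1 ^+ 2 by apply: mulr_gt0 => //; apply: exprn_gt0.
pose L := 4 / (delta * e1) + (1 + `|ytheta s x0 d|) / (delta * e1 ^+ 2).
have L1 : 0 <= 4 / (delta * e1) by apply: divr_ge0 => //; exact: ltW.
have L2 : 0 <= (1 + `|ytheta s x0 d|) / (delta * e1 ^+ 2).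
  by apply: divr_ge0; [rewrite addr_ge0|exact: ltW].
exists (d - L) => t htL.
have td : t <= d by move: htL L1 L2; rewrite /L; arith.
have := trajectory_to_repeller delta0 cT1 td dT1
   (theta_trajectory (y_trajectory (ydom_segment (Hd _ td) (Hd _ (lexx _))))) hd.
move=> /(_ ltac:(move: htL L1 L2; rewrite /L; arith) ltac:(move: htL L1 L2; rewrite /L; arith)) h.
rewrite normr_id {1}(thetaK t (y Q P t s x0)).
have -> : gam + tr t + ytheta s x0 t * w t - (tr t + gam) = ytheta s x0 t * w t by ring.
rewrite normrM (gtr0_norm (w0 t)).
apply: le_trans e1e; apply: (@le_trans _ _ (2 * e1 * (2 * B))).
  by apply: ler_pM => //; exact: ltW.
by move: e1_gt0; arith.
Qed.

Section FrakA.
Variables (beta : \bar R) (a : R -> R).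
Hypothesis (ha : is_frak_a Q P beta a).

Local Ltac arith ::= clear -bG bp hG sta str delta0 sep taB trB bQ bP w0 wB B0 ha;
  have := delta0; lra.

Lemma frak_a_maximal s : (s%:E < beta)%E ->
  ydom Q P s (a s) = [set t | (t%:E < beta)%E] /\
  forall t, (t%:E < beta)%E -> y Q P t s (a s) = a t.
Proof. by move=> sb; have [_ mx _ _] := ha; exact: (maximal_solutionE bQ bP mx sb). Qed.

Lemma frak_a_le s (x0 : R) : (s%:E < beta)%E ->
  (forall t, t <= s -> ydom Q P s x0 t) <-> x0 <= a s.
Proof.
move=> sb; have [_ _ hiff _] := ha; split=> [H|/(hiff _ _ sb)].
  by apply/(hiff _ _ sb); exact: past_solution_bounded H.
exact: bounded_past_solution.
Qed.

(** A value of [a] below [1 - eps] could be increased a little without leaving the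
    solutions that exist in the past, against the maximality of [a]. *)
Lemma frak_a_theta eps T t : calm eps T -> t <= T -> (t%:E < beta)%E ->
  1 - eps <= theta t (a t) <= 1 + eps.
Proof.
move=> cT tT tb; apply/andP; split.
  rewrite leNgt; apply/negP => h.
  pose k := (theta t (a t) + (1 - eps)) / 2.
  have := @past_solution_below eps T t (gam + tr t + k * w t) cT tT.
  rewrite theta_un => /(_ ltac:(rewrite /k; move: h; arith)).
  move=> /(frak_a_le _ tb); rewrite -(theta_le t) theta_un /k.
  by move: h; arith.
have := @past_solution_upper eps T t (a t) t cT tT.
by rewrite y_id // => ->//; apply/(frak_a_le _ tb).
Qed.

Lemma frak_a_domain : exists t0 : R, (t0%:E < beta)%E.
Proof.
have [ninf _ _ _] := ha; case: (beta) ninf => [b _|_|//].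
  by exists (b - 1); rewrite lte_fin ltrBlDr ltrDl.
by exists 0; rewrite ltry.
Qed.

Lemma frak_a_cvg : `|a t - (ta t + gam)| @[t --> -oo] --> 0.
Proof.
apply/cvg0_ninftyP => e e0.
pose e1 := Num.min (1 / 4) (e / (2 * B + 1)).
have B1 : 0 < 2 * B + 1 by have := B0; arith.
have e1_gt0 : 0 < e1 by rewrite /e1 lt_min; apply/andP; split; apply: divr_gt0.
have e14 : e1 <= 1 / 4 by rewrite /e1 ge_min lexx.
have e1e : e1 * (2 * B + 1) <= e by rewrite -ler_pdivlMr // /e1 ge_min lexx orbT.
have [T cT] := calm_exists e1_gt0 e14.
have [t0 t0b] := frak_a_domain.
exists (Num.min T t0) => t; rewrite le_min => /andP[tT tt0].
have tb : (t%:E < beta)%E by apply: le_lt_trans t0b; rewrite lee_fin.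
have /andP[h1 h2] := frak_a_theta cT tT tb.
rewrite normr_id {1}(thetaK t (a t)).
have -> : gam + tr t + theta t (a t) * w t - (ta t + gam) = (theta t (a t) - 1) * w t by ring.
rewrite normrM (gtr0_norm (w0 t)).
apply: le_trans e1e; apply: (@le_trans _ _ (e1 * (2 * B))).
  apply: ler_pM => //; first exact: ltW.
  by rewrite ler_norml; move: h1 h2; arith.
by rewrite ler_pM2l //; arith.
Qed.

(** Two distinct solutions cannot both stay near the attractor in the past: by
    [theta_contraction] their distance would be unbounded.  So a solution below [a]
    leaves the attractor, and [past_solution_repeller] applies. *)
Lemma below_frak_a s (x0 : R) : (s%:E < beta)%E -> x0 < a s ->
  (forall t, t <= s -> ydom Q P s x0 t) /\
  `|y Q P t s x0 - (tr t + gam)| @[t --> -oo] --> 0.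
Proof.
move=> sb xa; have D := (frak_a_le x0 sb).2 (ltW xa); split => //.
have [aD aE] := frak_a_maximal sb.
have [||T cT] := @calm_exists (1 / 4); [lra|by []|].
pose d := Num.min s T.
have [ds dT] : d <= s /\ d <= T by rewrite /d !ge_min !lexx orbT.
have tb t : t <= s -> (t%:E < beta)%E by move=> h; apply: le_lt_trans sb; rewrite lee_fin.
have ya t : t <= s -> y Q P t s x0 < a t.
  move=> ts; have ix : is_interval [set l : R | l <= s].
    by move=> b c /= _ hc l /andP[_ lc]; exact: le_trans hc.
  rewrite -(aE _ (tb _ ts)).
  apply: (@solution_lt R Q P bQ bP [set l : R | l <= s] (fun t => y Q P t s x0)
    (fun t => y Q P t s (a s)) s t _ _ (lexx s) ts).
  - exact: (solution_sub (y_solution bQ bP s x0) ix D).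
  - apply: (solution_sub (y_solution bQ bP s (a s)) ix) => l /= hl.
    by rewrite aD /=; exact: tb.
  - by rewrite !(y_id bQ bP).
have [t1 [t1d h1]] : exists t1, t1 <= d /\ ytheta s x0 t1 < 1 - 1 / 4.
  apply: contrapT => hno.
  have above t : t <= d -> 1 - 1 / 4 <= ytheta s x0 t.
    by move=> td; rewrite leNgt; apply/negP => h; apply: hno; exists t.
  pose e := theta d (a d) - ytheta s x0 d.
  have e0 : 0 < e by rewrite subr_gt0 theta_lt; exact: ya.
  (* over a time 8 / (delta e) a gap of final size e was at least 2 initially *)
  pose c := d - 8 / (delta * e).
  have de : 0 < delta * e by apply: mulr_gt0.
  have c0 : 0 < 8 / (delta * e) by apply: divr_gt0.
  have cd : c <= d by rewrite /c; move: c0; arith.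
  have cs := le_trans cd ds; have cT' := le_trans cd dT.
  have p1 := y_trajectory (ydom_segment (D c cs) (D d ds)).
  have p2 : primitive c d (ric a) a.
    have [_ [sa _] _ _] := ha; apply: (solution_primitive bQ bP sa) => l /=.
    by rewrite in_itv /= => /andP[_ ld]; apply: tb; exact: le_trans ds.
  have := theta_contraction cT cd dT p1 p2.
  move=> /(_ ltac:(move=> t /andP[_ td]; split; [exact/ltW/ya/(le_trans td)|exact: above])).
  have /andP[_ h2] := frak_a_theta cT cT' (tb _ cs).
  have h3 := above _ cd.
  rewrite -/e (_ : d - c = 8 / (delta * e)); last by rewrite /c; ring.
  have -> : e * (delta / 4 * (8 / (delta * e))) = 2.
    by field; rewrite !gt_eqF.
  by move: h2 h3; arith.
apply: (past_solution_repeller cT (le_trans t1d dT) _ h1).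
by move=> t tt1; apply: D; apply: le_trans tt1 (le_trans t1d ds).
Qed.


(** [theta_contraction] read in the original coordinate. *)
Lemma attracted_pair eps T s t x1 x2 : calm eps T -> s <= t -> t <= T ->
  solution Q P `[s, t] x1 -> solution Q P `[s, t] x2 -> x1 s <= x2 s ->
  (forall l, s <= l <= t -> 1 - eps <= theta l (x1 l)) ->
  `|x2 t - x1 t| * (t - s) <= 8 * B / delta * (theta s (x2 s) - theta s (x1 s)).
Proof.
move=> cT st tT s1 s2 x12 above.
have sub : `[s, t]%classic `<=` `[s, t]%classic by [].
have p1 := solution_primitive bQ bP s1 sub.
have p2 := solution_primitive bQ bP s2 sub.
have inl l : s <= l <= t -> `[s, t]%classic l by move=> h; rewrite /= in_itv.
have ss : `[s, t]%classic s by apply: inl; rewrite lexx.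
have tt : s <= t <= t by rewrite st lexx.
have le12 l : s <= l <= t -> x1 l <= x2 l.
  by move=> /inl Dl; exact: (solution_le bQ bP s1 s2 ss Dl x12).
have := theta_contraction cT st tT p1 p2 (fun l hl => conj (le12 l hl) (above l hl)).
set u := _ - theta s _ => h.
have ht := le12 t tt.
rewrite (ger0_norm (x := x2 t - x1 t)) ?subr_ge0 //.
have -> : x2 t - x1 t = (theta t (x2 t) - theta t (x1 t)) * w t.
  by rewrite {1}(thetaK t (x2 t)) {1}(thetaK t (x1 t)); ring.
set v := _ - theta t _ in h *.
have v0 : 0 <= v by rewrite subr_ge0 theta_le.
have ts0 : 0 <= t - s by rewrite subr_ge0.
have h1 : v * (t - s) * delta <= 4 * u by move: h; arith.
have u0 : 0 <= u.
  have : 0 <= v * (t - s) * delta by apply: mulr_ge0; [exact: mulr_ge0|exact: ltW].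
  by move: h1; arith.
rewrite -(ler_pM2r delta0).
have -> : 8 * B / delta * u * delta = 4 * u * (2 * B) by field; rewrite gt_eqF.
have -> : v * w t * (t - s) * delta = v * (t - s) * delta * w t by ring.
apply: ler_pM => //; last exact: ltW.
by apply: mulr_ge0; [exact: mulr_ge0|exact: ltW].
Qed.

(** Solutions starting within [rho] of [a] remain above [3 / 4] in the coordinate
    [theta], where [attracted_pair] applies. *)
Lemma frak_a_attracts : exists s0 rho C : R, [/\ (s0%:E < beta)%E, 0 < rho &
  forall s x0, s <= s0 -> `|x0 - a s| <= rho ->
  forall t, s <= t <= s0 -> ydom Q P s x0 t /\ `|a t - y Q P t s x0| * (t - s) <= C].
Proof.
have [||T4 cT4] := @calm_exists (1 / 4); [lra|by []|].
have [||T8 cT8] := @calm_exists (1 / 8); [lra|lra|].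
have [t0 t0b] := frak_a_domain.
pose s0 := Num.min t0 (Num.min T4 T8).
have [s0t s04 s08] : [/\ s0 <= t0, s0 <= T4 & s0 <= T8].
  by rewrite /s0 !ge_min !lexx !orbT.
have s0b : (s0%:E < beta)%E by apply: le_lt_trans t0b; rewrite lee_fin.
exists s0, (delta / 8), (8 * B / delta); split => //; first exact: divr_gt0.
move=> s x0 ss0 hx0.
have sb t : t <= s0 -> (t%:E < beta)%E by move=> h; apply: le_lt_trans s0b; rewrite lee_fin.
have close : `|theta s x0 - theta s (a s)| <= 1 / 8.
  have -> : theta s x0 - theta s (a s) = (x0 - a s) / w s by rewrite /theta; ring.
  rewrite normrM normfV (gtr0_norm (w0 s)) ler_pdivrMr //.
  by apply: le_trans hx0 _; have := sep s; arith.
have near1 l : l <= s0 -> 1 - 1 / 8 <= theta l (a l) <= 1 + 1 / 8.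
  by move=> ls; apply: (frak_a_theta cT8 (le_trans ls s08) (sb l ls)).
have x0_ge : 1 - 1 / 4 <= theta s x0.
  have /andP[h _] := near1 s ss0.
  by move: close; rewrite ler_norml => /andP[h' _]; move: h h'; arith.
have Ds := ydom_id bQ bP s x0.
have stay t : s <= t <= s0 -> ydom Q P s x0 t -> 1 - 1 / 4 <= ytheta s x0 t.
  move=> /andP[st ts] Dt; have [cT _] := cT4.
  apply: (trajectory_stays_above delta0 cT st (le_trans ts s04)
    (theta_trajectory (y_trajectory (ydom_segment Ds Dt)))) => //; first by arith.
  by rewrite y_id.
have D t : s <= t <= s0 -> ydom Q P s x0 t.
  apply: (ydom_forward bQ bP (M := - (`|gam| + B)) ss0) => l hl Dl.
  rewrite (thetaK l (y Q P l s x0)).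
  have : 0 <= ytheta s x0 l * w l.
    apply: mulr_ge0; last exact: ltW.
    by have := stay l hl Dl; arith.
  have := ler_norm (- gam); have := ler_norm (- tr l); rewrite !normrN.
  by have := trB l; arith.
move=> t ht; split; first exact: D.
have /andP[st ts] := ht.
have iI : is_interval `[s, t]%classic by exact: interval_is_interval.
have s1 : solution Q P `[s, t] (fun l => y Q P l s x0).
  apply: (solution_sub (y_solution bQ bP s x0) iI) => l /=; rewrite in_itv /= => hl.
  by apply: D; move: hl ts; arith.
have s2 : solution Q P `[s, t] a.
  have [_ [sa _] _ _] := ha; apply: (solution_sub sa iI) => l /=; rewrite in_itv /= => hl.
  by apply: sb; move: hl ts; arith.
have aboveY l : s <= l <= t -> 1 - 1 / 4 <= ytheta s x0 l.
  move=> hl; have hl' : s <= l <= s0 by move: hl ts; arith.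
  exact: stay l hl' (D l hl').
have aboveA l : s <= l <= t -> 1 - 1 / 4 <= theta l (a l).
  move=> hl; have /andP[h _] := near1 l ltac:(move: hl ts; arith).
  by move: h; arith.
have C0 : 0 <= 8 * B / delta by apply: divr_ge0; [exact: mulr_ge0|exact: ltW].
have yss : y Q P s s x0 = x0 by rewrite y_id.
move: close; rewrite ler_norml => /andP[close1 close2].
have [xa|ax] := leP x0 (a s).
  have := attracted_pair cT4 st (le_trans ts s04) s1 s2.
  rewrite yss => /(_ xa aboveY) h; apply: le_trans h _.
  by apply: ler_piMr => //; move: close1; arith.
have := attracted_pair cT4 st (le_trans ts s04) s2 s1.
rewrite yss => /(_ (ltW ax) aboveA) h; rewrite distrC; apply: le_trans h _.
by apply: ler_piMr => //; move: close2; arith.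
Qed.

Lemma frak_a_pullback_attractive : locally_pullback_attractive Q P beta a.
Proof.
have [s0 [rho [C [s0b rho0 H]]]] := frak_a_attracts.
exists s0, rho; split => //.
  by move=> s x0 ss0 hx t /=; rewrite in_itv /= => ht; have [] := H s x0 ss0 hx t ht.
move=> t ts0.
pose f s := ereal_sup [set `|a t - y Q P t s x0|%:E
   | x0 in `[a s - rho, a s + rho]%classic].
have C0 : 0 <= C.
  have [||_] := H s0 (a s0) (lexx _) _ s0; rewrite ?lexx //.
    by rewrite subrr normr0 ltW.
  by rewrite (subrr s0) mulr0.
apply: (@squeeze_cvge _ _ _ _ (fun=> 0%E) f (fun s => (C / (t - s))%:E)).
- apply/near_ninftyP; exists (t - 1) => s hs.
  have ts : 0 < t - s by move: hs; arith.
  apply/andP; split.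
    apply: le_trans (ereal_sup_ubound _); last first.
      exists (a s) => //=; rewrite in_itv /=; move: rho0; arith.
    by rewrite lee_fin.
  apply: ge_ereal_sup => _ [x0 /= hx <-]; rewrite lee_fin ler_pdivlMr //.
  have ss0 : s <= s0 by move: hs ts0; arith.
  have [] // := H s x0 ss0 _ t _; last by move: hs ts0; arith.
  by move: hx; rewrite in_itv /= ler_norml; arith.
- exact: cvg_cst.
apply: cvg_EFin; first by near=> s.
apply/cvg0_ninftyP => e e0; exists (t - (C / e + 1)) => s hs.
have Ce : 0 <= C / e by apply: divr_ge0 => //; exact: ltW.
have ts : 0 < t - s by move: hs Ce; arith.
rewrite ger0_norm; last by apply: divr_ge0 => //; exact: ltW.
rewrite ler_pdivrMr // mulrC -ler_pdivrMr //; move: hs; arith.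
Unshelve. all: by end_near. Qed.

End FrakA.

Local Ltac arith ::= clear -bG bp hG sta str delta0 sep taB trB bQ bP w0 wB B0;
  have := delta0; lra.

(** Existence for all past times does not depend on the time at which the initial
    value is prescribed. *)
Lemma past_solution_restart s (x0 : R) t :
  (forall l, l <= s -> ydom Q P s x0 l) -> ydom Q P s x0 t ->
  forall l, l <= t -> ydom Q P t (y Q P t s x0) l.
Proof.
move=> D Dt l lt.
have [sub _] := y_greatest bQ bP (y_solution bQ bP s x0) Dt.
apply: sub; have [ls|sl] := leP l s; first exact: D.
by apply: (ydom_interval bQ bP (ydom_id bQ bP s x0) Dt); rewrite (ltW sl).
Qed.

(** The supremum [cst] of the initial values at time [T] whose solutions exist for
    all past times is attained.  Otherwise, in the coordinate [theta], the solution
    through [cst] exceeds [1 + 1 / 4] at some [t1 <= T].  The solution that starts at [1 + 1 / 4] at time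
    [t1] exists up to [T] and is smaller than [cst] there, so it lies below the
    solution of some admissible value; the latter is then too large at [t1]. *)
Lemma largest_past_solution : exists T cst,
  (forall t, t <= T -> ydom Q P T cst t) /\
  forall x0, (forall t, t <= T -> ydom Q P T x0 t) -> x0 <= cst.
Proof.
have [||T cT] := @calm_exists (1 / 4); [lra|by []|].
pose S := [set x0 | forall t, t <= T -> ydom Q P T x0 t].
pose X th := gam + tr T + th * w T.
have S_half : S (X (1 / 2)).
  by apply: (past_solution_below cT (lexx T)); rewrite /X theta_un; arith.
have S_up x0 : S x0 -> x0 <= X (1 + 1 / 4).
  move=> Sx; have := past_solution_upper cT (lexx T) Sx.
  by rewrite y_id // => h; rewrite -(theta_le T) /X theta_un.
have supS : has_sup S by split; [exists (X (1 / 2))|exists (X (1 + 1 / 4)) => x0 /S_up].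
exists T, (sup S); split; last by move=> x0 Sx; apply: ub_le_sup => //; case: supS.
have sup_up : sup S <= X (1 + 1 / 4).
  by apply: ge_sup; [exists (X (1 / 2))|move=> x0 /S_up].
apply: (@past_solution_exists T (sup S) (1 + 1 / 4)) => t1 t1T Dt1.
rewrite leNgt; apply/negP => above.
pose z0 := gam + tr t1 + (1 + 1 / 4) * w t1.
have [cl _] := cT.
have Dz t : t1 <= t <= T -> ydom Q P t1 z0 t.
  apply: (ydom_forward bQ bP (M := - (`|gam| + B)) t1T) => l /andP[tl lT] Dl.
  rewrite (thetaK l (y Q P l t1 z0)).
  have h : 1 - 1 / 4 <= ytheta t1 z0 l.
    apply: (trajectory_stays_above delta0 cl tl lT (theta_trajectory
      (y_trajectory (ydom_segment (ydom_id bQ bP t1 z0) Dl)))); rewrite ?(y_id bQ bP) /z0 ?theta_un;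
    by arith.
  have : 0 <= ytheta t1 z0 l * w l by apply: mulr_ge0; [move: h; arith|exact: ltW].
  have := ler_norm (- gam); have := ler_norm (- tr l); rewrite !normrN.
  by have := trB l; arith.
have iI : is_interval `[t1, T]%classic by exact: interval_is_interval.
have subI x0 s : ydom Q P s x0 t1 -> ydom Q P s x0 T -> 
    solution Q P `[t1, T] (fun t => y Q P t s x0).
  by move=> h1 h2; apply: (solution_sub (y_solution bQ bP s x0) iI); exact: ydom_segment.
have I1 : `[t1, T]%classic t1 by rewrite /= in_itv /= lexx.
have IT : `[t1, T]%classic T by rewrite /= in_itv /= lexx andbT.
have sz := subI z0 t1 (Dz t1 ltac:(by rewrite lexx)) (Dz T ltac:(by rewrite lexx andbT)).
have ssup := subI (sup S) T Dt1 (ydom_id bQ bP T (sup S)).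
have ltT : y Q P T t1 z0 < sup S.
  rewrite -[ltRHS](y_id bQ bP T (sup S)).
  apply: (solution_lt bQ bP sz ssup I1 IT).
  by rewrite (y_id bQ bP) -(theta_lt t1) /z0 theta_un.
have zT : 0 < sup S - y Q P T t1 z0 by rewrite subr_gt0.
have [c Sc] := sup_adherent zT supS.
have -> : sup S - (sup S - y Q P T t1 z0) = y Q P T t1 z0 by ring.
move=> zc.
have sc := subI c T (Sc t1 t1T) (ydom_id bQ bP T c).
have : y Q P t1 t1 z0 < y Q P t1 T c.
  by apply: (solution_lt bQ bP sz sc IT I1); rewrite (y_id bQ bP T c).
have := @past_solution_upper _ _ T c t1 cT t1T.
move=> /(_ (fun t ht => Sc t (le_trans ht t1T))).
by rewrite (y_id bQ bP) -(theta_lt t1) /z0 theta_un; arith.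
Qed.

(** Complete the square. *)
Lemma riccati_le : exists K, forall t x, riccati Q P t x <= K.
Proof.
have [_ [CQ QC]] := bQ; have [_ [CP PC]] := bP.
exists (CQ ^+ 2 / 4 + CP) => t x; rewrite /riccati.
have h1 : Q t ^+ 2 <= CQ ^+ 2.
  rewrite -(real_normK (num_real (Q t))) lerXn2r ?nnegrE //.
  exact: le_trans (QC t).
have h2 := le_trans (ler_norm _) (PC t).
have h3 : 0 <= (x - Q t / 2) ^+ 2 by exact: sqr_ge0.
have e : (x - Q t / 2) ^+ 2 = x ^+ 2 - Q t * x + Q t ^+ 2 / 4 by field.
by move: h1 h2 h3; rewrite e; arith.
Qed.

(** The solution through the largest admissible value at time [T].  At a finite end
    [b] of its domain it cannot be bounded below, by [ydom_forward], and as its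
    derivative is bounded above it then tends to [-oo]. *)
Lemma frak_a_exists : exists beta a, is_frak_a Q P beta a.
Proof.
have [T [c [Dc cmax]]] := largest_past_solution.
pose a t := y Q P t T c; pose D := ydom Q P T c.
have DT : D T by exact: ydom_id.
have sa : solution Q P D a by exact: y_solution.
have Dpast t : t <= T -> D t by exact: Dc.
have Ddown s t : D s -> t <= s -> D t.
  move=> Ds ts; have [h|h] := leP t T; first exact: Dpast.
  by apply: (ydom_interval bQ bP DT Ds); rewrite (ltW h).
have [beta [nb DE]] : exists beta : \bar R, (-oo < beta)%E /\ D = [set t | (t%:E < beta)%E].
  have [ub|nub] := pselect (has_ubound D); last first.
    exists +oo%E; split => //; apply/seteqP; split => t /=; first by rewrite ltry.
    move=> _; apply: contrapT => nDt; apply: nub; exists t => s Ds.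
    by rewrite leNgt; apply/negP => ts; apply: nDt; apply: Ddown Ds (ltW ts).
  have supD : has_sup D by split; [exists T|].
  exists (sup D)%:E; split; first exact: ltNyr.
  apply/seteqP; split => t /=; rewrite lte_fin.
    move=> Dt; have [t' tt' Dt'] := ydom_open_right bQ bP Dt.
    by apply: lt_le_trans tt' _; apply: ub_le_sup.
  move=> tsup; have e0 : 0 < sup D - t by rewrite subr_gt0.
  have [s Ds] := sup_adherent e0 supD.
  by rewrite (_ : sup D - (sup D - t) = t); [move=> /ltW; exact: Ddown|ring].
exists beta, a; split => //.
- by rewrite -DE; exact: y_maximal.
- move=> s x0 sb; have Ds : D s by rewrite DE.
  have down (x1 : R) : x1 <= a s -> forall t, t <= s -> ydom Q P s x1 t.
    move=> xa t ts.
    have tsD : `[t, s]%classic `<=` D.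
      by move=> l; rewrite /= in_itv /= => /andP[_]; exact: Ddown.
    have [M _ aM] := lipschitz_bounded (solution_primitive bQ bP sa tsD).1.
    apply: (ydom_backward bQ bP (M := M) ts) => [l hl Dl|]; last by rewrite lexx.
    apply: (@le_trans _ _ (a l)); last exact: le_trans (ler_norm _) (aM l hl).
    have iI : is_interval `[l, s]%classic by exact: interval_is_interval.
    have I1 : `[l, s]%classic s by rewrite /= in_itv /= lexx andbT; case/andP: hl.
    have I2 : `[l, s]%classic l by rewrite /= in_itv /= lexx; case/andP: hl.
    have s1 : solution Q P `[l, s] (fun k => y Q P k s x1).
      apply: (solution_sub (y_solution bQ bP s x1) iI).
      by apply: ydom_segment => //; exact: ydom_id.
    have s2 : solution Q P `[l, s] a.
      apply: (solution_sub sa iI) => k; rewrite /= in_itv /= => /andP[_]; exact: Ddown.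
    by apply: (solution_le bQ bP s1 s2 I1 I2); rewrite (y_id bQ bP).
  split=> [/bounded_past_solution H|xa]; last exact: past_solution_bounded (down x0 xa).
  rewrite leNgt; apply/negP => ax.
  (* the solution also exists at time T, where it exceeds the largest admissible value *)
  pose lo := Num.min s T; pose hi := Num.max s T.
  have inI l : lo <= l <= hi -> l <= s \/ s <= l <= T.
    by rewrite /lo /hi; case: (leP s T) => h hl; [|left; move: hl; arith];
       case: (leP l s) => h'; [left|right; move: hl h'; arith].
  have DT' : ydom Q P s x0 T.
    have [Ts|sT] := leP T s; first exact: H.
    have sub : `[s, T]%classic `<=` D by move=> l; rewrite /= in_itv /= => /andP[_]; exact: Dpast.
    have [M _ aM] := lipschitz_bounded (solution_primitive bQ bP sa sub).1.
    apply: (ydom_forward bQ bP (M := - M) (ltW sT)) => [l hl Dl|]; last by rewrite lexx ltW.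
    apply: (@le_trans _ _ (a l)); first by have := aM l hl; rewrite ler_norml => /andP[].
    have iI : is_interval `[s, l]%classic by exact: interval_is_interval.
    have I1 : `[s, l]%classic s by rewrite /= in_itv /= lexx; case/andP: hl.
    have I2 : `[s, l]%classic l by rewrite /= in_itv /= lexx andbT; case/andP: hl.
    have s1 : solution Q P `[s, l] (fun k => y Q P k s x0).
      apply: (solution_sub (y_solution bQ bP s x0) iI).
      by apply: ydom_segment => //; exact: ydom_id.
    have s2 : solution Q P `[s, l] a.
      apply: (solution_sub sa iI) => k; rewrite /= in_itv /= => /andP[_ kl].
      by apply: Dpast; apply: le_trans kl _; case/andP: hl.
    by apply: (solution_le bQ bP s2 s1 I1 I2); rewrite (y_id bQ bP) ltW.
  have : y Q P T s x0 <= c by apply: cmax; exact: past_solution_restart.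
  rewrite leNgt => /negP; apply.
  pose I : set R := [set l | lo <= l <= hi].
  have iI : is_interval I by move=> b1 b2 /= h1 h2 l hl; move: h1 h2 hl; rewrite /I /=; arith.
  have Is : I s by rewrite /I /= /lo /hi; case: (leP s T) => h; rewrite ?lexx ?(ltW h) ?h.
  have IT : I T by rewrite /I /= /lo /hi; case: (leP s T) => h; rewrite ?lexx ?(ltW h) ?h.
  have s1 : solution Q P I (fun k => y Q P k s x0).
    apply: (solution_sub (y_solution bQ bP s x0) iI) => l /inI[|/andP[sl lT]]; first exact: H.
    by apply: (ydom_interval bQ bP (ydom_id bQ bP s x0) DT'); rewrite sl.
  have s2 : solution Q P I a.
    apply: (solution_sub sa iI) => l /inI[|/andP[_ lT]]; first exact: Ddown.
    exact: Dpast.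
  by have := solution_lt bQ bP s2 s1 Is IT; rewrite (y_id bQ bP) /a (y_id bQ bP); apply.
- move=> b bE; rewrite bE in DE; have DEb t : D t <-> t < b by rewrite DE /= lte_fin.
  have [K HK] := riccati_le.
  apply/cvgrNyPle => A.
  have Tb : T < b by apply/DEb.
  pose M := A - `|K| * (b - T).
  have [t1 [ht1 Dt1 at1]] : exists t1, [/\ T <= t1 <= b, D t1 & a t1 < M].
    apply: contrapT => hno.
    have := ydom_forward bQ bP (s := T) (y0 := c) (M := M) (ltW Tb).
    suff H : forall t, T <= t <= b -> ydom Q P T c t -> M <= y Q P t T c.
      by move=> /(_ H b); rewrite lexx (ltW Tb) => /(_ isT)/DEb; rewrite ltxx.
    by move=> t ht Dt; rewrite leNgt; apply/negP => h; apply: hno; exists t.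
  have t1b : t1 < b by apply/DEb.
  near=> t.
  have tb : t < b by near: t; exact: nbhs_left_lt.
  have t1t : t1 <= t by near: t; exact: nbhs_left_ge.
  have sub : `[t1, t]%classic `<=` D.
    by move=> l; rewrite /= in_itv /= => /andP[_ lt]; apply/DEb; exact: le_lt_trans tb.
  have := primitive_mean_le (m := `|K|) t1t (solution_primitive bQ bP sa sub).
  have HK' l : t1 < l < t -> riccati Q P l (a l) <= `|K|.
    by move=> _; apply: le_trans (HK _ _) (ler_norm _).
  move=> /(_ HK') h.
  have h2 : `|K| * (t - t1) <= `|K| * (b - T).
    by rewrite ler_wpM2l //; move: ht1 tb; arith.
  by move: h h2 at1; rewrite /M; arith.
Unshelve. all: by end_near. Qed.

End PastHalf.

Section NearPlusInfinity.
Variable R : realType.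

Lemma near_pinftyP (A : set R) : (\forall t \near +oo, A t) <->
  exists T, forall t, T <= t -> A t.
Proof.
split=> [[T [_ H]]|[T H]].
  by exists (T + 1) => t tT; apply: H; lra.
by exists T; split; [exact: num_real|move=> t tT; apply: H; exact: ltW].
Qed.

Lemma cvg0_pinftyP (f : R -> R) : f t @[t --> +oo] --> 0 <->
  forall e, 0 < e -> exists T, forall t, T <= t -> `|f t| <= e.
Proof.
split=> [/cvgrPdist_le H e e0|H].
  by have /near_pinftyP[T HT] := H e e0; exists T => t /HT; rewrite sub0r normrN.
apply/cvgrPdist_le => e e0; apply/near_pinftyP.
by have [T HT] := H e e0; exists T => t /HT; rewrite sub0r normrN.
Qed.

Lemma cvg0_reflect (f g : R -> R) : (exists T, forall t, T <= t -> g t = f (- t)) ->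
  f t @[t --> -oo] --> 0 -> g t @[t --> +oo] --> 0.
Proof.
move=> [T1 fg] /cvg0_ninftyP H; apply/cvg0_pinftyP => e e0.
have [T HT] := H e e0; exists (Num.max T1 (- T)) => t; rewrite ge_max => /andP[h1 h2].
by rewrite fg //; apply: HT; rewrite lerNl.
Qed.

End NearPlusInfinity.

(** * Time reversal *)

Section Reflection.
Variable R : realType.
Notation mu := (@lebesgue_measure R).
Implicit Types (Q P x G p : R -> R) (D : set R) (s t : R).

(** The change of variables [t -> - t], [y -> - y] turns a Riccati equation into
    another one and exchanges attractors at [-oo] with repellers at [+oo]. *)
Definition reflect_fun x t := - x (- t).
Definition reflect_time P t : R := P (- t).
Definition reflect_set D : set R := [set t | D (- t)].

Lemma reflect_funK x : reflect_fun (reflect_fun x) = x.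
Proof. by apply/funext => t; rewrite /reflect_fun !opprK. Qed.

Lemma reflect_timeK P : reflect_time (reflect_time P) = P.
Proof. by apply/funext => t; rewrite /reflect_time opprK. Qed.


Lemma ae_reflect (A : set R) : {ae mu, forall t, A t} -> {ae mu, forall t, A (- t)}.
Proof.
move=> [N [mN N0 sub]]; exists (-%R @^-1` N); split.
- have m : measurable_fun [set: measurableTypeR R] (-%R : R -> R) by exact: oppr_measurable.
  by rewrite -(setTI (_ @^-1` _)); apply: m.
- by have := lebesgue_measureN mN; rewrite /pushforward => ->.
- by move=> t /= h; apply: sub.
Qed.

Lemma abs_continuous_reflect c d x : abs_continuous c d x ->
  abs_continuous (- d) (- c) (reflect_fun x).
Proof.
move=> acx e e0; have [del del0 H] := acx e e0; exists del => // n u v huv tI small.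
have := H n (fun i => - v i) (fun i => - u i).
have h1 i : c <= - v i /\ - v i < - u i /\ - u i <= d by have := huv i; lra.
have h2 : trivIset setT (fun i => `]- v i, - u i[%classic).
  move=> i j _ _ [z [/=]]; rewrite !in_itv /= => hi hj.
  by apply: tI => //; exists (- z); split; rewrite /= in_itv /=; lra.
have h3 : \sum_(i < n) (- u i - - v i) < del.
  by under eq_bigr => i _ do rewrite opprK addrC.
move=> /(_ h1 h2 h3); congr (_ < _); apply: eq_bigr => i _.
by rewrite /reflect_fun; congr `|_|; ring.
Qed.

Lemma solution_reflect Q P D x : solution Q P D x ->
  solution (reflect_fun Q) (reflect_time P) (reflect_set D) (reflect_fun x).
Proof.
move=> [iD acD ae]; split.
- by move=> a b /= Da Db t ht; apply: (iD _ _ Db Da); lra.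
- move=> c d cd cdD; rewrite -(opprK c) -(opprK d); apply: abs_continuous_reflect.
  apply: acD; first lra.
  by move=> t; rewrite /= in_itv /= => ht; rewrite -(opprK t); apply: cdD; rewrite /= in_itv /=; lra.
apply: aeS (ae_reflect ae) => t H Dt.
have dx := H Dt.
have dN : is_derive t (1 : R) (-%R : R -> R) (-1) by exact: is_deriveNid.
apply: is_derive_eq (is_deriveN (is_derive1_comp dx dN)) _.
by rewrite /riccati /reflect_fun /reflect_time; ring.
Qed.

Lemma maximal_solution_reflect Q P D x : maximal_solution Q P D x ->
  maximal_solution (reflect_fun Q) (reflect_time P) (reflect_set D) (reflect_fun x).
Proof.
move=> [sx mx]; split; first exact: solution_reflect.
move=> D' x' sx' DD' xx' t D't.
have := solution_reflect sx'; rewrite reflect_funK reflect_timeK => sx''.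
apply: (mx _ _ sx'') => [l Dl|l Dl|].
- by apply: DD'; rewrite /reflect_set /= opprK.
- by rewrite /reflect_fun xx' /reflect_fun /reflect_set /= opprK ?opprK.
- by rewrite /reflect_set /= opprK.
Qed.

Lemma bounded_measurable_reflect G : bounded_measurable G ->
  bounded_measurable (reflect_time G).
Proof.
move=> [mG [M GM]]; split; last by exists M => t; exact: GM.
apply: (measurableT_comp mG); exact: oppr_measurable.
Qed.

Lemma bounded_measurable_reflectN G : bounded_measurable G ->
  bounded_measurable (reflect_fun G).
Proof.
move=> /bounded_measurable_reflect [mG [M GM]]; split; last by exists M => t; rewrite normrN; exact: GM.
exact: measurable_funN.
Qed.

Section ReflectY.
Variables (Q P : R -> R).
Hypothesis (bQ : bounded_measurable Q) (bP : bounded_measurable P).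

(** Both sides are the maximal solution through the same point. *)
Lemma y_reflect s (x0 : R) :
  ydom (reflect_fun Q) (reflect_time P) (- s) (- x0) = reflect_set (ydom Q P s x0) /\
  forall t, ydom Q P s x0 t ->
    y (reflect_fun Q) (reflect_time P) (- t) (- s) (- x0) = - y Q P t s x0.
Proof.
have := maximal_solution_reflect (y_maximal bQ bP s x0).
set D := reflect_set _; set x := reflect_fun (fun t => y Q P t s x0) => mx.
have Ds : D (- s) by rewrite /D /reflect_set /= opprK; exact: ydom_id.
have xs : x (- s) = - x0.
  by rewrite /x /reflect_fun opprK (y_id bQ bP).
have [dE yE] := maximal_solutionE (bounded_measurable_reflectN bQ)
  (bounded_measurable_reflect bP) mx Ds.
rewrite -xs; split => // t Dt; rewrite yE /x /reflect_fun ?opprK //.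
by rewrite /D /reflect_set /= opprK.
Qed.

Lemma bounded_at_reflect s (x0 : R) :
  bounded_at_ninfty (ydom (reflect_fun Q) (reflect_time P) (- s) (- x0))
    (fun t => y (reflect_fun Q) (reflect_time P) t (- s) (- x0)) <->
  bounded_at_pinfty (ydom Q P s x0) (fun t => y Q P t s x0).
Proof.
have [dE yE] := y_reflect s x0; rewrite dE; split=> -[t0 [M H]]; exists (- t0), M => t ht.
  have [Dt xM] := H (- t) ltac:(lra).
  move: Dt; rewrite /reflect_set /= opprK => Dt; split => //.
  by rewrite yE // normrN in xM.
have [Dt xM] := H (- t) ltac:(lra); split => //.
by rewrite -[X in y _ _ X](opprK t) yE // normrN.
Qed.

Lemma is_frak_a_reflect alpha r : is_frak_r Q P alpha r ->
  is_frak_a (reflect_fun Q) (reflect_time P) (- alpha)%E (reflect_fun r).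
Proof.
move=> [alp mx hiff lim].
have setE : [set t | (t%:E < - alpha)%E] = reflect_set [set t | (alpha < t%:E)%E].
  by apply/seteqP; split => t; rewrite /reflect_set /= EFinN lteNr.
split.
- by case: (alpha) alp => [b|//|_]; rewrite ?ltNyr.
- by rewrite setE; exact: maximal_solution_reflect.
- move=> s x0 sb; have sb' : (alpha < (- s)%:E)%E by rewrite EFinN lteNr.
  have := bounded_at_reflect (- s) (- x0); rewrite !opprK => ->.
  by rewrite /reflect_fun lerNr; exact: hiff.
move=> b bE; have aE : alpha = (- b)%:E by rewrite EFinN -bE oppeK.
apply/cvgrNyPle => A; have /cvgryPge /(_ (- A)) := lim _ aE.
rewrite /at_right /at_left !near_withinE !near_simpl => /nbhs_ballP[e /= e0 H].
apply/nbhs_ballP; exists e => // t /= bt tb.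
rewrite /reflect_fun lerNl; apply: H; last by rewrite ltrN2.
by move: bt; rewrite /ball /= -opprB normrN opprK addrC.
Qed.

End ReflectY.

Lemma is_frak_r_reflect Q P (bQ : bounded_measurable Q) (bP : bounded_measurable P) beta a :
  is_frak_a (reflect_fun Q) (reflect_time P) beta a ->
  is_frak_r Q P (- beta)%E (reflect_fun a).
Proof.
move=> [nb mx hiff lim].
have setE : [set t | (- beta < t%:E)%E] = reflect_set [set t | (t%:E < beta)%E].
  by apply/seteqP; split => t; rewrite /reflect_set /= EFinN lteNl.
split.
- by case: (beta) nb => [b _|_|//]; rewrite /= ?ltry.
- rewrite setE; have := maximal_solution_reflect mx.
  by rewrite reflect_funK reflect_timeK.
- move=> s x0 sb; have sb' : ((- s)%:E < beta)%E by rewrite EFinN lteNl.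
  rewrite -bounded_at_reflect // /reflect_fun lerNl; exact: hiff.
move=> b bE; have aE : beta = (- b)%:E by rewrite EFinN -bE oppeK.
apply/cvgryPge => A; have /cvgrNyPle /(_ (- A)) := lim _ aE.
rewrite /at_right /at_left !near_withinE !near_simpl => /nbhs_ballP[e /= e0 H].
apply/nbhs_ballP; exists e => // t /= bt tb.
rewrite /reflect_fun lerNr; apply: H; last by rewrite ltrN2.
by move: bt; rewrite /ball /= -opprB normrN opprK addrC.
Qed.

End Reflection.

(** * Dynamics near plus infinity *)

Section FutureHalf.
Variable R : realType.
Implicit Types (s t : R).

Lemma shiftQ_reflect (G : R -> R) : shiftQ (reflect_fun G) = reflect_fun (shiftQ G).
Proof. by apply/funext => t; rewrite /shiftQ /reflect_fun mulrN. Qed.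

Lemma shiftP_reflect (G p : R -> R) :
  shiftP (reflect_fun G) (reflect_time p) = reflect_time (shiftP G p).
Proof. by apply/funext => t; rewrite /shiftP /reflect_fun /reflect_time sqrrN. Qed.

Variables (G p ta tr : R -> R) (gam delta B : R).
Hypothesis (bG : bounded_measurable G) (bp : bounded_measurable p).
Hypothesis (hG : G t @[t --> +oo] --> gam).
Hypothesis (sta : solution (fun=> 0) p setT ta) (str : solution (fun=> 0) p setT tr).
Hypothesis (delta0 : 0 < delta) (sep : forall t, delta <= ta t - tr t).
Hypothesis (taB : forall t, `|ta t| <= B) (trB : forall t, `|tr t| <= B).

Local Notation Q := (shiftQ G).
Local Notation P := (shiftP G p).
Local Notation Gr := (reflect_fun G).
Local Notation pr := (reflect_time p).

Let bQ : bounded_measurable Q := shiftQ_bounded bG.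
Let bP : bounded_measurable P := shiftP_bounded bG bp.
Let bGr : bounded_measurable Gr := bounded_measurable_reflectN bG.
Let bpr : bounded_measurable pr := bounded_measurable_reflect bp.

Let hGr : Gr t @[t --> -oo] --> - gam.
Proof. by apply: cvgN; exact: ((cvgy_compNP G (nbhs gam)).1 hG). Qed.

Let reflect_solution0 x : solution (fun=> 0) p setT x ->
  solution (fun=> 0) pr setT (reflect_fun x).
Proof.
move=> /solution_reflect; rewrite (_ : reflect_fun (fun=> 0) = (fun=> 0)) //.
by apply/funext => t; rewrite /reflect_fun oppr0.
Qed.

Let sep_r t : delta <= reflect_fun tr t - reflect_fun ta t.
Proof. by rewrite /reflect_fun opprK addrC. Qed.

Let trB_r t : `|reflect_fun tr t| <= B. Proof. by rewrite normrN. Qed.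
Let taB_r t : `|reflect_fun ta t| <= B. Proof. by rewrite normrN. Qed.

Let str_r := reflect_solution0 str.
Let sta_r := reflect_solution0 sta.

(** The results near plus infinity are those near minus infinity for the reflected
    equation, in which [ta] and [tr] exchange their roles. *)
Lemma frak_r_exists : exists alpha r, is_frak_r Q P alpha r.
Proof.
have [beta [a]] := frak_a_exists bGr bpr hGr str_r sta_r delta0 sep_r trB_r taB_r.
rewrite shiftQ_reflect shiftP_reflect => ha.
by exists (- beta)%E, (reflect_fun a); exact: is_frak_r_reflect.
Qed.

Section FrakR.
Variables (alpha : \bar R) (r : R -> R).
Hypothesis (hr : is_frak_r Q P alpha r).

Let ha : is_frak_a (shiftQ Gr) (shiftP Gr pr) (- alpha)%E (reflect_fun r).
Proof. by rewrite shiftQ_reflect shiftP_reflect; exact: is_frak_a_reflect. Qed.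

Let reflect_lt s : (alpha < s%:E)%E -> ((- s)%:E < - alpha)%E.
Proof. by rewrite EFinN lteNr oppeK. Qed.

Let yr s (x0 : R) := y_reflect bQ bP s x0.

Lemma frak_r_le s (x0 : R) : (alpha < s%:E)%E ->
  (forall t, s <= t -> ydom Q P s x0 t) <-> r s <= x0.
Proof.
move=> /reflect_lt sb.
have := frak_a_le bGr bpr hGr str_r sta_r delta0 sep_r trB_r taB_r ha (- x0) sb.
have [dE _] := yr s x0.
rewrite shiftQ_reflect shiftP_reflect dE /reflect_fun opprK lerN2 => <-.
split=> H t ht; first by apply: H; rewrite lerNr.
by rewrite -(opprK t); apply: H; rewrite lerN2.
Qed.

Lemma frak_r_cvg : `|r t - (tr t + gam)| @[t --> +oo] --> 0.
Proof.
have := frak_a_cvg bGr bpr hGr str_r sta_r delta0 sep_r trB_r taB_r ha.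
apply: cvg0_reflect; exists 0 => t _; rewrite /reflect_fun !opprK -normrN.
by congr `|_|; ring.
Qed.

Lemma above_frak_r s (x0 : R) : (alpha < s%:E)%E -> r s < x0 ->
  (forall t, s <= t -> ydom Q P s x0 t) /\
  `|y Q P t s x0 - (ta t + gam)| @[t --> +oo] --> 0.
Proof.
move=> sb rx; have D := (frak_r_le x0 sb).2 (ltW rx); split => //.
have rx' : - x0 < reflect_fun r (- s) by rewrite /reflect_fun opprK ltrN2.
have [_] := below_frak_a bGr bpr hGr str_r sta_r delta0 sep_r trB_r taB_r ha
  (reflect_lt sb) rx'.
have [_ yE] := yr s x0.
apply: cvg0_reflect; exists s => t st; rewrite shiftQ_reflect shiftP_reflect.
rewrite yE; last exact: D.
by rewrite /reflect_fun !opprK -normrN; congr `|_|; ring.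
Qed.

Lemma frak_r_pullback_repulsive : locally_pullback_repulsive Q P alpha r.
Proof.
have [s0 [rho [C [s0b rho0 H]]]] :=
  frak_a_attracts bGr bpr hGr str_r sta_r delta0 sep_r trB_r taB_r ha.
have K s x0 : - s0 <= s -> `|x0 - r s| <= rho -> forall t, - s0 <= t <= s ->
    ydom Q P s x0 t /\ `|r t - y Q P t s x0| * (s - t) <= C.
  move=> ss hx t ht; have [dE yE] := yr s x0.
  have h1 : - s <= s0 by rewrite lerNl.
  have h2 : `|- x0 - reflect_fun r (- s)| <= rho.
    have -> : - x0 - reflect_fun r (- s) = - (x0 - r s) by rewrite /reflect_fun !opprK; ring.
    by rewrite normrN.
  have h3 : - s <= - t <= s0 by lra.
  have [] := H (- s) (- x0) h1 h2 (- t) h3.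
  rewrite shiftQ_reflect shiftP_reflect dE /reflect_set /= opprK => Dt.
  rewrite yE // /reflect_fun opprK => h; split => //.
  move: h; have -> : - r t - - y Q P t s x0 = - (r t - y Q P t s x0) by ring.
  by rewrite normrN; have -> : - t - - s = s - t by ring.
have Kp s : `|r s + rho - r s| <= rho by rewrite addrC addKr gtr0_norm.
have Km s : `|r s - rho - r s| <= rho.
  by rewrite addrC addKr normrN gtr0_norm.
have lim (f : R -> R) t : - s0 <= t -> (forall s, `|f s - r s| <= rho) ->
    `|r t - y Q P t s (f s)| @[s --> +oo] --> 0.
  move=> st hf; apply/cvg0_pinftyP => e e0.
  have C0 : 0 <= C.
    have [_] := K t (f t) st (hf t) t ltac:(rewrite st lexx //).
    by rewrite (subrr t) mulr0.
  have Ce : 0 <= C / e by apply: divr_ge0 => //; exact: ltW.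
  exists (t + C / e + 1) => s hs; rewrite normr_id.
  have ts : 0 < s - t by lra.
  have [_ h] := K s (f s) ltac:(lra) (hf s) t ltac:(lra).
  rewrite -(ler_pM2r ts); apply: (le_trans h).
  by rewrite -ler_pdivrMl // mulrC; lra.
exists (- s0), rho; split => //.
- by rewrite EFinN lteNr.
- by move=> s ss; split => t; rewrite /= in_itv /= => ht;
    [have [] := K s _ ss (Kp s) t ht|have [] := K s _ ss (Km s) t ht].
- by move=> t ht; split; [apply: (lim (fun s => r s + rho))|apply: (lim (fun s => r s - rho))].
Qed.

End FrakR.
End FutureHalf.

(** * BPUC functions are bounded and measurable *)

Section BPUCMeasurable.
Variable R : realType.
Implicit Types (q f : R -> R) (s t : R).

Lemma grid_function_measurable (g : int -> R) (N : nat) :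
  measurable_fun setT (fun t : R => g (Num.floor (N.+1%:R * t))).
Proof.
move=> _ Y mY; rewrite setTI.
pose cell (z : int) : set R := `[z%:~R / N.+1%:R, (z + 1)%:~R / N.+1%:R[%classic.
pose E k : set R := if unpickle k is Some z then
  (if g z \in Y then cell z else set0) else set0.
have -> : (fun t : R => g (Num.floor (N.+1%:R * t))) @^-1` Y = \bigcup_k E k.
  have N0 : (0 : R) < N.+1%:R by rewrite ltr0n.
  apply/seteqP; split => t /=.
    move=> Yt; exists (pickle (Num.floor (N.+1%:R * t))); first exact: I.
    rewrite /E pickleK mem_set // /cell /= in_itv /=.
    rewrite ler_pdivrMr // ltr_pdivlMr // mulrC.
    exact: Num.Theory.floor_itv.
  move=> [k _]; rewrite /E; case: unpickle => // z; case: ifPn => // /set_mem Yz.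
  rewrite /cell /= in_itv /= ler_pdivrMr // ltr_pdivlMr // mulrC => h.
  by rewrite (Num.Theory.floor_def h).
apply: bigcupT_measurable => k; rewrite /E; case: unpickle => // z; case: ifP => // _.
exact: measurable_itv.
Qed.

(** [q t] is the limit of the values of [q] at the next point of finer and finer
    grids, by right continuity. *)
Lemma right_continuous_measurable q : (forall t, q x @[x --> t^'+] --> q t) ->
  measurable_fun setT q.
Proof.
move=> rc.
pose h (N : nat) (z : int) := q ((z + 1)%:~R / N.+1%:R).
apply: (measurable_fun_cvg (fun N => grid_function_measurable (h N) N)) => t _.
apply/cvgrPdist_le => e e0.
have /cvgrPdist_le /(_ e e0) := rc t.
rewrite /at_right near_withinE => /nbhs_ballP[eta /= eta0 H].
exists (Num.truncn eta^-1) => // N /= hN; rewrite /h.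
have N0 : (0 : R) < N.+1%:R by rewrite ltr0n.
have /andP[f1 f2] := Num.Theory.floor_itv (N.+1%:R * t).
set z := Num.floor _ in f1 f2 *.
pose X : R := (z + 1)%:~R / N.+1%:R.
have tX : t < X by rewrite /X ltr_pdivlMr // mulrC.
have Xeta : X < t + eta.
  rewrite /X ltr_pdivrMr // mulrDl intrD rmorph1.
  have h1 : 1 < eta * N.+1%:R.
    rewrite mulrC -ltr_pdivrMr // mul1r.
    apply: lt_le_trans (truncnS_gt _) _.
    by rewrite ler_nat ltnS.
  by apply: ler_ltD h1; rewrite mulrC.
apply: H => //; rewrite /ball /= ltr_distlC -/X Xeta andbT.
by move: tX eta0; clear; move: X => X; lra.
Qed.

Lemma BPUC_bounded_measurable q : BPUC q -> bounded_measurable q.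
Proof.
move=> [n [d [qs [H qE]]]].
have -> : q = (fun t => \sum_i qs i t) by apply/funext.
have bm i : bounded_measurable (qs i).
  by have [_ [bd rc _]] := H i; split => //; exact: right_continuous_measurable.
split.
  by apply: measurable_sum => i; have [] := bm i.
have /choice[M HM] : forall i, exists M : R, forall t, `|qs i t| <= M by move=> i; have [] := bm i.
exists (\sum_i M i) => t; apply: le_trans (ler_norm_sum _ _ _) _.
by apply: ler_sum => i _.
Qed.

End BPUCMeasurable.

(** * Hyperbolic pairs: translation and separation *)

Section Translation.
Variable R : realType.
Implicit Types (p x Q P : R -> R) (s t k : R).

Lemma solution_translate Q P Q' P' k x :
  (forall t z, riccati Q' P' t (z + k) = riccati Q P t z) ->
  solution Q P setT x -> solution Q' P' setT (fun t => x t + k).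
Proof.
move=> ricE [iT acx ae]; split => //.
  move=> c d cd cdT e e0; have [del del0 H] := acx c d cd cdT e e0.
  exists del => // n u v h1 h2 h3.
  under eq_bigr => i _ do rewrite opprD addrACA subrr addr0.
  exact: H.
apply: aeS ae => t h _; rewrite ricE.
by apply: is_derive_eq (is_deriveD (h I) (is_derive_cst k t 1)) _; rewrite addr0.
Qed.

Lemma bounded_solution_translate Q P Q' P' k x :
  (forall t z, riccati Q' P' t (z + k) = riccati Q P t z) ->
  bounded_solution Q P x -> bounded_solution Q' P' (fun t => x t + k).
Proof.
move=> ricE [sx [M xM]]; split; first exact: solution_translate sx.
exists (M + `|k|) => t; apply: le_trans (ler_normD _ _) _.
by rewrite lerD2r.
Qed.

Lemma attractor_repeller_translate p a r k :
  attractor_repeller (fun=> 0) p a r ->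
  attractor_repeller (shiftQ (fun=> k)) (shiftP (fun=> k) p)
    (fun t => a t + k) (fun t => r t + k).
Proof.
have ricE t z : riccati (shiftQ (fun=> k)) (shiftP (fun=> k) p) t (z + k) =
    riccati (fun=> 0) p t z by rewrite /riccati /shiftQ /shiftP; ring.
have intE (x : R -> R) : (fun l => - 2 * (x l + k) + shiftQ (fun=> k) l) =
    (fun l => - 2 * x l + 0) by apply/funext => l; rewrite /shiftQ; ring.
move=> [[ba [ka [ea [ka1 ea0 Ha]]]] [br [kr [er [kr1 er0 Hr]]]] bnd]; split.
- split; first exact: bounded_solution_translate ba.
  by exists ka, ea; split => // s t st; rewrite intE; exact: Ha.
- split; first exact: bounded_solution_translate br.
  by exists kr, er; split => // s t st; rewrite intE; exact: Hr.
move=> b bb t.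
have ricE' l z : riccati (fun=> 0) p l (z + - k) =
    riccati (shiftQ (fun=> k)) (shiftP (fun=> k) p) l z by rewrite -ricE subrK.
have := bnd _ (bounded_solution_translate ricE' bb) t.
by rewrite lerBrDr lerBlDr.
Qed.

End Translation.

Section Hyperbolicity.
Variable R : realType.
Implicit Types (x : R -> R) (s t k c d : R).
Variables (Q P a r : R -> R).
Hypothesis (bQ : bounded_measurable Q) (bP : bounded_measurable P).
Hypothesis (sa : solution Q P setT a) (sr : solution Q P setT r).

Local Notation w t := (a t - r t).
Local Notation integrand x := (fun l => - 2 * x l + Q l).

Lemma global_primitive x c d : solution Q P setT x ->
  primitive c d (fun t => riccati Q P t (x t)) x.
Proof. by move=> sx; apply: (solution_primitive bQ bP sx). Qed.

Lemma integrand_primitive x s c d : solution Q P setT x ->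
  primitive c d (integrand x) (oriented_integral (integrand x) s).
Proof.
move=> sx; apply: lbm_oriented_integral; apply: lbmD; last exact: bm_lbm.
apply: lbmM; first exact: lbm_cst.
by apply: (lbm_primitive (g := fun t => riccati Q P t (x t))) => c' d'; exact: global_primitive.
Qed.

(** Since [w' = (Q - a - r) * w], dividing [w] by the exponential of the integral of
    [Q - 2 a] leaves the growth rate [w]; with [r] for [a] it leaves [- w]. *)
Lemma weighted_attractor s c d :
  let phi t := w t * expR (- oriented_integral (integrand a) s t) in
  primitive c d (fun t => w t * phi t) phi.
Proof.
move=> phi.
have pw := primitiveB (global_primitive c d sa) (global_primitive c d sr).
have pE := primitive_expR (primitiveZ (-1) (integrand_primitive s c d sa)).
apply: eq_primitive (primitiveM pw pE) => t _ /=; rewrite /phi mulN1r //.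
by rewrite /riccati; ring.
Qed.

Lemma weighted_repeller s c d :
  let psi t := w t * expR (- oriented_integral (integrand r) s t) in
  primitive c d (fun t => - w t * psi t) psi.
Proof.
move=> psi.
have pw := primitiveB (global_primitive c d sa) (global_primitive c d sr).
have pE := primitive_expR (primitiveZ (-1) (integrand_primitive s c d sr)).
apply: eq_primitive (primitiveM pw pE) => t _ /=; rewrite /psi mulN1r //.
by rewrite /riccati; ring.
Qed.

Section Separated.
Variables (delta W : R).
Hypothesis (delta0 : 0 < delta) (sep : forall t, delta <= w t) (wW : forall t, w t <= W).

Let w0 t : 0 < w t. Proof. exact: lt_le_trans (sep t). Qed.

Let W1 : 1 <= W / delta.
Proof. by rewrite ler_pdivlMr // mul1r (le_trans (sep 0)). Qed.


Lemma separated_attractive : attractive_bound Q a.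
Proof.
exists (W / delta), delta; split => // s t st.
have := primitive_expR_ge (k := delta) st (weighted_attractor s s t).
set E := oriented_integral _ s t.
have H l : s < l < t -> delta * (w l * expR (- oriented_integral (integrand a) s l)) <=
   w l * (w l * expR (- oriented_integral (integrand a) s l)).
  by move=> _; rewrite ler_wpM2r // mulr_ge0 ?expR_ge0 // ltW.
move=> /(_ H); rewrite oriented_integral_id oppr0 expR0 mulr1 -/E => h.
rewrite mulNr expRN ler_pdivlMr ?expR_gt0 // ler_pdivlMr //.
have : w s * expR (delta * (t - s)) * expR E <= w t.
  by rewrite -ler_pdivlMr ?expR_gt0 // -expRN.
have : delta * (expR (delta * (t - s)) * expR E) <= w s * (expR (delta * (t - s)) * expR E).
  by rewrite ler_wpM2r // mulr_ge0 ?expR_ge0.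
by have := wW t; lra.
Qed.

Lemma separated_repulsive : repulsive_bound Q r.
Proof.
exists (W / delta), delta; split => // s t ts.
have := primitive_expR_le (k := - delta) ts (weighted_repeller s t s).
set E := oriented_integral _ s t.
have H l : t < l < s -> - w l * (w l * expR (- oriented_integral (integrand r) s l)) <=
   - delta * (w l * expR (- oriented_integral (integrand r) s l)).
  by move=> _; rewrite ler_wpM2r ?lerN2 // mulr_ge0 ?expR_ge0 // ltW.
move=> /(_ H); rewrite oriented_integral_id oppr0 expR0 mulr1 -/E => h.
have -> : delta * (t - s) = - delta * (s - t) by ring.
have {}h : w s * expR E <= w t * expR (- delta * (s - t)).
  by rewrite -ler_pdivlMr ?expR_gt0 // -expRN mulrAC.
rewrite mulrAC ler_pdivlMr // mulrC.
apply: (@le_trans _ _ (w s * expR E)); first by rewrite ler_wpM2r ?expR_ge0.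
by apply: le_trans h _; rewrite ler_wpM2r ?expR_ge0.
Qed.

End Separated.

Lemma opposite_integral f s t : oriented_integral f t s = - oriented_integral f s t :> R.
Proof.
rewrite /oriented_integral; case: (ltgtP s t) => [st|ts|->]; rewrite ?opprK //.
by rewrite set_itv1 Rintegral_set1 oppr0.
Qed.

(** The same integral would be bounded above by [ln k1 - b1 * T] and below by
    [b2 * T - ln k2]. *)
Lemma attractive_repulsive_neq : attractive_bound Q a -> repulsive_bound Q r ->
  (forall t, a t = r t) -> False.
Proof.
move=> [k1 [b1 [k11 b10 H1]]] [k2 [b2 [k21 b20 H2]]] ar.
pose T := k1 * k2 / (b1 + b2).
have k120 : 0 < k1 * k2 by rewrite mulr_gt0 //; lra.
have b12 : 0 < b1 + b2 by lra.
have T0 : 0 <= T by rewrite divr_ge0 // ltW.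
have := H2 T 0 T0; have := H1 0 T T0.
have -> : integrand r = integrand a by apply/funext => l; rewrite ar.
rewrite (opposite_integral _ 0 T) expRN; set E := expR _ => h1 h2.
have E0 : 0 < E by exact: expR_gt0.
have : E * E^-1 <= (k1 * expR (- b1 * (T - 0))) * (k2 * expR (b2 * (0 - T))).
  by apply: ler_pM => //; rewrite ?invr_ge0 ltW.
rewrite divff ?gt_eqF // mulrACA -expRD.
have -> : - b1 * (T - 0) + b2 * (0 - T) = - (k1 * k2).
  by rewrite /T; field; rewrite gt_eqF.
rewrite expRN ler_pdivlMr ?expR_gt0 // mul1r.
by have := expR_ge1Dx (k1 * k2); lra.
Qed.

(** By [weighted_attractor] and [weighted_repeller], as long as [w <= m] the
    hyperbolic bounds make [w] small at the end of a long time interval compared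
    with its beginning, and also small at the beginning compared with the end.
    So [w] exceeds [m] in every interval of length [T]; as [- w' / w] is bounded,
    [w] remains bounded below in between. *)
Lemma hyperbolic_pair_separated (B : R) : (forall t, `|a t| <= B) -> (forall t, `|r t| <= B) ->
  (forall t, r t <= a t) -> attractive_bound Q a -> repulsive_bound Q r ->
  exists2 delta, 0 < delta & forall t, delta <= w t.
Proof.
move=> aB rB ra Ha Hr.
have wpos t : 0 < w t.
  rewrite subr_gt0 lt_neqAle ra andbT; apply/eqP => e.
  apply: (attractive_repulsive_neq Ha Hr) => l.
  exact: (solution_unique bQ bP sa sr I I (esym e)).
move: Ha Hr => [k1 [b1 [k11 b10 H1]]] [k2 [b2 [k21 b20 H2]]].
have [_ [CQ QC]] := bQ.
pose m := Num.min b1 b2 / 2.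
have [mb1 mb2] : 2 * m <= b1 /\ 2 * m <= b2.
  by rewrite /m mulrC divfK // !ge_min !lexx orbT.
have m0 : 0 < m by rewrite divr_gt0 // lt_min b10.
have k120 : 0 < k1 * k2 by rewrite mulr_gt0 //; lra.
(* this length is enough because expR z > z for z = k1 * k2 *)
pose T := k1 * k2 / b2.
have T0 : 0 <= T by rewrite divr_ge0 ?ltW.
pose L := CQ + 2 * B.
have often s : exists l, s <= l <= s + T /\ m < w l.
  apply: contrapT => hno; set t := s + T in hno.
  have st : s <= t by rewrite lerDl.
  have small l : s < l < t -> w l <= m.
    by move=> hl; rewrite leNgt; apply/negP => h; apply: hno; exists l; split => //; lra.
  have h1 := primitive_expR_le (k := m) st (weighted_attractor s s t).
  have {}h1 := h1 ltac:(by move=> l /small hl; rewrite ler_wpM2r // mulr_ge0 ?expR_ge0 // ltW).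
  have h2 := primitive_expR_ge (k := - m) st (weighted_repeller t s t).
  have {}h2 := h2 ltac:(by move=> l /small hl; rewrite ler_wpM2r ?lerN2 // mulr_ge0 ?expR_ge0 // ltW).
  have g1 := H1 s t st; have g2 := H2 t s st.
  move: h1 h2; rewrite !oriented_integral_id oppr0 !expR0 !mulr1.
  move: g1 g2; set E1 := oriented_integral _ s t; set E2 := oriented_integral _ t s.
  have -> : t - s = T by rewrite /t; ring.
  have -> : s - t = - T by rewrite /t; ring.
  move=> g1 g2 h1 h2.
  have {}h1 : w t <= w s * (k1 * expR ((m - b1) * T)).
    have : w t <= w s * expR (m * T) * expR E1 by rewrite -ler_pdivrMr ?expR_gt0 // -expRN.
    move=> /le_trans; apply; rewrite -mulrA ler_pM2l //.
    have -> : k1 * expR ((m - b1) * T) = expR (m * T) * (k1 * expR (- b1 * T)).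
      by rewrite mulrBl expRD -mulNr; ring.
    by rewrite ler_pM2l ?expR_gt0.
  have {}h2 : w s <= w t * (k2 * expR ((m - b2) * T)).
    have : w s <= w t * expR (m * T) * expR E2.
      rewrite -ler_pdivrMr ?expR_gt0 // -expRN.
      by rewrite -ler_pdivrMr ?expR_gt0 // -expRN -mulNr.
    move=> /le_trans; apply; rewrite -mulrA ler_pM2l //.
    have -> : k2 * expR ((m - b2) * T) = expR (m * T) * (k2 * expR (b2 * - T)).
      by rewrite mulrBl expRD mulrN; ring.
    by rewrite ler_pM2l ?expR_gt0.
  have : w t * w s <= (w s * (k1 * expR ((m - b1) * T))) * (w t * (k2 * expR ((m - b2) * T))).
    by apply: ler_pM => //; exact: ltW.
  have -> : (w s * (k1 * expR ((m - b1) * T))) * (w t * (k2 * expR ((m - b2) * T))) =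
     w t * w s * (k1 * k2 * (expR ((m - b1) * T) * expR ((m - b2) * T))) by ring.
  rewrite -expRD -{1}(mulr1 (w t * w s)) ler_pM2l ?mulr_gt0 //.
  have : expR ((m - b1) * T + (m - b2) * T) <= expR (- (k1 * k2)).
    rewrite ler_expR; have -> : k1 * k2 = b2 * T by rewrite /T; field; rewrite gt_eqF.
    have : 0 <= (b1 - 2 * m) * T by rewrite mulr_ge0 // subr_ge0.
    by lra.
  move=> h3 h4; have : 1 <= k1 * k2 * expR (- (k1 * k2)).
    by apply: (le_trans h4); rewrite ler_pM2l.
  rewrite expRN ler_pdivlMr ?expR_gt0 // mul1r.
  by have := expR_ge1Dx (k1 * k2); lra.
exists (m * expR (- L * T)); first by rewrite mulr_gt0 ?expR_gt0.
move=> t; have [l [hl ml]] := often (t - T).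
have lt : l <= t by lra.
have pw := primitiveB (global_primitive l t sa) (global_primitive l t sr).
have := primitive_expR_ge (k := - L) lt pw.
have H k : l < k < t -> - L * w k <= riccati Q P k (a k) - riccati Q P k (r k).
  move=> _; have -> : riccati Q P k (a k) - riccati Q P k (r k) = (Q k - a k - r k) * w k.
    by rewrite /riccati; ring.
  rewrite ler_pM2r // /L.
  have := QC k; have := aB k; have := rB k; rewrite !ler_norml.
  by lra.
move=> /(_ H) /(le_trans _); apply.
apply: ler_pM; rewrite ?expR_ge0 ?(ltW m0) ?(ltW ml) //.
rewrite ler_expR !mulNr lerN2 ler_wpM2l //; last by lra.
have := le_trans (normr_ge0 _) (QC 0); have := le_trans (normr_ge0 _) (aB 0).
by rewrite /L; lra.
Qed.

End Hyperbolicity.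

(** * Globally defined solutions and the theorem *)

Section GlobalDynamics.
Variable R : realType.
Implicit Types (s t : R).

Variables (G p ta tr : R -> R) (gm gp delta B : R).
Hypothesis (bG : bounded_measurable G) (bp : bounded_measurable p).
Hypothesis (hGm : G t @[t --> -oo] --> gm) (hGp : G t @[t --> +oo] --> gp).
Hypothesis (sta : solution (fun=> 0) p setT ta) (str : solution (fun=> 0) p setT tr).
Hypothesis (delta0 : 0 < delta) (sep : forall t, delta <= ta t - tr t).
Hypothesis (taB : forall t, `|ta t| <= B) (trB : forall t, `|tr t| <= B).

Local Notation Q := (shiftQ G).
Local Notation P := (shiftP G p).

Let bQ : bounded_measurable Q := shiftQ_bounded bG.
Let bP : bounded_measurable P := shiftP_bounded bG bp.

Variables (beta : \bar R) (a : R -> R) (alpha : \bar R) (r : R -> R).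
Hypothesis (ha : is_frak_a Q P beta a) (hr : is_frak_r Q P alpha r).

Let a_le s (x0 : R) := frak_a_le bG bp hGm sta str delta0 sep taB trB ha (s := s) x0.
Let r_le s (x0 : R) := frak_r_le bG bp hGp sta str delta0 sep taB trB hr (s := s) x0.

Lemma global_ydom b : solution Q P setT b -> forall s t,
  ydom Q P s (b s) t /\ y Q P t s (b s) = b t.
Proof.
move=> sb s t; have [sub yE] := y_greatest bQ bP sb (s := s) I.
by split; [exact: sub|rewrite -yE].
Qed.

Lemma global_le_frak_a b s : solution Q P setT b -> (s%:E < beta)%E -> b s <= a s.
Proof. by move=> sb sbeta; apply/(a_le _ sbeta) => t _; exact: (global_ydom sb s t).1. Qed.

Lemma frak_r_le_global b s : solution Q P setT b -> (alpha < s%:E)%E -> r s <= b s.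
Proof. by move=> sb salpha; apply/(r_le _ salpha) => t _; exact: (global_ydom sb s t).1. Qed.

(** Lying above a bounded solution, [a] cannot tend to [-oo] in finite time. *)
Lemma bounded_solution_beta b : bounded_solution Q P b -> beta = +oo%E.
Proof.
move=> [sb [M bM]]; have [nb _ _ lim] := ha.
move: nb lim (@global_le_frak_a b ^~ sb); case: (beta) => [c _|//|//] lim le_a.
have L : a t @[t --> c^'-] --> -oo by exact: lim.
have /cvgrNyPle /(_ (- M - 1)) := L.
rewrite /at_left near_withinE => /nbhs_ballP[e /= e0 H].
have [h1 h2] : c - e / 2 < c /\ ball c e (c - e / 2).
  rewrite /ball /= (_ : c - (c - e / 2) = e / 2); last by ring.
  by rewrite gtr0_norm; [split; lra|lra].
have h3 : b (c - e / 2) <= a (c - e / 2) by apply: le_a; rewrite lte_fin.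
suff : (1 : R) <= 0 by rewrite ler10.
have := H _ h2 h1; move: h3.
by have := bM (c - e / 2); rewrite ler_norml; lra.
Qed.

Lemma bounded_solution_alpha b : bounded_solution Q P b -> alpha = -oo%E.
Proof.
move=> [sb [M bM]]; have [nb _ _ lim] := hr.
move: nb lim (@frak_r_le_global b ^~ sb); case: (alpha) => [c _|//|//] lim le_r.
have L : r t @[t --> c^'+] --> +oo by exact: lim.
have /cvgryPge /(_ (M + 1)) := L.
rewrite /at_right near_withinE => /nbhs_ballP[e /= e0 H].
have [h1 h2] : c < c + e / 2 /\ ball c e (c + e / 2).
  rewrite /ball /= (_ : c - (c + e / 2) = - (e / 2)); last by ring.
  by rewrite normrN gtr0_norm; [split; lra|lra].
have h3 : r (c + e / 2) <= b (c + e / 2) by apply: le_r; rewrite lte_fin.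
suff : (1 : R) <= 0 by rewrite ler10.
have := H _ h2 h1; move: h3.
by have := bM (c + e / 2); rewrite ler_norml; lra.
Qed.

Section Global.
Hypothesis (betaE : beta = +oo%E) (alphaE : alpha = -oo%E).

Let below_beta s : (s%:E < beta)%E. Proof. by rewrite betaE ltry. Qed.
Let above_alpha s : (alpha < s%:E)%E. Proof. by rewrite alphaE ltNyr. Qed.

Let sa : solution Q P setT a.
Proof.
have [_ [s _] _ _] := ha; apply: (solution_sub s) => //.
by move=> t _; exact: below_beta.
Qed.

Let sr : solution Q P setT r.
Proof.
have [_ [s _] _ _] := hr; apply: (solution_sub s) => //.
by move=> t _; exact: above_alpha.
Qed.

Hypothesis (neq : a <> r).

(** A global solution exists for all past times, hence lies below [a]; this applies
    to [r]. *)
Lemma frak_lt t : r t < a t.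
Proof.
have [t0 h0] : exists t0, r t0 <> a t0.
  apply: contrapT => hno; apply: neq; apply/funext => l.
  by apply: contrapT => h; apply: hno; exists l => /esym.
apply: (solution_lt bQ bP sr sa (s := t0) I I).
rewrite lt_neqAle; apply/andP; split; first exact/eqP.
exact: global_le_frak_a.
Qed.

Let M0 : 0 <= B. Proof. exact: le_trans (normr_ge0 _) (taB 0). Qed.

(** In the past [r] is a solution below [a], so it approaches the repeller. *)
Lemma frak_near_ninfty e : 0 < e -> exists T, forall t, t <= T ->
  `|a t - (ta t + gm)| <= e /\ `|r t - (tr t + gm)| <= e.
Proof.
move=> e0.
have /cvg0_ninftyP /(_ e e0) [T1 H1] := frak_a_cvg bG bp hGm sta str delta0 sep taB trB ha.
have [_] := below_frak_a bG bp hGm sta str delta0 sep taB trB ha (below_beta 0) (frak_lt 0).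
move=> /cvg0_ninftyP /(_ e e0) [T2 H2].
exists (Num.min T1 T2) => t; rewrite le_min => /andP[t1 t2]; split.
  by have := H1 t t1; rewrite normr_id.
by have := H2 t t2; rewrite normr_id (global_ydom sr 0 t).2.
Qed.

Lemma frak_near_pinfty e : 0 < e -> exists T, forall t, T <= t ->
  `|a t - (ta t + gp)| <= e /\ `|r t - (tr t + gp)| <= e.
Proof.
move=> e0.
have /cvg0_pinftyP /(_ e e0) [T1 H1] := frak_r_cvg bG bp hGp sta str delta0 sep taB trB hr.
have [_] := above_frak_r bG bp hGp sta str delta0 sep taB trB hr (above_alpha 0) (frak_lt 0).
move=> /cvg0_pinftyP /(_ e e0) [T2 H2].
exists (Num.max T1 T2) => t; rewrite ge_max => /andP[t1 t2]; split.
  by have := H2 t t2; rewrite normr_id (global_ydom sa 0 t).2.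
by have := H1 t t1; rewrite normr_id.
Qed.

(** Near both ends the pair is close to a translate of [(ta, tr)], and on the compact
    interval in between the continuous gap has a positive minimum. *)
Lemma frak_separated : exists2 d, 0 < d & forall t, d <= a t - r t.
Proof.
have e0 : 0 < delta / 4 by rewrite divr_gt0.
have [T1 H1] := frak_near_ninfty e0; have [T2 H2] := frak_near_pinfty e0.
pose c := Num.min T1 T2; pose d := Num.max T1 T2.
have cd : c <= d by rewrite /c /d ge_min le_max lexx.
have cT1 : c <= T1 by rewrite /c ge_min lexx.
have T2d : T2 <= d by rewrite /d le_max lexx orbT.
have cw : continuous (fun t => a t - r t).
  apply: (linear_continuous (g := fun t => riccati Q P t (a t) - riccati Q P t (r t))) => c' d'.
  by apply: primitiveB; exact: (global_primitive bQ bP c' d').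
have [m m0 Hm] := positive_lower_bound cd cw (fun t _ => etrans (subr_gt0 _ _) (frak_lt t)).
exists (Num.min m (delta / 2)); first by rewrite lt_min m0 divr_gt0.
have far t k : `|a t - (ta t + k)| <= delta / 4 -> `|r t - (tr t + k)| <= delta / 4 ->
    delta / 2 <= a t - r t.
  by rewrite !ler_norml; have := sep t; lra.
move=> t; rewrite ge_min; have [tc|ct] := leP t c.
  by apply/orP; right; have [h1 h2] := H1 t (le_trans tc cT1); exact: far h1 h2.
have [dt|td] := leP d t.
  by apply/orP; right; have [h1 h2] := H2 t (le_trans T2d dt); exact: far h1 h2.
by apply/orP; left; apply: Hm; rewrite (ltW ct) (ltW td).
Qed.

Lemma frak_bounded : exists M : R, forall t, `|a t| <= M /\ `|r t| <= M.
Proof.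
have [T1 H1] := frak_near_ninfty ltr01; have [T2 H2] := frak_near_pinfty ltr01.
have [Ma Ma0 HMa] := lipschitz_bounded (global_primitive bQ bP T1 T2 sa).1.
have [Mr Mr0 HMr] := lipschitz_bounded (global_primitive bQ bP T1 T2 sr).1.
have far (x z : R -> R) (k t : R) : `|z t| <= B -> `|x t - (z t + k)| <= 1 -> `|x t| <= 1 + B + `|k|.
  move=> zB h; have -> : x t = (x t - (z t + k)) + (z t + k) by ring.
  apply: le_trans (ler_normD _ _) _; rewrite -addrA; apply: lerD => //.
  by apply: le_trans (ler_normD _ _) _; rewrite lerD2r.
exists (1 + B + `|gm| + `|gp| + Ma + Mr) => t.
have [g1 g2] := (normr_ge0 gm, normr_ge0 gp).
have [tT|Tt] := leP t T1.
  have [h1 h2] := H1 t tT.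
  by have := far _ _ _ _ (taB t) h1; have := far _ _ _ _ (trB t) h2; split; lra.
have [tT2|Tt2] := leP T2 t.
  have [h1 h2] := H2 t tT2.
  by have := far _ _ _ _ (taB t) h1; have := far _ _ _ _ (trB t) h2; split; lra.
have ht : T1 <= t <= T2 by rewrite !ltW.
by have := HMa t ht; have := HMr t ht; have := M0; split; lra.
Qed.

Lemma frak_attractor_repeller :
  uniformly_separated r a /\ attractor_repeller Q P a r.
Proof.
have [d d0 Hd] := frak_separated; have [M HM] := frak_bounded.
split.
  split; first by move=> t; exact/ltW/frak_lt.
  apply: (lt_le_trans d0); apply: lb_le_inf; first by exists (a 0 - r 0); exists 0.
  by move=> _ [t _ <-].
have wM t : a t - r t <= M + M.
  by have [] := HM t; rewrite !ler_norml; lra.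
split.
- split; first by split => //; exists M => t; case: (HM t).
  exact: (separated_attractive bQ bP sa sr d0 Hd wM).
- split; first by split => //; exists M => t; case: (HM t).
  exact: (separated_repulsive bQ bP sa sr d0 Hd wM).
- move=> b [sb _] t; apply/andP; split; first exact: frak_r_le_global.
  exact: global_le_frak_a.
Qed.

End Global.

(** If [a] and [r] differed, [a] would be hyperbolic; and a bounded solution lies
    between [r] and [a]. *)
Lemma no_hyperbolic_unique b : ~ (exists h, hyperbolic Q P h) ->
  bounded_solution Q P b -> [/\ beta = +oo%E, alpha = -oo%E, b = a & b = r].
Proof.
move=> nohyp bb; have bE := bounded_solution_beta bb.
have aE := bounded_solution_alpha bb.
have ar : a = r.
  apply: contrapT => neq; apply: nohyp; exists a; left.
  by have [_ []] := frak_attractor_repeller bE aE neq.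
have ba : b = a.
  apply/funext => t; have [sb _] := bb; apply/eqP; rewrite eq_le.
  apply/andP; split; first by apply: global_le_frak_a => //; rewrite bE ltry.
  by rewrite ar; apply: frak_r_le_global => //; rewrite aE ltNyr.
by split => //; rewrite ba.
Qed.

End GlobalDynamics.

Theorem theorem3p4 (R : realType) (G p : R -> R) (gm gp : R)
  (ta tr : R -> R)
  (hG : BPUC G) (hp : BPUC p)
  (hgm : G t @[t --> -oo] --> gm)
  (hgp : G t @[t --> +oo] --> gp)
  (hpair : attractor_repeller (fun _ => 0) p ta tr) :
  let Q := shiftQ G in
  let P := shiftP G p in
  let tam := fun t => ta t + gm in
  let trm := fun t => tr t + gm in
  let tap := fun t => ta t + gp in
  let trp := fun t => tr t + gp in
  (* the translated pairs solve the limit equations *)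
  (attractor_repeller (shiftQ (fun _ => gm)) (shiftP (fun _ => gm) p) tam trm /\
   attractor_repeller (shiftQ (fun _ => gp)) (shiftP (fun _ => gp) p) tap trp)
  /\
  (* (i) *)
  ((exists D x, maximal_solution Q P D x /\ bounded_at_ninfty D x) /\
   (exists D x, maximal_solution Q P D x /\ bounded_at_pinfty D x) /\
   (exists beta a, is_frak_a Q P beta a) /\
   (exists alpha r, is_frak_r Q P alpha r))
  /\
  forall (beta : \bar R) (a : R -> R) (alpha : \bar R) (r : R -> R),
  is_frak_a Q P beta a -> is_frak_r Q P alpha r ->
  [/\ (* (ii) *)
      [/\ `|a t - tam t| @[t --> -oo] --> 0,
          forall s y0, (s%:E < beta)%E -> y0 < a s ->
            (\forall t \near -oo, ydom Q P s y0 t) /\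
            `|y Q P t s y0 - trm t| @[t --> -oo] --> 0,
          `|r t - trp t| @[t --> +oo] --> 0 &
          forall s y0, (alpha < s%:E)%E -> r s < y0 ->
            (\forall t \near +oo, ydom Q P s y0 t) /\
            `|y Q P t s y0 - tap t| @[t --> +oo] --> 0],
      (* (iii) *)
      locally_pullback_attractive Q P beta a /\
      locally_pullback_repulsive Q P alpha r,
      (* (iv) *)
      beta = +oo%E -> alpha = -oo%E -> a <> r ->
        uniformly_separated r a /\ attractor_repeller Q P a r &
      (* (v) *)
      ~ (exists b, hyperbolic Q P b) ->
        (forall b1 b2, bounded_solution Q P b1 -> bounded_solution Q P b2 ->
           b1 = b2) /\
        (forall b, bounded_solution Q P b ->
           [/\ beta = +oo%E, alpha = -oo%E, b = a & b = r])].
Proof.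
have bG := BPUC_bounded_measurable hG; have bp := BPUC_bounded_measurable hp.
have b0 : bounded_measurable (fun=> 0 : R).
  by split; [exact: measurable_cst|exists 0 => t; rewrite normr0].
have [[[sta [Ma HMa]] atta] [[str [Mr HMr]] repr] bnd] := hpair.
pose B := Num.max Ma Mr.
have taB t : `|ta t| <= B by rewrite le_max HMa.
have trB t : `|tr t| <= B by rewrite le_max HMr orbT.
have ra t : tr t <= ta t.
  by have /andP[] := bnd tr (conj str (ex_intro _ Mr HMr)) t.
have [delta delta0 sep] := hyperbolic_pair_separated b0 bp sta str taB trB ra atta repr.
have bQ := shiftQ_bounded bG; have bP := shiftP_bounded bG bp.
move=> Q P tam trm tap trp.
have [beta0 [a0 ha0]] := frak_a_exists bG bp hgm sta str delta0 sep taB trB.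
have [alpha0 [r0 hr0]] := frak_r_exists bG bp hgp sta str delta0 sep taB trB.
split; first by split; exact: attractor_repeller_translate.
split.
  split; last split; last by split; [exists beta0, a0|exists alpha0, r0].
    have [s sb] := frak_a_domain ha0.
    exists (ydom Q P s (a0 s)), (fun t => y Q P t s (a0 s)).
    split; first exact: y_maximal.
    by have [_ _ hiff _] := ha0; apply/(hiff s (a0 s) sb).
  have [s sb] : exists s : R, (alpha0 < s%:E)%E.
    have [nal _ _ _] := hr0; case: (alpha0) nal => [c _|//|_]; last by exists 0; exact: ltNyr.
    by exists (c + 1); rewrite lte_fin ltrDl.
  exists (ydom Q P s (r0 s)), (fun t => y Q P t s (r0 s)).
  split; first exact: y_maximal.
  by have [_ _ hiff _] := hr0; apply/(hiff s (r0 s) sb).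
move=> beta a alpha r ha hr; split.
- split.
  + exact: (frak_a_cvg bG bp hgm sta str delta0 sep taB trB ha).
  + move=> s x0 sb xa.
    have [D lim] := below_frak_a bG bp hgm sta str delta0 sep taB trB ha sb xa.
    by split => //; apply/near_ninftyP; exists s.
  + exact: (frak_r_cvg bG bp hgp sta str delta0 sep taB trB hr).
  + move=> s x0 sb rx.
    have [D lim] := above_frak_r bG bp hgp sta str delta0 sep taB trB hr sb rx.
    by split => //; apply/near_pinftyP; exists s.
- split; first exact: (frak_a_pullback_attractive bG bp hgm sta str delta0 sep taB trB ha).
  exact: (frak_r_pullback_repulsive bG bp hgp sta str delta0 sep taB trB hr).
- move=> bE aE neq.
  exact: (frak_attractor_repeller bG bp hgm hgp sta str delta0 sep taB trB ha hr bE aE neq).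
move=> nohyp.
have U b : bounded_solution Q P b -> [/\ beta = +oo%E, alpha = -oo%E, b = a & b = r].
  exact: (no_hyperbolic_unique bG bp hgm hgp sta str delta0 sep taB trB ha hr nohyp).
by split => // b1 b2 /U[_ _ -> _] /U[_ _ -> _].
Qed.
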